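(* Let $C_0\ge1$, $D_0>0$ and $k>k_*$. There exists a positive constant $C_{\mathrm{global},5}$, depending only on $R$, $k_*$, $\Sigma$, $C_0$ and $D_0$, such that for every true mixing measure $G_*=\sum_{j=1}^{k_*}\pi_j^*\delta_{\theta_j^*}$ (as in the context) satisfying the multi-cluster condition with parameters $C_0,D_0$ (defined in the context), with largest cluster size $s_{\max}$, $$d_H(p_G,p_{G_*})\ \ge\ C_{\mathrm{global},5}\,\Delta_{\mathrm{sep}}^{2s_{\max}-2}\,W_2^2(G,G_* )$$ uniformly for all $G\in\mathcal{G}_k(\Theta)$ (at most $k$ components). As a consequence, there exist positive constants $C_{\mathrm{density}},c_{\mathrm{density}}$ (the constants of the density estimation rate, see context) depending only on $\Theta$ and $k_*$ such that, for the over-specified maximum likelihood estimator $\widehat G_n$ over $\mathcal{G}_k(\Theta)$, $$\mathbb{P}\left(W_2(\widehat G_n,G_* )>\Big(\frac{C_{\mathrm{density}}}{C_{\mathrm{global},5}}\Big)^{1/2}\Big(\frac{d\log n}{n}\Big)^{1/4}\Delta_{\mathrm{sep}}^{-(s_{\max}-1)}\right)\ \lesssim\ \exp(-c_{\mathrm{density}}\log n).$$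
   Context: Setting. $\Sigma$ is a known, fixed symmetric positive-definite $d\times d$ matrix with eigenvalues in $[\lambda_{\min},\lambda_{\max}]$, $0<\lambda_{\min}\le\lambda_{\max}$; $f(\cdot\mid\theta,\Sigma)$ is the density of the Gaussian $N(\theta,\Sigma)$ on $\mathbb{R}^d$. $\Theta\subset\mathbb{R}^d$ is compact and contained in the closed ball of radius $R>0$ centred at $0$. For a discrete probability measure $G=\sum_i\pi_i\delta_{\theta_i}$ put $p_G(x)=\sum_i\pi_i f(x\mid\theta_i,\Sigma)$. The true mixing measure is $G_*=\sum_{j=1}^{k_*}\pi_j^*\delta_{\theta_j^*}$ with $k_*\ge 2$, $\theta_j^*\in\Theta$, $\pi_j^*>0$, $\sum_j\pi_j^*=1$. Put $\Delta_{\mathrm{sep}}=\min_{j\ne l}\|\theta_j^*-\theta_l^*\|$ (Euclidean norm), assumed positive. Multi-cluster condition. The true atoms are partitioned into $k_0$ disjoint clusters $\mathcal{C}_1,\dots,\mathcal{C}_{k_0}$ such that: (intra-cluster) $\|\theta_j^*-\theta_q^*\|\le C_0\Delta_{\mathrm{sep}}$ for any two $\theta_j^*\ne\theta_q^*$ in the same $\mathcal{C}_m$; (inter-cluster) $\|\theta_j^*-\theta_p^*\|\ge D_0$ whenever $\theta_j^*\in\mathcal{C}_m$ and $\theta_p^*\notin\mathcal{C}_m$; and $\Delta_{\mathrm{sep}}\le D_0/(4C_0)$. Put $s_m=|\mathcal{C}_m|$ and $s_{\max}=\max_{1\le m\le k_0}s_m$. $\mathcal{G}_k(\Theta)=\{\sum_{i=1}^{k'}\pi_i\delta_{\theta_i}:1\le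 k'\le k,\ \theta_i\in\Theta,\ 0\le\pi_i\le1,\ \sum_i\pi_i=1\}$. Hellinger distance: $d_H(p,q)=\big(\tfrac12\int(\sqrt p-\sqrt q)^2dx\big)^{1/2}$. $W_2$ is the 2-Wasserstein distance with respect to the Euclidean norm. Estimator. $X_1,\dots,X_n$ are i.i.d. with density $p_{G_*}$, and $\widehat G_n\in\arg\max_{G\in\mathcal{G}_k(\Theta)}\frac1n\sum_{i=1}^n\log p_G(X_i)$. Probabilities are under the true law. $\lesssim$ means inequality up to a positive multiplicative constant independent of $n$ and $G_*$. $C_{\mathrm{density}},c_{\mathrm{density}}$ are the constants in the density estimation bound $\mathbb{P}(d_H(p_{\widehat G_n},p_{G_*})>C_{\mathrm{density}}[d\log(n)/n]^{1/2})\lesssim n^{-c_{\mathrm{density}}}$. *)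

(* Defs.v *)
From HB Require Import structures.
From mathcomp Require Import all_boot all_order all_algebra.
From mathcomp Require Import all_classical all_reals all_analysis.
Set Implicit Arguments.
Unset Strict Implicit.
Unset Printing Implicit Defensive.
Import Order.TTheory GRing.Theory Num.Theory.
Import numFieldNormedType.Exports.
Local Open Scope classical_set_scope.
Local Open Scope ring_scope.

Definition tcons (T : Type) (n : nat) (xt : T * n.-tuple T) : n.+1.-tuple T :=
  [tuple of xt.1 :: xt.2].

Section lebesgue_tuple.
Context {R : realType} (n : nat).
Let TR := measurableTypeR R.
Variable m : {sigma_finite_measure set (n.-tuple TR) -> \bar R}.

Lemma measurable_tcons : measurable_fun [set: TR * n.-tuple TR] (@tcons TR n).
Proof. exact: measurable_cons. Qed.

Definition lebesgue_cons : set (n.+1.-tuple TR) -> \bar R :=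
  pushforward (lebesgue_measure \x m)%E (@tcons TR n).

Let preimage_tcons (A : set (n.+1.-tuple TR)) :
  measurable A -> measurable (@tcons TR n @^-1` A).
Proof. by rewrite -[X in _ -> measurable X]setTI; exact: measurable_tcons. Qed.

Let lebesgue_cons0 : lebesgue_cons set0 = 0%E.
Proof. by rewrite /lebesgue_cons /pushforward preimage_set0 measure0. Qed.

Let lebesgue_cons_ge0 A : (0 <= lebesgue_cons A)%E.
Proof. exact: (measure_ge0 (lebesgue_measure \x m)%E). Qed.

Let lebesgue_cons_sigma_additive : semi_sigma_additive lebesgue_cons.
Proof.
move=> F mF tF mUF; rewrite /lebesgue_cons /pushforward preimage_bigcup.
apply: measure_semi_sigma_additive.
- by move=> i; exact: preimage_tcons.
- apply/trivIsetP => /= i j _ _ ij; rewrite -preimage_setI.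
  by move/trivIsetP : tF => /(_ _ _ _ _ ij) ->//; rewrite preimage_set0.
- by rewrite -preimage_bigcup; exact: preimage_tcons.
Qed.

HB.instance Definition _ := isMeasure.Build _ _ _ lebesgue_cons
  lebesgue_cons0 lebesgue_cons_ge0 lebesgue_cons_sigma_additive.

Lemma lebesgue_cons_sigma_finite : sigma_finite setT lebesgue_cons.
Proof.
have /sigma_finiteP[F [FT ndF Foo]] :=
  sigma_finiteT (@lebesgue_measure R : {sigma_finite_measure set TR -> \bar R}).
have /sigma_finiteP[G [GT ndG Goo]] := sigma_finiteT m.
pose g (t : n.+1.-tuple TR) : TR * n.-tuple TR :=
  (thead t, [tuple of behead t]).
have mg : measurable_fun setT g.
  apply: measurable_fun_pair; first exact: measurable_tnth.
  exact: measurable_behead.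
have gK : cancel (@tcons TR n) g.
  by case=> x t; congr pair; apply/val_inj.
exists (fun i => g @^-1` (F i `*` G i)) => [|i].
  apply/esym/seteqP; split => // t _.
  have [i _ Fi] : (\bigcup_i F i) (g t).1 by rewrite -FT.
  have [j _ Gj] : (\bigcup_i G i) (g t).2 by rewrite -GT.
  exists (maxn i j) => //; split.
  - by move/subsetPset : (ndF _ _ (leq_maxl i j)); apply.
  - by move/subsetPset : (ndG _ _ (leq_maxr i j)); apply.
have [mF Fioo] := Foo i; have [mG Gioo] := Goo i; split.
  by rewrite -[X in measurable X]setTI; apply: mg => //; exact: measurableX.
rewrite /lebesgue_cons /pushforward.
rewrite [X in (_ X < _)%E](_ : _ = F i `*` G i).
  by rewrite product_measure1E// lte_mul_pinfty// ge0_fin_numE.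
by apply/seteqP; split => xt; rewrite /preimage /mkset gK.
Qed.

HB.instance Definition _ :=
  Measure_isSigmaFinite.Build _ _ _ lebesgue_cons lebesgue_cons_sigma_finite.

End lebesgue_tuple.

(* Lebesgue measure on R^d (the product of d copies of the Lebesgue measure on
   R), on the d-tuples because these carry the product sigma-algebra; matrices
   have no measurable structure in the library. *)
Fixpoint lebesgue_tuple {R : realType} (d : nat) :
    {sigma_finite_measure set (d.-tuple (measurableTypeR R)) -> \bar R} :=
  if d is n.+1 then lebesgue_cons (lebesgue_tuple n) else \d_[tuple].

Definition rv_of_tuple {R : realType} {d : nat} (t : d.-tuple R) : 'rV[R]_d :=
  \row_i tnth t i.

(* The norm `|u| of the library on 'rV[R]_d is the sup norm. *)
Definition enorm {R : realType} {d : nat} (u : 'rV[R]_d) : R :=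
  Num.sqrt (\sum_i u 0 i ^+ 2).

Definition sym_posdef {R : realType} {d : nat} (S : 'M[R]_d) : Prop :=
  S^T = S /\ forall u : 'rV[R]_d, u != 0 -> 0 < (u *m S *m u^T) 0 0.

Definition gauss_pdf {R : realType} {d : nat} (theta : 'rV[R]_d) (S : 'M[R]_d)
    (x : 'rV[R]_d) : R :=
  (Num.sqrt ((2 * pi) ^+ d * \det S))^-1 *
  expR (- ((x - theta) *m invmx S *m (x - theta)^T) 0 0 / 2).

(* A finitely supported probability measure \sum_i weight_i \delta_(atom_i).
   Atoms may be repeated and weights may vanish, so that several terms can
   denote one measure; mixture_pdf and wasserstein2 only depend on the measure.
   In true_mixing, 0 < sep G makes the atoms pairwise distinct. *)
Record mixing (R : realType) (d : nat) := Mixing {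
  natoms : nat;
  weight : 'I_natoms -> R;
  atom : 'I_natoms -> 'rV[R]_d;
  weight_ge0 : forall i, 0 <= weight i;
  weight_sum1 : \sum_i weight i = 1 }.
Arguments weight {R d} G i : rename.
Arguments atom {R d} G i : rename.

Definition mixture_pdf {R : realType} {d : nat} (S : 'M[R]_d) (G : mixing R d)
    (x : 'rV[R]_d) : R :=
  \sum_i weight G i * gauss_pdf (atom G i) S x.

Definition mixing_class {R : realType} {d : nat} (k : nat)
    (Theta : set 'rV[R]_d) (G : mixing R d) : Prop :=
  (1 <= natoms G <= k)%N /\ forall i, Theta (atom G i).

Definition hellinger {R : realType} {d : nat} (p q : 'rV[R]_d -> R) : R :=
  Num.sqrt (2^-1 * \int[lebesgue_tuple d]_t
    (Num.sqrt (p (rv_of_tuple t)) - Num.sqrt (q (rv_of_tuple t))) ^+ 2).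

Definition is_coupling {R : realType} {d : nat} (G H : mixing R d)
    (q : 'M[R]_(natoms G, natoms H)) : Prop :=
  [/\ forall i j, 0 <= q i j,
      forall i, \sum_j q i j = weight G i &
      forall j, \sum_i q i j = weight H j].

Definition wasserstein2 {R : realType} {d : nat} (G H : mixing R d) : R :=
  Num.sqrt (inf [set \sum_i \sum_j q i j * enorm (atom G i - atom H j) ^+ 2
                | q in @is_coupling R d G H]).

(* The infimum of a finite set, nonempty when there are two atoms or more. *)
Definition sep {R : realType} {d : nat} (G : mixing R d) : R :=
  inf [set enorm (atom G jl.1 - atom G jl.2)
      | jl in [set jl : 'I_(natoms G) * 'I_(natoms G) | jl.1 != jl.2]].

Definition true_mixing {R : realType} {d : nat} (ks : nat)
    (Theta : set 'rV[R]_d) (G : mixing R d) : Prop :=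
  [/\ natoms G = ks,
      forall j, Theta (atom G j),
      forall j, 0 < weight G j &
      0 < sep G].

Definition multi_cluster {R : realType} {d : nat} (C0 D0 : R) (G : mixing R d)
    (C : {set {set 'I_(natoms G)}}) : Prop :=
  [/\ finset.partition C [set: 'I_(natoms G)]%SET,
      forall (B : {set 'I_(natoms G)}) j q, B \in C -> j \in B -> q \in B ->
        j != q -> enorm (atom G j - atom G q) <= C0 * sep G,
      forall (B : {set 'I_(natoms G)}) j p, B \in C -> j \in B -> p \notin B ->
        D0 <= enorm (atom G j - atom G p) &
      sep G <= D0 / (4 * C0)].

Definition max_cluster {T : finType} (C : {set {set T}}) : nat :=
  (\max_(B in C) #|B|)%N.

Definition iid_sample {R : realType} {d : nat} {disp : measure_display}
    {Omega : measurableType disp} (P : probability Omega R) (n : nat)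
    (X : 'I_n -> {mfun Omega >-> d.-tuple (measurableTypeR R)})
    (p : 'rV[R]_d -> R) : Prop :=
  (forall i A, measurable A ->
    P (X i @^-1` A) = (\int[lebesgue_tuple d]_(t in A) (p (rv_of_tuple t))%:E)%E)
  /\
  (forall A : 'I_n -> set (d.-tuple (measurableTypeR R)),
    (forall i, measurable (A i)) ->
    P (\bigcap_i (X i @^-1` A i)) = (\prod_(i < n) P (X i @^-1` A i))%E).

Definition avg_loglik {R : realType} {d : nat} (S : 'M[R]_d) (n : nat)
    (x : 'I_n -> 'rV[R]_d) (G : mixing R d) : R :=
  n%:R^-1 * \sum_i ln (mixture_pdf S G (x i)).

Definition is_mle {R : realType} {d : nat} (k : nat) (Theta : set 'rV[R]_d)
    (S : 'M[R]_d) (n : nat) (x : 'I_n -> 'rV[R]_d) (G : mixing R d) : Prop :=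
  mixing_class k Theta G /\
  forall G', mixing_class k Theta G' -> avg_loglik S x G' <= avg_loglik S x G.

(* Main.v *)
From HB Require Import structures.
From mathcomp Require Import all_boot all_order all_algebra.
From mathcomp Require Import all_classical all_reals all_analysis.
From mathcomp Require Import measurable_realfun zify lra ring.
From mathcomp Require polyrcf.
Require Import Defs.

(** For every polynomial T, the difference of the means of T under G and G* is O(h), where h is
    the Hellinger distance of the two mixtures: the Gaussian location family has polynomials that
    are unbiased for T, and two densities at Hellinger distance h integrate such functions up to
    O(h). Applied to the product of the squared distances to the true atoms, this shows that the
    mass of G sits near the true atoms; applied to polynomials that agree with the indicator
    function of the cell of one atom, or of the cells of one cluster, it compares the masses of
    cells and of clusters. An explicit coupling, that first rebalances the masses inside the
    clusters and then between them, turns these estimates into the bound on W_2^2; each of the at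
    most s_max - 1 other atoms of a cluster costs two factors Delta_sep.

    The density estimation rate is a PAC-Bayesian bound with a constant that depends neither on k
    nor on Sigma. If W is the mean, under a prior on densities q, of the products of
    sqrt(q/p)(X_i), each divided by its approximate expectation, then W has mean at most 1. Near
    p = p_{G*}, p_G - p is expanded along the monomials of G - G*: all of them are O(h) with
    geometric constants, so that p_G is the mean of perturbations p + h U whose signs are biased
    by the moments of G. Such a posterior has density at most 2 with respect to a fixed symmetric
    prior, so that its complexity does not depend on G; replacing the mean by averages of finitely
    many draws costs a small multiple of n h^2, and the likelihood inequality gives
    n h^2 <= 4 log n + O(1). Away from p, a finite grid of atoms suffices. *)

Set Implicit Arguments.
Unset Strict Implicit.
Unset Printing Implicit Defensive.
Import Order.TTheory GRing.Theory Num.Theory.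
Import numFieldNormedType.Exports.
Local Open Scope classical_set_scope.
Local Open Scope ring_scope.

(** * Lebesgue integrals of functions of a row vector *)

(** The constants of the density rate are fixed before [Sigma] and [k], whereas covering numbers of
    the mixture class would bring both into the rate. Only [K] may depend on them, and it absorbs
    every additive constant: below some [n0] the bound [K / n] exceeds 1, and beyond it the
    constants are at most [ln n]. What is left, [n * h ^+ 2 <= 5 * ln n], contradicts
    [h > 3 * sqrt (d * ln n / n)], whence the value 3 of the constant. The exponent 1 comes from a
    union of about [n] events of probability [n ^- 2] and from Chebyshev bounds of order [1 / n].

    For the Wasserstein bound, the smallness of G away from the true atoms is expressed by the mean
    of a product of squared distances, which is quadratic at each atom. A polynomial that imitates
    an indicator function must therefore match it to second order at the atoms: this is the origin
    of the linear correction in [cell_test] and of the squares in [block_test]. All coefficients are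
    tracked as explicit powers of [sep], without any compactness argument, so that the constants
    survive the merging of true atoms. *)

Section lebesgue_translation.
Context {R : realType}.
Let TR := measurableTypeR R.
Local Notation leb := (@lebesgue_measure R).

Lemma measurable_addr (c : R) : measurable_fun [set: TR] (fun x : TR => x + c : TR).
Proof. by apply: measurable_funD => //; exact: measurable_id. Qed.

Lemma lebesgue_measure_translation (c : R) (A : set TR) : measurable A ->
  pushforward leb (fun x : TR => x + c : TR) A = leb A.
Proof.
have mc := measurable_addr c.
pose m : {measure set TR -> \bar R} :=
  measure_function_pushforward__canonical__measure_function_Measure leb mc.
have H X : ocitv X -> leb X = m X.
  move=> [[a b]] _ <-; rewrite /m/= /pushforward.
  rewrite (_ : _ @^-1` _ = `](a - c), (b - c)]%classic); last first.
    by apply/seteqP; split=> x /=; rewrite !in_itv/= ltrBlDr lerBrDr.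
  rewrite !lebesgue_measure_itv/= !lte_fin ltrD2r.
  by case: ifP => // _; rewrite -!EFinB; congr EFin; ring.
by move=> mA; rewrite (lebesgue_measure_unique H mA).
Qed.

Lemma ge0_integral_translation (c : R) (f : TR -> \bar R) :
  measurable_fun setT f -> (forall x, 0 <= f x)%E ->
  (\int[leb]_x f (x + c)%R = \int[leb]_x f x)%E.
Proof.
move=> mf f0.
rewrite -(@ge0_integral_pushforward _ _ _ _ _ _ (measurable_addr c) leb setT f)//.
apply: eq_measure_integral; first exact: measurable_addr.
by move=> mc A mA _; exact: lebesgue_measure_translation.
Qed.

Lemma ge0_integral_lebesgue_tupleS n (f : n.+1.-tuple TR -> \bar R) :
  measurable_fun setT f -> (forall x, 0 <= f x)%E ->
  (\int[lebesgue_tuple n.+1]_t f t =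
   \int[leb]_x \int[lebesgue_tuple n]_t f (tcons (x, t)))%E.
Proof.
move=> mf f0 /=; rewrite /lebesgue_cons.
rewrite (@ge0_integral_pushforward _ _ _ _ _ _ (@measurable_tcons R n))//.
rewrite preimage_setT fubini_tonelli1//.
  by apply: measurableT_comp => //; exact: measurable_tcons.
by move=> x; exact: f0.
Qed.

Definition tshift n (a : 'I_n -> R) (t : n.-tuple TR) : n.-tuple TR :=
  [tuple tnth t i + a i | i < n].

Lemma measurable_tshift n (a : 'I_n -> R) : measurable_fun setT (tshift a).
Proof.
apply/measurable_fun_tnthP => i.
rewrite (_ : _ \o _ = fun t => tnth t i + a i); last first.
  by apply/funext => t /=; rewrite tnth_mktuple.
by apply: measurable_funD => //; exact: measurable_tnth.
Qed.

Lemma ge0_integral_tshift n (a : 'I_n -> R) (f : n.-tuple TR -> \bar R) :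
  measurable_fun setT f -> (forall x, 0 <= f x)%E ->
  (\int[lebesgue_tuple n]_t f (tshift a t) = \int[lebesgue_tuple n]_t f t)%E.
Proof.
elim: n a f => [|n IH] a f mf f0.
  by apply: eq_integral => t _; congr f; rewrite [LHS]tuple0 [RHS]tuple0.
have mfs : measurable_fun setT (f \o tshift a).
  by apply: measurableT_comp => //; exact: measurable_tshift.
rewrite [LHS](ge0_integral_lebesgue_tupleS (f := f \o tshift a))//.
rewrite ge0_integral_lebesgue_tupleS//.
pose g x := (\int[lebesgue_tuple n]_t f (tcons (x, t)))%E.
have mx x : measurable_fun setT (fun t => tcons (T := TR) (n:=n) (x, t)).
  apply: measurableT_comp; first exact: measurable_tcons.
  exact: measurable_pair1.
transitivity (\int[leb]_x g (x + a ord0)%R)%E.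
  apply: eq_integral => x _; rewrite /g.
  rewrite -[RHS](IH (fun i => a (lift ord0 i))) => [|//|//].
    apply: eq_integral => t _ /=; congr f; apply: eq_from_tnth => i.
    rewrite tnth_mktuple; case: (unliftP ord0 i) => [j|] ->.
      by rewrite !tnthS tnth_mktuple.
    by rewrite !tnth0.
  by apply: measurableT_comp => //; exact: mx.
apply: ge0_integral_translation.
  apply: (@measurable_fun_fubini_tonelli_F _ _ _ _ _ _ (f \o @tcons TR n)).
    by apply: measurableT_comp => //; exact: measurable_tcons.
  by move=> z /=.
  by move=> x; apply: integral_ge0.
by move=> x; exact: f0.
Qed.

Lemma ge0_integral_lebesgue_tuple_prod n (f : R -> R) (I : R) :
  measurable_fun [set: TR] f -> (forall x, 0 <= f x) ->
  (\int[leb]_x (f x)%:E = I%:E)%E ->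
  (\int[lebesgue_tuple n]_t (\prod_(i < n) f (tnth t i))%:E = (I ^+ n)%:E)%E.
Proof.
move=> mf f0 fI.
have mp k : measurable_fun setT (fun t : k.-tuple TR => \prod_(i < k) f (tnth t i)).
  apply: measurable_prod => i _.
  by apply: measurableT_comp => //; exact: measurable_tnth.
elim: n => [|n IH].
  under eq_integral do rewrite big_ord0.
  by rewrite /= integral_dirac//= diracT mul1e expr0.
rewrite ge0_integral_lebesgue_tupleS; last first.
- by move=> x; rewrite lee_fin prodr_ge0.
- by apply/measurable_EFinP; exact: mp.
transitivity (\int[leb]_x ((f x)%:E * (I ^+ n)%:E))%E.
  apply: eq_integral => x _; rewrite -IH -ge0_integralZl_EFin//.
  - apply: eq_integral => t _; rewrite big_ord_recl tnth0 -EFinM.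
    by congr (_ * _)%:E; apply: eq_bigr => i _; rewrite tnthS.
  - by move=> t _; rewrite lee_fin prodr_ge0.
  - by apply/measurable_EFinP; exact: mp.
rewrite ge0_integralZr//.
- by rewrite fI -EFinM exprS.
- exact/measurable_EFinP.
- by move=> x _; rewrite lee_fin.
- by rewrite lee_fin exprn_ge0// -lee_fin -fI integral_ge0// => x _; rewrite lee_fin.
Qed.

(** Gives strict positivity of integrals: in [rv_int_gt0], a positive function of zero integral
    would make the whole space a null set. *)
Lemma lebesgue_tuple_setT_gt0 n : (0 < lebesgue_tuple n [set: n.-tuple TR])%E.
Proof.
elim: n => [|n IH]; first by rewrite /= diracT lte01.
rewrite /= /lebesgue_cons /pushforward preimage_setT -setXTT product_measure1E//.
have E : (0 < leb setT)%E.
  rewrite -(set_itvNyy R) lebesgue_measure_itv/=.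
  by rewrite lt0y.
exact: (mule_gt0 E IH).
Qed.

Lemma integral_tshift n (a : 'I_n -> R) (f : n.-tuple TR -> \bar R) :
  measurable_fun setT f ->
  (\int[lebesgue_tuple n]_t f (tshift a t) = \int[lebesgue_tuple n]_t f t)%E.
Proof.
move=> mf; rewrite [RHS]integralE [LHS]integralE; congr (_ - _)%E.
  rewrite -[RHS](ge0_integral_tshift a) => [|//|//].
    by apply: eq_integral => t _; rewrite !funeposE.
  exact: measurable_funepos.
rewrite -[RHS](ge0_integral_tshift a) => [|//|//].
  by apply: eq_integral => t _; rewrite !funenegE.
exact: measurable_funeneg.
Qed.

End lebesgue_translation.

Section rv_integral.
Context {R : realType} (d : nat).
Let TR := measurableTypeR R.
Implicit Types (f g : 'rV[R]_d -> R).
Local Notation mu := (lebesgue_tuple d).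

Definition rv_measurable f :=
  measurable_fun [set: d.-tuple TR] (fun t : d.-tuple TR => f (rv_of_tuple t)).

Definition rv_integrable f :=
  mu.-integrable setT (fun t => (f (rv_of_tuple t))%:E).

Definition rv_int f : R := \int[mu]_t f (rv_of_tuple t).

Lemma rv_measurable_cst (c : R) : rv_measurable (fun=> c).
Proof. exact: measurable_cst. Qed.

Lemma rv_measurable_coord i : rv_measurable (fun x => x 0 i).
Proof.
rewrite /rv_measurable (_ : (fun _ => _) = fun t : d.-tuple TR => tnth t i).
  exact: measurable_tnth.
by apply/funext => t; rewrite mxE.
Qed.

Lemma rv_measurableD f g : rv_measurable f -> rv_measurable g ->
  rv_measurable (fun x => f x + g x).
Proof. exact: measurable_funD. Qed.

Lemma rv_measurableM f g : rv_measurable f -> rv_measurable g ->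
  rv_measurable (fun x => f x * g x).
Proof. exact: measurable_funM. Qed.

Lemma rv_measurableB f g : rv_measurable f -> rv_measurable g ->
  rv_measurable (fun x => f x - g x).
Proof. exact: measurable_funB. Qed.

Lemma rv_measurableX f n : rv_measurable f -> rv_measurable (fun x => f x ^+ n).
Proof. exact: measurable_funX. Qed.

Lemma rv_measurable_max f g : rv_measurable f -> rv_measurable g ->
  rv_measurable (fun x => Num.max (f x) (g x)).
Proof. exact: measurable_maxr. Qed.

Lemma rv_measurable_comp (h : R -> R) f : measurable_fun [set: TR] (h : TR -> TR) ->
  rv_measurable f -> rv_measurable (fun x => h (f x)).
Proof. by move=> mh mf; exact: (measurableT_comp mh mf). Qed.

Lemma rv_measurable_expR f : rv_measurable f -> rv_measurable (fun x => expR (f x)).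
Proof. by apply: rv_measurable_comp; exact: measurable_expR. Qed.

Lemma rv_measurable_ln f : rv_measurable f -> rv_measurable (fun x => ln (f x)).
Proof. by apply: rv_measurable_comp; exact: measurable_ln. Qed.

Lemma rv_measurable_norm f : rv_measurable f -> rv_measurable (fun x => `|f x|).
Proof. by apply: rv_measurable_comp; exact: normr_measurable. Qed.

Lemma rv_measurable_sqrt f : rv_measurable f -> rv_measurable (fun x => Num.sqrt (f x)).
Proof.
apply: rv_measurable_comp; apply: continuous_measurable_fun.
exact: sqrt_continuous.
Qed.

Lemma rv_measurable_sum I (s : seq I) (f : I -> 'rV[R]_d -> R) :
  (forall i, rv_measurable (f i)) -> rv_measurable (fun x => \sum_(i <- s) f i x).
Proof. by move=> mf; apply: measurable_sum => i; exact: mf. Qed.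

Lemma rv_measurable_prod (I : eqType) (s : seq I) (f : I -> 'rV[R]_d -> R) :
  (forall i, rv_measurable (f i)) -> rv_measurable (fun x => \prod_(i <- s) f i x).
Proof. by move=> mf; apply: measurable_prod => i _; exact: mf. Qed.

Lemma rv_integrable_meas f : rv_integrable f -> rv_measurable f.
Proof. by move=> /measurable_int /measurable_EFinP. Qed.

Lemma rv_integrable_le f g : rv_measurable f -> rv_integrable g ->
  (forall x, `|f x| <= g x) -> rv_integrable f.
Proof.
move=> mf ig fg; apply: le_integrable ig => //; first exact/measurable_EFinP.
by move=> t _ /=; rewrite lee_fin (le_trans (fg _)) ?ler_norm.
Qed.

Lemma rv_integrableZ (c : R) f : rv_integrable f -> rv_integrable (fun x => c * f x).
Proof.
move=> fi; have := integrableZl measurableT c fi.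
by apply: eq_integrable => // t _.
Qed.

Lemma rv_integrableD f g : rv_integrable f -> rv_integrable g ->
  rv_integrable (fun x => f x + g x).
Proof.
move=> fi gi; have := integrableD measurableT fi gi.
by apply: eq_integrable => // t _.
Qed.

Lemma rv_integrableB f g : rv_integrable f -> rv_integrable g ->
  rv_integrable (fun x => f x - g x).
Proof.
move=> fi gi; have := integrableB measurableT fi gi.
by apply: eq_integrable => // t _.
Qed.

Lemma rv_integrable_sum I (s : seq I) (f : I -> 'rV[R]_d -> R) :
  (forall i, rv_integrable (f i)) -> rv_integrable (fun x => \sum_(i <- s) f i x).
Proof.
move=> fi; have := @integrable_sum _ _ _ mu _ measurableT _ s xpredT
  (fun i t => (f i (rv_of_tuple t))%:E) (fun i _ => fi i).
by apply: eq_integrable => // t _; rewrite sumEFin.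
Qed.

Lemma rv_int_sum I (s : seq I) (f : I -> 'rV[R]_d -> R) :
  (forall i, rv_integrable (f i)) ->
  rv_int (fun x => \sum_(i <- s) f i x) = \sum_(i <- s) rv_int (f i).
Proof.
move=> fi; elim: s => [|i s IH].
  rewrite big_nil /rv_int (_ : (fun _ => _) = cst 0).
    by rewrite /Rintegral integral0.
  by apply/funext => t; rewrite big_nil.
rewrite big_cons -IH /rv_int -RintegralD//.
- by apply: eq_Rintegral => t _; rewrite big_cons.
- exact: fi.
- exact: rv_integrable_sum.
Qed.

Lemma rv_intD f g : rv_integrable f -> rv_integrable g ->
  rv_int (fun x => f x + g x) = rv_int f + rv_int g.
Proof. by move=> fi gi; rewrite /rv_int RintegralD. Qed.

Lemma rv_intB f g : rv_integrable f -> rv_integrable g ->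
  rv_int (fun x => f x - g x) = rv_int f - rv_int g.
Proof. by move=> fi gi; rewrite /rv_int RintegralB. Qed.

Lemma rv_intZ (c : R) f : rv_integrable f -> rv_int (fun x => c * f x) = c * rv_int f.
Proof. by move=> fi; rewrite /rv_int RintegralZl. Qed.

Lemma eq_rv_int f g : f =1 g -> rv_int f = rv_int g.
Proof. by move=> fg; apply: eq_Rintegral => t _; rewrite fg. Qed.

Lemma le_rv_int f g : rv_integrable f -> rv_integrable g ->
  (forall x, f x <= g x) -> rv_int f <= rv_int g.
Proof. by move=> fi gi fg; apply: le_Rintegral => // t _; exact: fg. Qed.

Lemma rv_int_ge0 f : (forall x, 0 <= f x) -> 0 <= rv_int f.
Proof. by move=> f0; apply: Rintegral_ge0 => t _; exact: f0. Qed.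

Lemma EFin_rv_int f : rv_integrable f ->
  ((rv_int f)%:E = \int[mu]_t (f (rv_of_tuple t))%:E)%E.
Proof. by move=> fi; rewrite fineK//; exact: integrable_fin_num. Qed.

Lemma rv_of_tshift (a : 'rV[R]_d) (t : d.-tuple R) :
  rv_of_tuple (tshift (a 0) t) = rv_of_tuple t + a.
Proof. by apply/rowP => i; rewrite !mxE tnth_mktuple. Qed.

Lemma rv_int_shift f a : rv_measurable f -> rv_int (fun x => f (x + a)) = rv_int f.
Proof.
move=> mf; rewrite /rv_int /Rintegral; congr fine.
rewrite -[RHS](integral_tshift (a 0)); last exact/measurable_EFinP.
by apply: eq_integral => t _; rewrite rv_of_tshift.
Qed.

Lemma rv_int_gt0 f : rv_integrable f -> (forall x, 0 < f x) -> 0 < rv_int f.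
Proof.
move=> fi f0; rewrite lt_neqAle rv_int_ge0 ?andbT; last by move=> x; exact: ltW.
apply/eqP => I0.
have := EFin_rv_int fi; rewrite -I0 => /esym I0'.
have mf : measurable_fun setT (fun t => (f (rv_of_tuple t))%:E).
  exact: measurable_int fi.
have /(ae_eq_integral_abs mu measurableT mf)/= : 
    (\int[mu]_t `|(f (rv_of_tuple t))%:E| = 0)%E.
  rewrite -[RHS]I0'; apply: eq_integral => t _.
  by rewrite /= ger0_norm// ltW.
move=> [N [mN N0 sN]].
have : (@lebesgue_tuple R d setT <= 0)%E.
  rewrite -N0; apply: le_measure; rewrite ?inE// => t _; apply: sN => /=.
  by move/(_ I) => [] /eqP; rewrite gt_eqF.
by rewrite leNgt lebesgue_tuple_setT_gt0.
Qed.

End rv_integral.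

(** * Gaussian densities *)

Section posdef.
Context {R : realType} (d : nat).
Implicit Types (S : 'M[R]_d) (x u v : 'rV[R]_d).

Definition bil S u v : R := (u *m S *m v^T) 0 0.

Lemma bilE S u v : bil S u v = \sum_j \sum_i u 0 i * S i j * v 0 j.
Proof.
rewrite /bil !mxE; apply: eq_bigr => j _.
by rewrite !mxE mulr_suml.
Qed.

Lemma bilDl S u u' v : bil S (u + u') v = bil S u v + bil S u' v.
Proof. by rewrite /bil !mulmxDl !mxE. Qed.

Lemma bilDr S u v v' : bil S u (v + v') = bil S u v + bil S u v'.
Proof. by rewrite /bil linearD/= mulmxDr !mxE. Qed.

Lemma bilZl S a u v : bil S (a *: u) v = a * bil S u v.
Proof. by rewrite /bil -!scalemxAl !mxE. Qed.

Lemma bilZr S a u v : bil S u (a *: v) = a * bil S u v.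
Proof. by rewrite /bil linearZ/= -!scalemxAr !mxE. Qed.

Lemma bilNl S u v : bil S (- u) v = - bil S u v.
Proof. by rewrite -scaleN1r bilZl mulN1r. Qed.

Lemma bilNr S u v : bil S u (- v) = - bil S u v.
Proof. by rewrite -scaleN1r bilZr mulN1r. Qed.

Lemma bilC S u v : S^T = S -> bil S u v = bil S v u.
Proof.
move=> ST; rewrite /bil -[in RHS](trmxK (v *m S *m u^T)) [in RHS]mxE.
by rewrite !trmx_mul ST trmxK mulmxA.
Qed.

Lemma posdef_unit S : sym_posdef S -> S \in unitmx.
Proof.
move=> [_ Sp]; rewrite -row_free_unit -kermx_eq0; apply/eqP/row_matrixP => i.
rewrite row0; apply/eqP; apply/negP => /negP /Sp.
by rewrite -row_mul mulmx_ker row0 mul0mx mxE ltxx.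
Qed.

Lemma posdef_inv_sym S : sym_posdef S -> (invmx S)^T = invmx S.
Proof. by move=> [ST _]; rewrite trmx_inv ST. Qed.

Lemma posdef_bil_inv_ge0 S u : sym_posdef S -> 0 <= bil (invmx S) u u.
Proof.
move=> pS; have [_ Sp] := pS; have uS := posdef_unit pS.
have [->|u0] := eqVneq u 0; first by rewrite /bil !mul0mx mxE.
have /Sp : u *m invmx S != 0.
  by apply: contra u0 => /eqP /(congr1 (mulmx^~ S)); rewrite mulmxKV// mul0mx => ->.
rewrite mulmxKV// trmx_mul posdef_inv_sym// mulmxA => /ltW.
by [].
Qed.

Lemma delta_mul_tr i v : ((delta_mx 0 i : 'rV[R]_d) *m v^T) 0 0 = v 0 i.
Proof. by rewrite -rowE !mxE. Qed.

Lemma bil_delta S i : bil S (delta_mx 0 i) (delta_mx 0 i) = S i i.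
Proof. by rewrite /bil trmx_delta -rowE -colE !mxE. Qed.

Lemma posdef_diag_gt0 S i : sym_posdef S -> 0 < S i i.
Proof.
move=> [_ /(_ (delta_mx 0 i))]; rewrite -/(bil _ _ _) bil_delta; apply.
by apply/eqP => /matrixP/(_ 0 i)/eqP; rewrite !mxE !eqxx oner_eq0.
Qed.

(* Cauchy-Schwarz for the form S^-1, with the vectors x and e_i S. *)
Lemma posdef_coord_le S i x : sym_posdef S ->
  x 0 i ^+ 2 <= S i i * bil (invmx S) x x.
Proof.
move=> pS; have Sii := posdef_diag_gt0 i pS; have uS := posdef_unit pS.
pose e : 'rV[R]_d := delta_mx 0 i *m S; pose t := x 0 i / S i i.
have ex v : bil (invmx S) e v = v 0 i by rewrite /bil mulmxK// delta_mul_tr.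
have eeS : e 0 i = S i i.
  by rewrite /e -rowE mxE.
have := posdef_bil_inv_ge0 (x - t *: e) pS.
rewrite !(bilDl, bilDr, bilNl, bilNr, bilZl, bilZr) (bilC x e) ?posdef_inv_sym// !ex eeS.
rewrite /t => H.
rewrite -subr_ge0; have := mulr_ge0 (ltW Sii) H.
congr (0 <= _); field.
exact: lt0r_neq0.
Qed.

(** The determinant is the value at 0 of the characteristic polynomial of [- S]. If it were
    nonpositive, this monic polynomial would have a root [t >= 0] by the intermediate value theorem,
    and an eigenvector of [- S] for [t] would contradict positivity. *)
Lemma posdef_det_gt0 S : sym_posdef S -> 0 < \det S.
Proof.
move=> pS; have [_ Sp] := pS.
have p0 : (char_poly (- S)).[0] = \det S.
  by rewrite horner_coef0 char_poly_det -(scaleN1r S) detZ mulrA -exprMn mulrNN mulr1 expr1n mul1r.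
rewrite ltNge; apply/negP => det0.
have lc1 : 0 < lead_coef (char_poly (- S)) by rewrite (monicP (char_poly_monic _)).
have [n nP] := polyrcf.poly_pinfty_gt_lc lc1.
have /nP : n <= Num.max n 0 by rewrite le_max lexx.
rewrite (monicP (char_poly_monic _)) => lcp.
have [||t t0] := @Num.poly_ivt R (char_poly (- S)) 0 (Num.max n 0).
- by rewrite le_max lexx orbT.
- by rewrite p0 det0 (le_trans ler01).
rewrite -eigenvalue_root_char => /eigenvalueP[v vS v0].
have := Sp v v0; rewrite -[S]opprK mulmxN vS mulNmx -scalemxAl mxE.
rewrite oppr_gt0 mxE pmulr_llt0 ?ltNge ?(andP t0).1//.
have vv j : 0 <= v 0 j * v^T j 0 by rewrite mxE -expr2 sqr_ge0.
rewrite mxE -ltNge lt_neqAle sumr_ge0 ?andbT; last by move=> j _; exact: vv.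
apply: contra v0; rewrite eq_sym psumr_eq0; last by move=> j _; exact: vv.
move=> /allP v0; apply/eqP/rowP => j.
by have := v0 j (mem_index_enum _); rewrite /= !mxE mulf_eq0 orbb => /eqP.
Qed.

End posdef.

(** * Exponential moments of Gaussians on the line *)

Section gaussian_tail.
Context {R : realType}.
Local Notation leb := (@lebesgue_measure R).

(** Completing the square: half of the quadratic term pays for the linear one, and the other half is
    the unnormalized Gaussian of standard deviation [(Num.sqrt a)^-1], in the form expected from
    [normal_fun]. *)
Lemma gauss_exp_le (a c x : R) : 0 < a ->
  expR (c * `|x| - a * x ^+ 2) <= expR (c ^+ 2 / (2 * a)) * expR (- (x ^+ 2) / ((Num.sqrt a)^-1 ^+ 2 *+ 2)).
Proof.
move=> a0; rewrite -expRD ler_expR exprVn (sqr_sqrtr (ltW a0)).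
rewrite -(real_normK (num_real x)); set y := `|x|.
rewrite -subr_ge0.
have -> : c ^+ 2 / (2 * a) + - y ^+ 2 / (a^-1 *+ 2) - (c * y - a * y ^+ 2) =
   (c - a * y) ^+ 2 / (2 * a).
  by field; exact: lt0r_neq0.
by rewrite mulr_ge0 ?sqr_ge0// invr_ge0 mulr_ge0// ltW.
Qed.

Lemma integral_gauss_exp_lty (a c : R) : 0 < a ->
  exists I : R, (\int[leb]_x (expR (c * `|x| - a * x ^+ 2))%:E = I%:E)%E.
Proof.
move=> a0; pose s := (Num.sqrt a)^-1.
have s0 : s != 0 by rewrite invr_neq0// sqrtr_eq0 -ltNge.
have mf : measurable_fun setT (fun x : R => expR (c * `|x| - a * x ^+ 2)).
  apply: (@measurableT_comp _ _ _ _ _ _ expR); first exact: measurable_expR.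
  apply: measurable_funB.
    apply: measurable_funM; first exact: measurable_cst.
    exact: (@normr_measurable R setT).
  apply: measurable_funM; first exact: measurable_cst.
  exact: exprn_measurable.
have : leb.-integrable setT (fun x : R => (expR (c * `|x| - a * x ^+ 2))%:E).
  have := integrableZl (measurableT) (expR (c ^+ 2 / (2 * a)) / normal_peak s) (integrable_normal_pdf 0 s).
  apply: le_integrable => //; first exact/measurable_EFinP.
  move=> x _ /=; rewrite lee_fin (ger0_norm (expR_ge0 _)).
  rewrite (le_trans (gauss_exp_le _ _ a0))// (le_trans _ (ler_norm _))//.
  have -> : normal_pdf 0 s x = normal_peak s * normal_fun 0 s x.
    by rewrite /normal_pdf (negbTE s0).
  rewrite mulrA divfK ?gt_eqF ?normal_peak_gt0//.
  by rewrite /normal_fun subr0.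
move=> /integrable_fin_num fin.
by exists (fine (\int[leb]_x (expR (c * `|x| - a * x ^+ 2))%:E)%E); rewrite fineK// fin.
Qed.

End gaussian_tail.

Section gauss_pdf_facts.
Context {R : realType} (d : nat).
Let TR := measurableTypeR R.
Local Notation mu := (lebesgue_tuple d).
Variable S : 'M[R]_d.
Hypothesis pS : sym_posdef S.
Implicit Types (x th : 'rV[R]_d).

Local Notation iS := (invmx S).
Local Notation g := (gauss_pdf 0 S).

Definition norm1 x : R := \sum_i `|x 0 i|.

(** The log-likelihood ratio of N(th, S) to N(0, S): affine in [x], and a polynomial of degree two
    in [th]. *)
Definition gexp x th : R := bil iS x th - bil iS th th / 2.

Lemma norm1_ge0 x : 0 <= norm1 x.
Proof. by apply: sumr_ge0. Qed.

Lemma norm1D x y : norm1 (x + y) <= norm1 x + norm1 y.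
Proof.
rewrite /norm1 -big_split/=; apply: ler_sum => i _.
by rewrite mxE ler_normD.
Qed.

Lemma bil_le (A : 'M[R]_d) x y :
  `|bil A x y| <= (\sum_i \sum_j `|A i j|) * norm1 x * norm1 y.
Proof.
rewrite bilE (le_trans (ler_norm_sum _ _ _))//.
rewrite /norm1 mulr_sumr; apply: ler_sum => j _.
rewrite (le_trans (ler_norm_sum _ _ _))// mulr_sumr mulr_suml.
apply: ler_sum => i _; rewrite !normrM (mulrC `|x 0 i|).
do 2 apply: ler_wpM2r => //.
rewrite (bigD1 i)//= (bigD1 j)//= -addrA lerDl addr_ge0 ?sumr_ge0// => k _.
by rewrite sumr_ge0.
Qed.

Lemma gauss_norm_gt0 : 0 < (Num.sqrt ((2 * pi) ^+ d * \det S))^-1.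
Proof.
rewrite invr_gt0 sqrtr_gt0 mulr_gt0 ?posdef_det_gt0// exprn_gt0// mulr_gt0//.
exact: pi_gt0.
Qed.

Lemma gauss_pdf_gt0 th x : 0 < gauss_pdf th S x.
Proof. by rewrite mulr_gt0 ?gauss_norm_gt0 ?expR_gt0. Qed.

Lemma gauss_pdfE th x : gauss_pdf th S x = g x * expR (gexp x th).
Proof.
rewrite /gauss_pdf -mulrA -expRD; congr (_ * expR _).
rewrite subr0 /gexp -!/(bil _ _ _).
rewrite !(bilDl, bilDr, bilNl, bilNr) (bilC th x) ?posdef_inv_sym//.
by field.
Qed.

Lemma gauss_pdf_shift th x : gauss_pdf th S (x + th) = g x.
Proof. by rewrite /gauss_pdf addrK subr0. Qed.

Lemma rv_measurable_bil (A : 'M[R]_d) (f h : 'rV[R]_d -> 'rV[R]_d) :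
  (forall i, rv_measurable (fun x => f x 0 i)) ->
  (forall i, rv_measurable (fun x => h x 0 i)) ->
  rv_measurable (fun x => bil A (f x) (h x)).
Proof.
move=> mf mh; rewrite (_ : (fun x => _) = fun x => \sum_j \sum_i f x 0 i * A i j * h x 0 j).
  apply: rv_measurable_sum => j; apply: rv_measurable_sum => i.
  apply: rv_measurableM => //; apply: rv_measurableM => //.
  exact: rv_measurable_cst.
by apply/funext => x; rewrite bilE.
Qed.

Lemma rv_measurable_gauss th : rv_measurable (gauss_pdf th S).
Proof.
apply: rv_measurableM; first exact: rv_measurable_cst.
apply: rv_measurable_expR; apply: rv_measurableM; last exact: rv_measurable_cst.
rewrite (_ : (fun x => _) = fun x => 0 - bil iS (x - th) (x - th)); last first.
  by apply/funext => x; rewrite sub0r.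
apply: rv_measurableB; first exact: rv_measurable_cst.
have mc i : rv_measurable (fun x => (x - th) 0 i).
  rewrite (_ : (fun x => _) = fun x => x 0 i - th 0 i); last first.
    by apply/funext => x; rewrite !mxE.
  by apply: rv_measurableB; [exact: rv_measurable_coord|exact: rv_measurable_cst].
exact: rv_measurable_bil.
Qed.

Lemma rv_measurable_norm1 : @rv_measurable R d norm1.
Proof.
apply: rv_measurable_sum => i; apply: rv_measurable_norm.
exact: rv_measurable_coord.
Qed.

(** The weights that dominate all integrands. They multiply by adding the parameters, they dominate
    monomials and the likelihood ratios of bounded location parameters, and they are integrable
    against [g] for every [c]. The summand 1 lets the exponent absorb constants too. *)
Definition ewt (c : R) x : R := expR (c * (1 + norm1 x)).

Lemma ewt_gt0 c x : 0 < ewt c x. Proof. exact: expR_gt0. Qed.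

Lemma ewt_ge1 c x : 0 <= c -> 1 <= ewt c x.
Proof.
by move=> c0; rewrite -expR0 ler_expR mulr_ge0// addr_ge0// norm1_ge0.
Qed.

Lemma ewtD c c' x : ewt (c + c') x = ewt c x * ewt c' x.
Proof. by rewrite /ewt -expRD mulrDl. Qed.

Lemma le_ewt c c' x : c <= c' -> ewt c x <= ewt c' x.
Proof.
by move=> cc; rewrite ler_expR ler_wpM2r// addr_ge0// norm1_ge0.
Qed.

Lemma rv_measurable_ewt c : rv_measurable (ewt c).
Proof.
apply: rv_measurable_expR; apply: rv_measurableM; first exact: rv_measurable_cst.
by apply: rv_measurableD; [exact: rv_measurable_cst|exact: rv_measurable_norm1].
Qed.

(** Summing [posdef_coord_le] over the coordinates, the quadratic form of the inverse of [S]
    dominates a multiple of the sum of squares. The integrand is then below a product of functions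
    of one coordinate, which Tonelli's theorem integrates. *)
Lemma rv_integrable_ewt c : rv_integrable (fun x => g x * ewt c x).
Proof.
pose s := \sum_i S i i.
have Sle i : S i i <= s.
  rewrite /s (bigD1 i)//= lerDl sumr_ge0// => j _.
  by rewrite ltW// posdef_diag_gt0.
have s0 : 0 <= s by apply: sumr_ge0 => i _; rewrite ltW// posdef_diag_gt0.
(* [d.+1] and [s + 1] keep [D] positive in dimension 0 as well. *)
pose D : R := d.+1%:R * (s + 1).
have D0 : 0 < D by rewrite mulr_gt0// ltr_wpDl.
pose a := (2 * D)^-1.
have a0 : 0 < a by rewrite invr_gt0 mulr_gt0.
pose f (y : R) := expR (c * `|y| - a * y ^+ 2).
have [I fI] := integral_gauss_exp_lty c a0.
have mf : measurable_fun [set: TR] (f : TR -> TR).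
  apply: (@measurableT_comp _ _ _ _ _ _ expR); first exact: measurable_expR.
  apply: measurable_funB.
    apply: measurable_funM; first exact: measurable_cst.
    exact: (@normr_measurable R setT).
  apply: measurable_funM; first exact: measurable_cst.
  exact: exprn_measurable.
pose h x := expR c * (Num.sqrt ((2 * pi) ^+ d * \det S))^-1 * \prod_i f (x 0 i).
have hi : rv_integrable h.
  apply: rv_integrableZ; apply/integrableP; split.
    apply/measurable_EFinP.
    apply: (@rv_measurable_prod R d _ (index_enum 'I_d) (fun i x => f (x 0 i))) => i.
    exact: (rv_measurable_comp mf (rv_measurable_coord i)).
  rewrite (_ : (\int[_]_x _)%E = (I ^+ d)%:E) ?ltry//.
  rewrite -(@ge0_integral_lebesgue_tuple_prod R d f I mf)//.
    apply: eq_integral => t _; rewrite /= ger0_norm; last first.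
      by rewrite prodr_ge0// => i _; exact: expR_ge0.
    by congr EFin; apply: eq_bigr => i _; rewrite mxE.
  by move=> y; exact: expR_ge0.
apply: rv_integrable_le hi _.
  by apply: rv_measurableM; [exact: rv_measurable_gauss|exact: rv_measurable_ewt].
move=> x; rewrite ger0_norm; last by rewrite mulr_ge0 ?expR_ge0 ?ltW ?gauss_pdf_gt0.
rewrite /h /gauss_pdf /ewt (mulrC (expR c)) -!mulrA (ler_wpM2l (ltW gauss_norm_gt0))//.
rewrite /f -expR_sum -!expRD ler_expR subr0 -/(bil _ _ _) sumrB -!mulr_sumr -/(norm1 x).
have : (\sum_i x 0 i ^+ 2) <= D * bil iS x x.
  apply: (@le_trans _ _ (\sum_(i < d) (s * bil iS x x))).
    apply: ler_sum => i _; rewrite (le_trans (posdef_coord_le i x pS))//.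
    by rewrite ler_wpM2r ?posdef_bil_inv_ge0.
  rewrite sumr_const card_ord -mulr_natl /D mulrA ler_wpM2r ?posdef_bil_inv_ge0//.
  by rewrite ler_pM// ?ler_nat ?lerDl.
move=> H.
have : a * \sum_i x 0 i ^+ 2 <= bil iS x x / 2.
  have -> : bil iS x x / 2 = a * (D * bil iS x x) by rewrite /a; field; exact: lt0r_neq0.
  by rewrite ler_pM2l.
set A := a * _; set b := bil _ _ _; rewrite mulrDr mulr1; lra.
Qed.

End gauss_pdf_facts.

(** * Moments of mixtures and the Hellinger distance *)

Section mixture_facts.
Context {R : realType} (d : nat).
Variable S : 'M[R]_d.
Hypothesis pS : sym_posdef S.
Implicit Types (x th : 'rV[R]_d) (G H : mixing R d).

Local Notation iS := (invmx S).
Local Notation g := (gauss_pdf 0 S).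

Definition ev G (T : 'rV[R]_d -> R) : R := \sum_i weight G i * T (atom G i).

Lemma mixture_pdfE G x : mixture_pdf S G x = ev G (fun th => gauss_pdf th S x).
Proof. by []. Qed.

Lemma ev_cst G (c : R) : ev G (fun=> c) = c.
Proof. by rewrite /ev -mulr_suml weight_sum1 mul1r. Qed.

Lemma evD G T T' : ev G (fun th => T th + T' th) = ev G T + ev G T'.
Proof. by rewrite /ev -big_split/=; apply: eq_bigr => i _; rewrite mulrDr. Qed.

Lemma evB G T T' : ev G (fun th => T th - T' th) = ev G T - ev G T'.
Proof. by rewrite /ev -sumrB; apply: eq_bigr => i _; rewrite mulrBr. Qed.

Lemma evZ G (c : R) T : ev G (fun th => c * T th) = c * ev G T.
Proof. by rewrite /ev mulr_sumr; apply: eq_bigr => i _; rewrite mulrCA. Qed.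

Lemma ev_sum G I (s : seq I) (T : I -> 'rV[R]_d -> R) :
  ev G (fun th => \sum_(i <- s) T i th) = \sum_(i <- s) ev G (T i).
Proof. by rewrite /ev exchange_big/=; apply: eq_bigr => i _; rewrite mulr_sumr. Qed.

Definition supp (rad : R) G := forall i, enorm (atom G i) <= rad.

Lemma le_ev rad G T T' : supp rad G ->
  (forall th, enorm th <= rad -> T th <= T' th) -> ev G T <= ev G T'.
Proof.
move=> sG TT; apply: ler_sum => i _; rewrite ler_wpM2l ?weight_ge0//.
exact: TT.
Qed.

Lemma eq_ev G T T' : (forall i, T (atom G i) = T' (atom G i)) -> ev G T = ev G T'.
Proof. by move=> TT; apply: eq_bigr => i _; rewrite TT. Qed.

Lemma ev_norm G T : `|ev G T| <= ev G (fun th => `|T th|).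
Proof.
rewrite (le_trans (ler_norm_sum _ _ _))//; apply: ler_sum => i _.
by rewrite normrM (ger0_norm (weight_ge0 _)).
Qed.

Lemma coord_le_enorm (u : 'rV[R]_d) i : `|u 0 i| <= enorm u.
Proof.
rewrite /enorm -(ger0_norm (sqrtr_ge0 (\sum_i u 0 i ^+ 2))) -ler_sqr ?nnegrE//.
rewrite !real_normK ?num_real// sqr_sqrtr; last by apply: sumr_ge0 => j _; exact: sqr_ge0.
by rewrite (bigD1 i)//= lerDl sumr_ge0// => j _; exact: sqr_ge0.
Qed.

Lemma norm1_le_enorm (u : 'rV[R]_d) rad : enorm u <= rad -> norm1 u <= d%:R * rad.
Proof.
move=> ur; rewrite /norm1 mulr_natl -[d in leRHS]card_ord -sumr_const.
by apply: ler_sum => i _; exact: le_trans (coord_le_enorm u i) ur.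
Qed.

Definition gc (rad : R) : R :=
  (\sum_i \sum_j `|iS i j|) * (d%:R * rad) * (1 + d%:R * rad).

Lemma gc_ge0 rad : 0 <= rad -> 0 <= gc rad.
Proof.
move=> r0; rewrite mulr_ge0// ?addr_ge0 ?mulr_ge0//.
by apply: sumr_ge0 => i _; apply: sumr_ge0.
Qed.

Lemma gexp_le rad x th : 0 <= rad -> enorm th <= rad ->
  `|gexp S x th| <= gc rad * (1 + norm1 x).
Proof.
move=> r0 thr; have n1 := norm1_le_enorm thr; have t0 := norm1_ge0 th.
have x0 := norm1_ge0 x.
set M := \sum_i \sum_j `|iS i j|.
have M0 : 0 <= M by apply: sumr_ge0 => i _; apply: sumr_ge0.
rewrite /gexp (le_trans (ler_normB _ _))// normrM (ger0_norm (_ : 0 <= 2^-1))//.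
have H1 := bil_le iS x th; have H2 := bil_le iS th th.
rewrite -/M in H1 H2; rewrite /gc -/M.
set D := d%:R * rad in n1 *.
have D0 : 0 <= D by rewrite mulr_ge0.
have H3 : M * norm1 x * norm1 th <= M * norm1 x * D by rewrite ler_wpM2l// mulr_ge0.
have H4 : M * norm1 th * norm1 th <= M * D * D.
  by apply: ler_pM => //; [exact: mulr_ge0|exact: ler_wpM2l].
have H5 : 0 <= M * D * D * norm1 x by rewrite !mulr_ge0.
have H6 : 0 <= M * D by rewrite mulr_ge0.
have H7 : 0 <= M * D * D by rewrite mulr_ge0.
have -> : M * D * (1 + D) * (1 + norm1 x) =
  M * norm1 x * D + M * D * D + M * D + M * D * D * norm1 x by ring.
lra.
Qed.

Lemma gauss_pdf_le rad x th : 0 <= rad -> enorm th <= rad ->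
  gauss_pdf th S x <= g x * ewt (gc rad) x.
Proof.
move=> r0 thr; rewrite gauss_pdfE// ler_pM2l ?gauss_pdf_gt0// ler_expR.
by rewrite (le_trans (ler_norm _))// gexp_le.
Qed.

Lemma gauss_pdf_ge rad x th : 0 <= rad -> enorm th <= rad ->
  g x * ewt (- gc rad) x <= gauss_pdf th S x.
Proof.
move=> r0 thr; rewrite (gauss_pdfE pS th) ler_pM2l ?gauss_pdf_gt0// ler_expR mulNr.
by rewrite lerNl (le_trans (ler_norm _))// normrN gexp_le.
Qed.

Lemma mixture_pdf_le rad x G : 0 <= rad -> supp rad G ->
  mixture_pdf S G x <= g x * ewt (gc rad) x.
Proof.
move=> r0 sG; rewrite mixture_pdfE -[leRHS](ev_cst G); apply: (le_ev sG) => th thr.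
exact: gauss_pdf_le.
Qed.

Lemma mixture_pdf_ge rad x G : 0 <= rad -> supp rad G ->
  g x * ewt (- gc rad) x <= mixture_pdf S G x.
Proof.
move=> r0 sG; rewrite mixture_pdfE -[leLHS](ev_cst G); apply: (le_ev sG) => th thr.
exact: gauss_pdf_ge.
Qed.

Lemma mixture_pdf_gt0 G x : 0 < mixture_pdf S G x.
Proof.
rewrite lt_neqAle sumr_ge0 ?andbT; last first.
  by move=> i _; rewrite mulr_ge0 ?weight_ge0// ltW// gauss_pdf_gt0.
apply/eqP => /esym/eqP; rewrite psumr_eq0; last first.
  by move=> i _; rewrite mulr_ge0 ?weight_ge0// ltW// gauss_pdf_gt0.
move=> /allP w0; have := weight_sum1 G.
rewrite big1 => [/esym/eqP|i _]; first by rewrite oner_eq0.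
have := w0 i (mem_index_enum _); rewrite /= mulf_eq0 (gt_eqF (gauss_pdf_gt0 pS _ _)) orbF.
by move/eqP.
Qed.

Lemma rv_measurable_mixture G : rv_measurable (mixture_pdf S G).
Proof.
apply: (@rv_measurable_sum R d _ _ (fun i x => weight G i * gauss_pdf (atom G i) S x)) => i.
apply: rv_measurableM; first exact: rv_measurable_cst.
exact: rv_measurable_gauss.
Qed.

Lemma rv_integrable_ewtM (f : 'rV[R]_d -> R) K c : rv_measurable f ->
  (forall x, `|f x| <= K * (g x * ewt c x)) -> rv_integrable f.
Proof.
move=> mf fK; apply: (rv_integrable_le mf _ fK).
by apply: rv_integrableZ; exact: rv_integrable_ewt.
Qed.

Lemma rv_integrable_mul_gauss (f : 'rV[R]_d -> R) K c th : rv_measurable f ->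
  (forall x, `|f x| <= K * ewt c x) -> rv_integrable (fun x => f x * gauss_pdf th S x).
Proof.
move=> mf fK.
apply: (@rv_integrable_ewtM _ K (c + gc (enorm th))).
  by apply: rv_measurableM => //; exact: rv_measurable_gauss.
move=> x; rewrite normrM ewtD (gtr0_norm (gauss_pdf_gt0 pS _ _)).
have -> : K * (g x * (ewt c x * ewt (gc (enorm th)) x)) =
  K * ewt c x * (g x * ewt (gc (enorm th)) x) by ring.
apply: ler_pM => //; first by rewrite ltW// gauss_pdf_gt0.
by apply: gauss_pdf_le => //; exact: sqrtr_ge0.
Qed.

Lemma rv_int_gauss_shift (f : 'rV[R]_d -> R) th : rv_measurable f ->
  rv_int (fun x => f x * gauss_pdf th S x) = rv_int (fun x => f (x + th) * g x).
Proof.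
move=> mf; rewrite -(rv_int_shift th); last first.
  by apply: rv_measurableM => //; exact: rv_measurable_gauss.
by apply: eq_rv_int => x; rewrite gauss_pdf_shift.
Qed.

Lemma rv_integrable_mixture_mul (f : 'rV[R]_d -> R) K c G : rv_measurable f ->
  (forall x, `|f x| <= K * ewt c x) -> rv_integrable (fun x => f x * mixture_pdf S G x).
Proof.
move=> mf fK.
have := @rv_integrable_sum R d _ (index_enum 'I_(natoms G))
  (fun i x => weight G i * (f x * gauss_pdf (atom G i) S x))
  (fun i => rv_integrableZ (weight G i) (rv_integrable_mul_gauss (atom G i) mf fK)).
apply: eq_integrable => // t _; congr EFin; rewrite mulr_sumr.
by apply: eq_bigr => i _; rewrite mulrCA.
Qed.

(** Testing the mixture against [f] amounts to testing G against the Gaussian smoothing of [f]; this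
    is how polynomials in the observation become polynomials in the parameter. *)
Lemma rv_int_mixture_mul (f : 'rV[R]_d -> R) K c G : rv_measurable f ->
  (forall x, `|f x| <= K * ewt c x) ->
  rv_int (fun x => f x * mixture_pdf S G x) =
  ev G (fun th => rv_int (fun x => f (x + th) * g x)).
Proof.
move=> mf fK.
transitivity (rv_int (fun x => \sum_i weight G i * (f x * gauss_pdf (atom G i) S x))).
  by apply: eq_rv_int => x; rewrite mulr_sumr; apply: eq_bigr => i _; rewrite mulrCA.
rewrite rv_int_sum; last first.
  by move=> i; apply: rv_integrableZ; exact: rv_integrable_mul_gauss fK.
apply: eq_bigr => i _; rewrite rv_intZ; last exact: rv_integrable_mul_gauss fK.
by rewrite (rv_int_gauss_shift (atom G i) mf).
Qed.

Definition hel G H : R := hellinger (mixture_pdf S G) (mixture_pdf S H).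

Definition sqdiff G H x : R :=
  (Num.sqrt (mixture_pdf S G x) - Num.sqrt (mixture_pdf S H x)) ^+ 2.

Lemma hel_ge0 G H : 0 <= hel G H. Proof. exact: sqrtr_ge0. Qed.

Lemma hel_sqr G H : hel G H ^+ 2 = 2^-1 * rv_int (sqdiff G H).
Proof.
rewrite /hel /hellinger sqr_sqrtr// mulr_ge0//.
by apply: (@rv_int_ge0 R d (sqdiff G H)) => x; exact: sqr_ge0.
Qed.

Lemma rv_measurable_sqdiff G H : rv_measurable (sqdiff G H).
Proof.
apply: rv_measurableX; apply: rv_measurableB;
  by apply: rv_measurable_sqrt; exact: rv_measurable_mixture.
Qed.

Lemma rv_integrable_sqdiff rad G H : 0 <= rad -> supp rad G -> supp rad H ->
  rv_integrable (sqdiff G H).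
Proof.
move=> r0 sG sH; apply: (@rv_integrable_ewtM _ 2 (gc rad)).
  exact: rv_measurable_sqdiff.
move=> x; rewrite ger0_norm ?sqr_ge0// /sqdiff.
have pG := mixture_pdf_le x r0 sG; have pH := mixture_pdf_le x r0 sH.
have G0 := mixture_pdf_gt0 G x; have H0 := mixture_pdf_gt0 H x.
have := sqr_sqrtr (ltW G0); have := sqr_sqrtr (ltW H0).
have := sqrtr_ge0 (mixture_pdf S G x); have := sqrtr_ge0 (mixture_pdf S H x).
nra.
Qed.

(** In the weighted AM-GM inequality of [hel_test], the term with the squared difference of the
    square roots contributes 1, and the term with their sum, whose square is at most
    [4 * (g x * ewt (gc rad) x)], contributes the integral with the factor 2. *)
Definition test_cst rad c : R :=
  1 + 2 * rv_int (fun x => g x * ewt (2 * c + gc rad) x).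

Lemma test_cst_ge0 rad c : 0 <= test_cst rad c.
Proof.
apply: addr_ge0; first exact: ler01.
apply: mulr_ge0; first exact: ler0n.
by apply: rv_int_ge0 => x; apply: mulr_ge0; [exact: ltW (gauss_pdf_gt0 pS _ _)|exact: expR_ge0].
Qed.

(* AM-GM with the weight 1 / (hel G H + e), e -> 0, in place of Cauchy-Schwarz. *)
Lemma hel_test rad (f : 'rV[R]_d -> R) K c G H : 0 <= rad -> supp rad G -> supp rad H ->
  0 <= K -> rv_measurable f -> (forall x, `|f x| <= K * ewt c x) ->
  `|rv_int (fun x => f x * mixture_pdf S G x) - rv_int (fun x => f x * mixture_pdf S H x)|
  <= K * test_cst rad c * hel G H.
Proof.
move=> r0 sG sH K0 mf fK.
rewrite -rv_intB; try exact: rv_integrable_mixture_mul fK.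
set u := fun x => _.
have iu : rv_integrable u by apply: rv_integrableB; exact: rv_integrable_mixture_mul fK.
have h0 := hel_ge0 G H; set h := hel G H in h0 *.
pose A := rv_int (fun x => g x * ewt (2 * c + gc rad) x).
have A0 : 0 <= A.
  by apply: rv_int_ge0 => x; rewrite mulr_ge0 ?expR_ge0// ltW// gauss_pdf_gt0.
have iA := rv_integrable_ewt pS (2 * c + gc rad).
have isq := rv_integrable_sqdiff r0 sG sH.
have key e : 0 < e -> `|rv_int u| <= K * ((2 * (h + e))^-1 * (2 * h ^+ 2) + 2 * (h + e) * A).
  move=> e0; have he : 0 < h + e by rewrite ltr_wpDl.
  have -> : 2 * h ^+ 2 = rv_int (sqdiff G H) by rewrite /h hel_sqr mulrA divff// mul1r.
  rewrite -!rv_intZ// -rv_intD; [|exact: rv_integrableZ..].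
  rewrite -rv_intZ; last by apply: rv_integrableD; exact: rv_integrableZ.
  apply: le_trans (_ : rv_int (fun x => `|u x|) <= _).
    exact: le_normr_Rintegral.
  apply: le_rv_int => [| |x].
  - exact: integrable_norm iu.
  - by apply: rv_integrableZ; apply: rv_integrableD; exact: rv_integrableZ.
  rewrite /u -mulrBr normrM.
  have pG := mixture_pdf_le x r0 sG; have pH := mixture_pdf_le x r0 sH.
  have G0 := mixture_pdf_gt0 G x; have H0 := mixture_pdf_gt0 H x.
  rewrite /sqdiff -{1}(sqr_sqrtr (ltW G0)) -{1}(sqr_sqrtr (ltW H0)) subr_sqr normrM.
  have : Num.sqrt (mixture_pdf S G x) ^+ 2 <= g x * ewt (gc rad) x by rewrite sqr_sqrtr// ltW.
  have : Num.sqrt (mixture_pdf S H x) ^+ 2 <= g x * ewt (gc rad) x by rewrite sqr_sqrtr// ltW.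
  have := sqrtr_ge0 (mixture_pdf S G x); have := sqrtr_ge0 (mixture_pdf S H x).
  set a := Num.sqrt (mixture_pdf S G x); set b := Num.sqrt (mixture_pdf S H x) => b0 a0 bg ag.
  have fx := fK x; rewrite (ger0_norm (addr_ge0 a0 b0)).
  rewrite (mulrC (g x)) -mulrA.
  have -> : ewt (2 * c + gc rad) x * g x = ewt c x ^+ 2 * (g x * ewt (gc rad) x).
    by rewrite ewtD mulr2n mulrDl !mul1r ewtD expr2; ring.
  set w := ewt c x in fx *; set q := g x * _ in ag bg *.
  apply: le_trans (_ : K * w * (`|a - b| * (a + b)) <= _).
    by rewrite ler_wpM2r// mulr_ge0// addr_ge0.
  rewrite -mulrA ler_wpM2l// -[(a - b) ^+ 2]real_normK ?num_real//.
  set y := `|a - b|.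
  have w0 : 0 < w by exact: ewt_gt0.
  have ab4 : (a + b) ^+ 2 <= 4 * q.
    by have := sqr_ge0 (a - b); rewrite !expr2 in ag bg *; nra.
  have : 0 <= (y - (h + e) * w * (a + b)) ^+ 2 by exact: sqr_ge0.
  have hw : 0 <= (h + e) ^+ 2 * w ^+ 2 by rewrite mulr_ge0// sqr_ge0.
  have := ler_wpM2l hw ab4 => H1 H2.
  rewrite -(ler_pM2l (_ : 0 < 2 * (h + e))) ?mulr_gt0//.
  have -> : 2 * (h + e) * ((2 * (h + e))^-1 * y ^+ 2 + 2 * ((h + e) * (w ^+ 2 * q))) =
    y ^+ 2 + 4 * (h + e) ^+ 2 * w ^+ 2 * q by field; exact: lt0r_neq0.
  rewrite !expr2 in H1 H2 *; lra.
have key2 e : 0 < e -> `|rv_int u| <= K * test_cst rad c * h + (K * 2 * A) * e.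
  move=> e0; apply: le_trans (key e e0) _; have he : 0 < h + e by rewrite ltr_wpDl.
  have hh : (2 * (h + e))^-1 * (2 * h ^+ 2) <= h.
    rewrite ler_pdivrMl ?mulr_gt0// expr2; nra.
  rewrite /test_cst -/A -!mulrA -mulrDr ler_wpM2l//.
  lra.
apply/ler_addgt0Pr => e e0.
have B0 : 0 < K * 2 * A + 1 by rewrite ltr_wpDl// !mulr_ge0.
apply: le_trans (key2 (e / (K * 2 * A + 1)) _) _; first by rewrite divr_gt0.
rewrite lerD2l mulrA ler_pdivrMr// mulrC ler_pM2l//.
by rewrite lerDl.
Qed.

End mixture_facts.

(** * Monomials of the parameter and their unbiased estimation *)

Section monomial_duality.
Context {R : realType} (d : nat).
Variable S : 'M[R]_d.
Hypothesis pS : sym_posdef S.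
Implicit Types (x th : 'rV[R]_d) (G H : mixing R d) (s : seq 'I_d).

Local Notation g := (gauss_pdf 0 S).

Definition mon s x : R := \prod_(i <- s) x 0 i.

Lemma mon_cat s1 s2 x : mon (s1 ++ s2) x = mon s1 x * mon s2 x.
Proof. by rewrite /mon big_cat. Qed.

Lemma mon_cons i s x : mon (i :: s) x = x 0 i * mon s x.
Proof. by rewrite /mon big_cons. Qed.

Lemma rv_measurable_mon s : rv_measurable (mon s).
Proof. by apply: rv_measurable_prod => i; exact: rv_measurable_coord. Qed.

Lemma mon_le_ewt s x : `|mon s x| <= ewt (size s)%:R x.
Proof.
elim: s => [|i s IH]; first by rewrite /mon big_nil normr1 /ewt mul0r expR0.
rewrite mon_cons normrM /= -natr1 addrC ewtD ler_pM//.
rewrite /ewt mul1r (le_trans _ (expR_ge1Dx _))// (le_trans (_ : _ <= norm1 x))//.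
  by rewrite /norm1 (bigD1 i)//= lerDl sumr_ge0.
by rewrite addrA lerDr.
Qed.

Lemma mon_le_enorm s rad th : 1 <= rad -> enorm th <= rad -> `|mon s th| <= rad ^+ size s.
Proof.
move=> r1 thr; elim: s => [|i s IH]; first by rewrite /mon big_nil normr1.
rewrite mon_cons normrM exprS ler_pM// (le_trans (coord_le_enorm th i))//.
Qed.

(* The expansion of mon s (x + th) as a sum over subwords, without the term mon s th. *)
Fixpoint msplit s : seq (seq 'I_d * seq 'I_d) :=
  if s is i :: s' then
    ([:: i], s') :: [seq (i :: p.1, p.2) | p <- msplit s'] ++
                    [seq (p.1, i :: p.2) | p <- msplit s']
  else [::].

Lemma mon_shift s x th :
  mon s (x + th) = mon s th + \sum_(p <- msplit s) mon p.1 x * mon p.2 th.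
Proof.
elim: s => [|i s IH]; first by rewrite /mon !big_nil addr0.
rewrite mon_cons IH mxE /= big_cons big_cat/= !big_map/= !mon_cons.
have -> : \sum_(p <- msplit s) mon (i :: p.1) x * mon p.2 th =
    x 0 i * \sum_(p <- msplit s) mon p.1 x * mon p.2 th.
  by rewrite mulr_sumr; apply: eq_bigr => p _; rewrite mon_cons mulrA.
have -> : \sum_(p <- msplit s) mon p.1 x * mon (i :: p.2) th =
    th 0 i * \sum_(p <- msplit s) mon p.1 x * mon p.2 th.
  by rewrite mulr_sumr; apply: eq_bigr => p _; rewrite mon_cons mulrCA.
have -> : mon [::] x = 1 by rewrite /mon big_nil.
ring.
Qed.

Lemma msplit_size s p : p \in msplit s ->
  (size p.1 <= size s)%N && (size p.2 < size s)%N.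
Proof.
elim: s p => [|i s IH] p //=; rewrite inE mem_cat => /orP[/eqP -> //=|/orP[]] /mapP[q /IH].
  by move=> /andP[q1 q2] -> /=; rewrite !ltnS q1 (ltnW q2).
by move=> /andP[q1 q2] -> /=; rewrite !ltnS q2 (leq_trans q1 (leqnSn _)).
Qed.

Lemma size_msplit s : (size (msplit s)).+1 = (2 ^ size s)%N.
Proof.
elim: s => [|i s IH]//=; rewrite size_cat !size_map expnS -IH mul2n -addnn.
by rewrite addSn addnS.
Qed.

Lemma rv_int_g_gt0 : 0 < rv_int g.
Proof.
apply: rv_int_gt0 => [|x]; last exact: gauss_pdf_gt0.
have := rv_integrable_ewt pS 0; apply: eq_integrable => // t _.
by rewrite /ewt mul0r expR0 mulr1.
Qed.

Lemma mon_gauss_integrable s : rv_integrable (fun x => mon s x * g x).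
Proof.
apply: (@rv_integrable_mul_gauss _ _ _ pS _ 1 (size s)%:R).
  exact: rv_measurable_mon.
by move=> x; rewrite mul1r mon_le_ewt.
Qed.

(** Induction on the degree. Under N(th, S), the mean of [mon s] is [mon s th] times the mass [c0]
    of [g], plus shorter monomials in [th] weighted by Gaussian moments. The whole mean is compared
    by [hel_test], and the shorter monomials by the induction hypothesis. *)
Lemma mon_dual rad D : 0 <= rad -> exists C : R, 0 <= C /\
  forall G H s, supp rad G -> supp rad H -> (size s <= D)%N ->
  `|ev G (mon s) - ev H (mon s)| <= C * hel S G H.
Proof.
move=> r0; elim: D => [|D [C [C0 IH]]].
  exists 0; split=> // G H [|//] sG sH _; rewrite mul0r.
  have e K : ev K (mon [::]) = 1.
    by rewrite -[RHS](ev_cst K); apply: eq_ev => i; rewrite /mon big_nil.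
  by rewrite !e subrr normr0.
pose c0 := rv_int g; have c00 : 0 < c0 := rv_int_g_gt0.
pose M := rv_int (fun x => g x * ewt D.+1%:R x).
have M0 : 0 <= M.
  by apply: rv_int_ge0 => x; rewrite mulr_ge0 ?expR_ge0// ltW// gauss_pdf_gt0.
pose m s := rv_int (fun x => mon s x * g x).
have mM s : (size s <= D.+1)%N -> `|m s| <= M.
  move=> sD; apply: le_trans (_ : rv_int (fun x => `|mon s x * g x|) <= _).
    exact: (le_normr_Rintegral measurableT (mon_gauss_integrable s)).
  apply: le_rv_int => [||x].
  - exact: integrable_norm (mon_gauss_integrable s).
  - exact: rv_integrable_ewt.
  rewrite normrM (gtr0_norm (gauss_pdf_gt0 pS _ _)) mulrC.
  rewrite (ler_wpM2l (ltW (gauss_pdf_gt0 pS _ _)))// (le_trans (mon_le_ewt _ _))//.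
  by apply: le_ewt; rewrite ler_nat.
pose K := test_cst S rad D.+1%:R.
have K0 : 0 <= K := test_cst_ge0 pS rad _.
pose N : R := (2 ^ D.+1)%N%:R.
exists ((K + N * (M * C)) / c0); split.
  by apply: divr_ge0; [apply: addr_ge0 => //; rewrite !mulr_ge0// ler0n|exact: ltW].
move=> G H s sG sH sD.
have mono x : `|mon s x| <= 1 * ewt D.+1%:R x.
  by rewrite mul1r (le_trans (mon_le_ewt _ _))// le_ewt// ler_nat.
have E th : rv_int (fun x => mon s (x + th) * g x) =
    c0 * mon s th + \sum_(p <- msplit s) m p.1 * mon p.2 th.
  transitivity (rv_int (fun x => mon s th * g x + \sum_(p <- msplit s) mon p.2 th * (mon p.1 x * g x))).
    apply: eq_rv_int => x; rewrite mon_shift mulrDl mulr_suml; congr (_ + _).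
    by apply: eq_bigr => p _; ring.
  rewrite rv_intD.
  - rewrite rv_intZ; last first.
      have := mon_gauss_integrable [::]; apply: eq_integrable => // t _.
      by rewrite /mon big_nil mul1r.
    rewrite mulrC rv_int_sum; last by move=> p; apply: rv_integrableZ; exact: mon_gauss_integrable.
    congr (_ + _); apply: eq_bigr => p _; rewrite rv_intZ; last exact: mon_gauss_integrable.
    by rewrite mulrC.
  - apply: rv_integrableZ; have := mon_gauss_integrable [::]; apply: eq_integrable => // t _.
    by rewrite /mon big_nil mul1r.
  - apply: rv_integrable_sum => p; apply: rv_integrableZ; exact: mon_gauss_integrable.
have := hel_test pS r0 sG sH ler01 (rv_measurable_mon s) mono.
rewrite !(rv_int_mixture_mul pS _ (rv_measurable_mon s) mono) mul1r -/K.
have evE Q : ev Q (fun th => rv_int (fun x => mon s (x + th) * g x)) =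
   c0 * ev Q (mon s) + \sum_(p <- msplit s) m p.1 * ev Q (mon p.2).
  rewrite -evZ; under [in RHS]eq_bigr do rewrite -evZ.
  by rewrite -ev_sum -evD; apply: eq_ev => i; exact: E.
rewrite !evE => HK.
set h := hel S G H in HK *; have h0 : 0 <= h := hel_ge0 S G H.
have HS : `|\sum_(p <- msplit s) m p.1 * (ev G (mon p.2) - ev H (mon p.2))| <= N * (M * C) * h.
  rewrite (le_trans (ler_norm_sum _ _ _))//.
  apply: le_trans (_ : \sum_(p <- msplit s) M * (C * h) <= _).
    rewrite big_seq [in leRHS]big_seq; apply: ler_sum => p /msplit_size /andP[p1 p2].
    rewrite normrM ler_pM//; first exact: mM (leq_trans p1 sD).
    by apply: IH => //; rewrite -ltnS (leq_trans p2).
  rewrite big_const_seq count_predT iter_addr_0 -mulr_natl -!mulrA.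
  rewrite ler_wpM2r ?mulr_ge0// ler_nat -ltnS size_msplit.
  by rewrite leqW// leq_exp2l.
rewrite mulrAC ler_pdivlMr//.
have -> : `|ev G (mon s) - ev H (mon s)| * c0 = `|c0 * (ev G (mon s) - ev H (mon s))|.
  by rewrite normrM mulrC (gtr0_norm c00).
have -> : c0 * (ev G (mon s) - ev H (mon s)) =
  (c0 * ev G (mon s) + \sum_(p <- msplit s) m p.1 * ev G (mon p.2)
   - (c0 * ev H (mon s) + \sum_(p <- msplit s) m p.1 * ev H (mon p.2)))
  - \sum_(p <- msplit s) m p.1 * (ev G (mon p.2) - ev H (mon p.2)).
  under [X in _ = _ - X]eq_bigr do rewrite mulrBr.
  by rewrite sumrB; ring.
by rewrite (le_trans (ler_normB _ _))// mulrDl lerD.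
Qed.

End monomial_duality.

(** * Euclidean and product estimates *)

Section euclidean.
Context {R : realType} (d : nat).
Implicit Types (u v w : 'rV[R]_d).

Definition dot u v : R := \sum_i u 0 i * v 0 i.

Lemma dotC u v : dot u v = dot v u.
Proof. by apply: eq_bigr => i _; rewrite mulrC. Qed.

Lemma dotDl u v w : dot (u + v) w = dot u w + dot v w.
Proof. by rewrite -big_split; apply: eq_bigr => i _; rewrite mxE mulrDl. Qed.

Lemma dotZl a u w : dot (a *: u) w = a * dot u w.
Proof. by rewrite mulr_sumr; apply: eq_bigr => i _; rewrite mxE mulrA. Qed.

Lemma dotNl u w : dot (- u) w = - dot u w.
Proof. by rewrite -scaleN1r dotZl mulN1r. Qed.

Lemma dotDr u v w : dot w (u + v) = dot w u + dot w v.
Proof. by rewrite dotC dotDl !(dotC w). Qed.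

Lemma dotNr u w : dot w (- u) = - dot w u.
Proof. by rewrite dotC dotNl dotC. Qed.

Lemma dotZr a u w : dot w (a *: u) = a * dot w u.
Proof. by rewrite dotC dotZl dotC. Qed.

Lemma dot_ge0 u : 0 <= dot u u.
Proof. by apply: sumr_ge0 => i _; rewrite -expr2 sqr_ge0. Qed.

Lemma enorm_ge0 u : 0 <= enorm u. Proof. exact: sqrtr_ge0. Qed.

Lemma enorm_sqr u : enorm u ^+ 2 = dot u u.
Proof.
rewrite sqr_sqrtr; last by apply: sumr_ge0 => i _; exact: sqr_ge0.
by apply: eq_bigr => i _; rewrite expr2.
Qed.

Lemma enorm0 : enorm (0 : 'rV[R]_d) = 0.
Proof.
rewrite /enorm big1 ?sqrtr0// => i _; by rewrite mxE expr0n.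
Qed.

Lemma enormN u : enorm (- u) = enorm u.
Proof. by rewrite /enorm; congr Num.sqrt; apply: eq_bigr => i _; rewrite mxE sqrrN. Qed.

Lemma dot_le u v : `|dot u v| <= enorm u * enorm v.
Proof.
rewrite -ler_sqr ?nnegrE ?mulr_ge0 ?enorm_ge0// real_normK ?num_real//.
rewrite exprMn !enorm_sqr.
have [v0|v0] := eqVneq (dot v v) 0.
  have -> : dot u v = 0.
    apply: big1 => i _; move/eqP: v0; rewrite psumr_eq0; last by move=> j _; rewrite -expr2 sqr_ge0.
    by move/allP/(_ i (mem_index_enum _)); rewrite /= mulf_eq0 orbb => /eqP ->; rewrite mulr0.
  by rewrite expr0n v0 mulr0.
have vp : 0 < dot v v by rewrite lt_neqAle eq_sym v0 dot_ge0.
have := dot_ge0 (u - (dot u v / dot v v) *: v).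
rewrite !(dotDl, dotDr, dotNl, dotNr, dotZl, dotZr) (dotC v u) => H.
rewrite -subr_ge0; have := mulr_ge0 (ltW vp) H.
by congr (0 <= _); field.
Qed.

Lemma enorm_sqrD_le u v : enorm (u + v) ^+ 2 <= 2 * enorm u ^+ 2 + 2 * enorm v ^+ 2.
Proof.
rewrite !enorm_sqr; have := dot_ge0 (u - v).
by rewrite !(dotDl, dotDr, dotNl, dotNr) (dotC v u); lra.
Qed.

Lemma enorm_sqrB_le u v : enorm (u - v) ^+ 2 <= 2 * enorm u ^+ 2 + 2 * enorm v ^+ 2.
Proof. by rewrite (le_trans (enorm_sqrD_le _ _))// enormN. Qed.

Lemma enormC u v : enorm (u - v) = enorm (v - u).
Proof. by rewrite -enormN opprB. Qed.

Lemma enorm_le_sum u v rad : enorm u <= rad -> enorm v <= rad -> enorm (u - v) <= 2 * rad.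
Proof.
move=> ur vr; have r0 : 0 <= rad := le_trans (enorm_ge0 _) ur.
rewrite -ler_sqr ?nnegrE ?mulr_ge0 ?enorm_ge0// (le_trans (enorm_sqrB_le _ _))//.
have u2 : enorm u ^+ 2 <= rad ^+ 2 by rewrite ler_sqr ?nnegrE ?enorm_ge0.
have v2 : enorm v ^+ 2 <= rad ^+ 2 by rewrite ler_sqr ?nnegrE ?enorm_ge0.
rewrite exprMn; lra.
Qed.

End euclidean.

(** * Perturbation of finite products *)

Section product_estimates.
Context {R : realType}.

Lemma prod_lipschitz (I : Type) (s : seq I) (P : pred I) (A B : I -> R) (M e : R) :
  1 <= M -> 0 <= e -> (forall i, P i -> `|A i| <= M) -> (forall i, P i -> `|B i| <= M) ->
  (forall i, P i -> `|A i - B i| <= e) ->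
  `|\prod_(i <- s | P i) A i - \prod_(i <- s | P i) B i| <= (size s)%:R * M ^+ size s * e.
Proof.
move=> M1 e0 AM BM AB; have M0 : 0 <= M by rewrite (le_trans ler01).
have pB s' : `|\prod_(i <- s' | P i) B i| <= M ^+ size s'.
  elim: s' => [|i s' IH]; first by rewrite big_nil normr1.
  rewrite big_cons; case: ifPn => Pi /=; first by rewrite normrM exprS ler_pM// BM.
  by rewrite exprS (le_trans IH)// ler_peMl// exprn_ge0.
elim: s => [|i s IH]; first by rewrite !big_nil subrr normr0 !mul0r.
have Ms : 0 <= M ^+ size s by exact: exprn_ge0.
rewrite !big_cons /= -natr1 exprS.
have H1 : e * M ^+ size s <= e * M ^+ size s * M by rewrite ler_peMr// mulr_ge0.
case: ifPn => Pi; last first.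
  apply: le_trans IH _; rewrite ler_wpM2r// ler_pM// ?mulr_ge0//; first by rewrite lerDl.
  by rewrite ler_peMl.
have -> : A i * \prod_(j <- s | P j) A j - B i * \prod_(j <- s | P j) B j =
  A i * (\prod_(j <- s | P j) A j - \prod_(j <- s | P j) B j) +
  (A i - B i) * \prod_(j <- s | P j) B j by ring.
rewrite (le_trans (ler_normD _ _))// !normrM.
apply: le_trans (lerD (ler_pM _ _ (AM i Pi) IH) (ler_pM _ _ (AB i Pi) (pB s))) _ => //.
by rewrite !mulrDl mul1r; lra.
Qed.

Lemma prodr_const_ge (I : finType) (P : pred I) (F : I -> R) (e : R) : 0 <= e <= 1 ->
  (forall i, P i -> e <= F i) -> e ^+ #|I| <= \prod_(i | P i) F i.
Proof.
move=> /andP[e0 e1] eF; apply: (@le_trans _ _ (\prod_(i | P i) e)).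
  rewrite prodr_const; apply: ler_wiXn2l => //; exact: max_card.
by apply: ler_prod => i Pi; rewrite e0 eF.
Qed.

Lemma norm_sum_le (I : Type) (s : seq I) (f : I -> R) (M : R) :
  (forall i, `|f i| <= M) -> `|\sum_(i <- s) f i| <= (size s)%:R * M.
Proof.
move=> fM; elim: s => [|i s IH]; first by rewrite big_nil normr0 mul0r.
by rewrite big_cons (le_trans (ler_normD _ _))//= -natr1 mulrDl mul1r addrC lerD.
Qed.

(* Second order expansion of prod (1 + b_i + c_i), where b_i = O(e) and c_i = O(e^2). *)
Lemma prod_second_order (n : nat) : exists K : R, 0 <= K /\
  forall (I : Type) (s : seq I) (b c : I -> R) (e : R), size s = n ->
  0 <= e <= 2^-1 -> (forall i, `|b i| <= 2 * e) -> (forall i, 0 <= c i <= e ^+ 2) ->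
  `|\prod_(i <- s) (1 + b i + c i) - 1 - \sum_(i <- s) b i| <= K * e ^+ 2.
Proof.
elim: n => [|n [K [K0 IH]]].
  exists 0; split=> // I [|//] b c e _ _ _ _.
  by rewrite !big_nil !subrr normr0 mul0r.
exists (4 * K + (1 + n%:R) + 4 * n%:R); split; first by rewrite !addr_ge0// mulr_ge0.
move=> I [//|i s] b c e [sn] /andP[e0 e1] be ce.
have {}IH := IH I s b c e sn _ be ce.
rewrite !big_cons; set P := \prod_(_ <- _) _ in IH *; set B := \sum_(_ <- _) _ in IH *.
have -> : (1 + b i + c i) * P - 1 - (b i + B) =
  (1 + b i + c i) * (P - 1 - B) + (c i * (1 + B) + b i * B) by ring.
have BN : `|B| <= n%:R * (2 * e) by rewrite -sn; exact: norm_sum_le.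
have e1' : e * 2 <= 1 by rewrite -ler_pdivlMr// mul1r.
have B1 : `|B| <= n%:R.
  by rewrite (le_trans BN)// ler_piMr// mulrC.
have bi := be i; have /andP[ci0 ci] := ce i.
have e2 : e ^+ 2 <= 1 by rewrite expr_le1//; lra.
have r4 : `|1 + b i + c i| <= 4.
  rewrite (le_trans (ler_normD _ _))// (ger0_norm ci0).
  have := ler_normD 1 (b i); rewrite normr1; lra.
have n0 : 0 <= n%:R :> R by [].
have IH' := IH (introT andP (conj e0 e1)).
rewrite (le_trans (ler_normD _ _))// normrM.
have H1 : `|1 + b i + c i| * `|P - 1 - B| <= 4 * (K * e ^+ 2) by rewrite ler_pM.
have H2 : `|c i * (1 + B)| <= e ^+ 2 * (1 + n%:R).
  rewrite normrM (ger0_norm ci0) ler_pM// (le_trans (ler_normD _ _))// normr1.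
  by rewrite lerD2l.
have H3 : `|b i * B| <= 2 * e * (n%:R * (2 * e)) by rewrite normrM ler_pM.
have H4 := ler_normD (c i * (1 + B)) (b i * B).
rewrite expr2 in H1 H2 *; lra.
Qed.

(** [P] will be a product of ratios of squared distances, with first-order part [B], so that
    [P * (1 - B)] is 1 up to O(e^2). The errors are stated relative to [e ^+ 2 * P] because that
    quantity becomes a multiple of [cellprod]. The first bound serves points in other cells, where
    [e] is at least 1/2 and [1 - B] is O(e^2). The second one serves the own cell, where no ratio is
    below 1/4. *)
Lemma cell_estimate (n : nat) : exists K : R, 0 <= K /\
  forall (I : Type) (s : seq I) (b c : I -> R) (e : R), size s = n -> 0 <= e ->
  (forall i, `|b i| <= 2 * e) -> (forall i, 0 <= c i <= e ^+ 2) ->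
  (forall i, 0 <= 1 + b i + c i) ->
  let P := \prod_(i <- s) (1 + b i + c i) in let B := \sum_(i <- s) b i in
  (2^-1 <= e -> `|P * (1 - B)| <= K * e ^+ 2 * P) /\
  ((forall i, 4^-1 <= 1 + b i + c i) -> `|1 - P * (1 - B)| <= K * e ^+ 2 * P).
Proof.
have [K0 [K00 H0]] := prod_second_order n.
pose N : R := n%:R; have N0 : 0 <= N by exact: ler0n.
pose Q : R := 4 ^+ n; have Q0 : 0 <= Q by exact: exprn_ge0.
pose K1 := 4 * (1 + N); have K10 : 0 <= K1 by rewrite mulr_ge0// addr_ge0.
pose K2 := K0 * (1 + N) + 4 * N ^+ 2.
have K20 : 0 <= K2 by rewrite addr_ge0// mulr_ge0// ?addr_ge0// sqr_ge0.
exists (4 * Q + K1 + K2 * Q); split; first by rewrite !addr_ge0// mulr_ge0.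
move=> I s b c e sn e0 be ce r0 P B.
have P0 : 0 <= P by apply: prodr_ge0.
have BN : `|B| <= N * (2 * e) by rewrite /N -sn; exact: norm_sum_le.
have e20 : 0 <= e ^+ 2 by exact: sqr_ge0.
have part1 : 2^-1 <= e -> `|P * (1 - B)| <= K1 * e ^+ 2 * P.
  move=> e2; rewrite normrM (ger0_norm P0) mulrC ler_wpM2r//.
  have := ler_normB 1 B; rewrite normr1 => nB.
  have Ne : 0 <= N * (e * (2 * e - 1)) by rewrite !mulr_ge0//; lra.
  rewrite /K1 expr2; nra.
have QQ : 0 <= 4 * Q * e ^+ 2 * P by rewrite !mulr_ge0.
have QK : 0 <= K2 * Q * e ^+ 2 * P by rewrite !mulr_ge0.
have QL : 0 <= K1 * e ^+ 2 * P by apply: mulr_ge0 => //; exact: mulr_ge0.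
have KE : (4 * Q + K1 + K2 * Q) * e ^+ 2 * P =
  4 * Q * e ^+ 2 * P + K1 * e ^+ 2 * P + K2 * Q * e ^+ 2 * P by ring.
split=> [e2|r4]; rewrite KE.
  by apply: le_trans (part1 e2) _; lra.
(* All factors being at least 1/4, [P] is at least [4 ^- n]; this turns absolute errors into errors
   relative to [P]. *)
have PQ : 1 <= Q * P.
  rewrite /Q /P -sn; elim: (s) => [|i s' IH]; first by rewrite big_nil mulr1.
  rewrite big_cons /= exprS.
  have -> : 4 * 4 ^+ size s' * ((1 + b i + c i) * \prod_(j <- s') (1 + b j + c j)) =
    (4 * (1 + b i + c i)) * (4 ^+ size s' * \prod_(j <- s') (1 + b j + c j)) by ring.
  rewrite -[X in X <= _]mulr1 ler_pM//.
  by have := r4 i; lra.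
have [e2|e2] := leP 2^-1 e.
  apply: le_trans (ler_normB _ _) _; rewrite normr1.
  have := part1 e2.
  have : 1 <= 4 * e ^+ 2 by rewrite expr2; nra.
  move=> e4 H1.
  have : 1 * 1 <= (4 * e ^+ 2) * (Q * P) by rewrite ler_pM.
  rewrite mulr1 => H2; lra.
have := H0 I s b c e sn _ be ce; rewrite -/P -/B => /(_ _)/wrap[|HP].
  by rewrite e0 ltW.
have -> : 1 - P * (1 - B) = - ((P - 1 - B) * (1 - B) - B ^+ 2) by ring.
rewrite normrN (le_trans (ler_normB _ _))// normrM normrX.
have B1 : `|1 - B| <= 1 + N.
  have := ler_normB 1 B; rewrite normr1.
  have : 0 <= N * (1 - 2 * e) by rewrite mulr_ge0//; lra.
  lra.
have H1 : `|P - 1 - B| * `|1 - B| <= K0 * e ^+ 2 * (1 + N) by rewrite ler_pM.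
have H2 : `|B| ^+ 2 <= 4 * N ^+ 2 * e ^+ 2.
  have -> : 4 * N ^+ 2 * e ^+ 2 = (N * (2 * e)) ^+ 2 by ring.
  by rewrite lerXn2r ?nnegrE// !mulr_ge0.
have H3 : K2 * e ^+ 2 * 1 <= K2 * e ^+ 2 * (Q * P) by rewrite ler_wpM2l// mulr_ge0.
by rewrite /K2 in H3 QK *; lra.
Qed.

End product_estimates.

Lemma size_index_enum (T : finType) : size (index_enum T) = #|T|.
Proof. by rewrite -sum1_size -sum1_card; apply: eq_bigl. Qed.

(** * Polynomials with bounded coefficients *)

Section bounded_polynomials.
Context {R : realType} (d : nat).
Implicit Types (T : 'rV[R]_d -> R) (th a : 'rV[R]_d).

(* T is a polynomial of degree <= D whose coefficients have total mass <= B. *)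
Definition pol (D : nat) (B : R) T := exists l : seq (R * seq 'I_d),
  [/\ forall q, q \in l -> (size q.2 <= D)%N, \sum_(q <- l) `|q.1| <= B &
      forall th, T th = \sum_(q <- l) q.1 * mon q.2 th].

Lemma pol_ext D B T T' : T =1 T' -> pol D B T -> pol D B T'.
Proof. by move=> TT [l [lD lB lT]]; exists l; split=> // th; rewrite -TT. Qed.

Lemma pol_mono D D' B B' T : (D <= D')%N -> B <= B' -> pol D B T -> pol D' B' T.
Proof.
move=> DD BB [l [lD lB lT]]; exists l; split=> //; last exact: le_trans BB.
by move=> q ql; rewrite (leq_trans (lD q ql)).
Qed.

Lemma pol_cst D (c : R) : pol D `|c| (fun=> c).
Proof.
exists [:: (c, [::])]; split=> [q||th].
- by rewrite inE => /eqP ->.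
- by rewrite big_seq1.
- by rewrite big_seq1 /mon big_nil mulr1.
Qed.

Lemma pol_coord i : pol 1 1 (fun th => th 0 i).
Proof.
exists [:: (1, [:: i])]; split=> [q||th].
- by rewrite inE => /eqP ->.
- by rewrite big_seq1 normr1.
- by rewrite big_seq1 /mon big_seq1 mul1r.
Qed.

Lemma polD D B B' T T' : pol D B T -> pol D B' T' ->
  pol D (B + B') (fun th => T th + T' th).
Proof.
move=> [l [lD lB lT]] [l' [lD' lB' lT']]; exists (l ++ l'); split=> [q||th].
- by rewrite mem_cat => /orP[/lD|/lD'].
- by rewrite big_cat lerD.
- by rewrite big_cat lT lT'.
Qed.

Lemma polM D B D' B' T T' : pol D B T -> pol D' B' T' ->
  pol (D + D') (B * B') (fun th => T th * T' th).
Proof.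
move=> [l [lD lB lT]] [l' [lD' lB' lT']].
exists [seq (p.1 * q.1, p.2 ++ q.2) | p <- l, q <- l']; split=> [q||th].
- move=> /allpairsP[[p p'] [pl pl' ->]] /=; rewrite size_cat leq_add//.
    exact: lD.
  exact: lD'.
- rewrite big_allpairs_dep/=; apply: le_trans (ler_pM _ _ lB lB') => //; last 2 first.
  + by apply: sumr_ge0.
  + by apply: sumr_ge0.
  rewrite mulr_suml; apply: ler_sum => p _; rewrite mulr_sumr; apply: ler_sum => q _.
  by rewrite normrM.
- rewrite big_allpairs_dep/= lT lT' mulr_suml; apply: eq_bigr => p _.
  rewrite mulr_sumr; apply: eq_bigr => q _.
  by rewrite mon_cat; ring.
Qed.

Lemma polZ D B (c : R) T : pol D B T -> pol D (`|c| * B) (fun th => c * T th).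
Proof. by move=> pT; have := polM (pol_cst 0 c) pT. Qed.

Lemma polB D B B' T T' : pol D B T -> pol D B' T' ->
  pol D (B + B') (fun th => T th - T' th).
Proof.
move=> pT pT'; have := polD pT (polZ (-1) pT').
rewrite normrN1 mul1r; apply: pol_ext => th; by rewrite mulN1r.
Qed.

Lemma pol_sum (I : Type) (s : seq I) D B (T : I -> 'rV[R]_d -> R) :
  (forall i, pol D B (T i)) -> pol D ((size s)%:R * B) (fun th => \sum_(i <- s) T i th).
Proof.
move=> pT; elim: s => [|i s IH].
  have := pol_cst D 0; rewrite normr0 mul0r; apply: pol_ext => th.
  by rewrite big_nil.
have := polD (pT i) IH; rewrite /= -natr1 mulrDl mul1r addrC; apply: pol_ext => th.
by rewrite big_cons.
Qed.

Lemma pol_prod (I : Type) (s : seq I) D B (T : I -> 'rV[R]_d -> R) :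
  (forall i, pol D B (T i)) ->
  pol (size s * D) (B ^+ size s) (fun th => \prod_(i <- s) T i th).
Proof.
move=> pT; elim: s => [|i s IH].
  have := pol_cst 0 1; rewrite normr1 expr0; apply: pol_ext => th.
  by rewrite big_nil.
have := polM (pT i) IH; rewrite /= exprS mulSn; apply: pol_ext => th.
by rewrite big_cons.
Qed.

Lemma polX n D B T : pol D B T -> pol (n * D) (B ^+ n) (fun th => T th ^+ n).
Proof.
move=> pT; elim: n => [|n IH]; first by have := pol_cst 0 1; rewrite normr1 expr0.
have := polM pT IH; rewrite exprS mulSn; apply: pol_ext => th.
by rewrite exprS.
Qed.

Definition sqd a th : R := enorm (th - a) ^+ 2.

Lemma sqdE a th : sqd a th = \sum_i (th 0 i - a 0 i) ^+ 2.
Proof.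
rewrite /sqd enorm_sqr; apply: eq_bigr => i _; by rewrite !mxE expr2.
Qed.

Lemma sqd_ge0 a th : 0 <= sqd a th. Proof. exact: sqr_ge0. Qed.

Lemma sqd_id a : sqd a a = 0.
Proof. by rewrite /sqd subrr enorm0 expr0n. Qed.

Lemma sqdC a th : sqd a th = sqd th a.
Proof. by rewrite /sqd enormC. Qed.

Lemma sqd_triangle a th u : sqd a u <= 2 * sqd th a + 2 * sqd th u.
Proof.
rewrite /sqd (_ : u - a = (u - th) - (a - th)); last by rewrite opprB addrA subrK.
by rewrite [leRHS]addrC; exact: enorm_sqrB_le.
Qed.

Lemma sqd_le rad a th : enorm a <= rad -> enorm th <= rad -> sqd a th <= (2 * rad) ^+ 2.
Proof.
move=> ar tr; have r0 : 0 <= rad := le_trans (enorm_ge0 _) ar.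
by rewrite /sqd lerXn2r ?nnegrE ?enorm_ge0 ?mulr_ge0// enorm_le_sum.
Qed.

Lemma pol_sqd rad a : enorm a <= rad -> pol 2 (d%:R * (1 + rad) ^+ 2) (sqd a).
Proof.
move=> ar; have := @pol_sum 'I_d (index_enum 'I_d) 2 ((1 + rad) ^+ 2) (fun i th => (th 0 i - a 0 i) ^+ 2).
rewrite (_ : size (index_enum _) = d); last first.
  by rewrite size_index_enum card_ord.
move=> /(_ _)/wrap[i|].
  have := polX 2 (polB (pol_coord i) (pol_cst 1 (a 0 i))).
  apply: pol_mono => //; rewrite lerXn2r ?nnegrE ?addr_ge0//.
    by rewrite (le_trans (enorm_ge0 _) ar).
  by rewrite lerD2l (le_trans (coord_le_enorm _ _)).
by apply: pol_ext => th; rewrite sqdE.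
Qed.

(** The constant depends on the polynomial only through its degree, and [B] enters linearly. Test
    functions may thus be built from the atoms of H, with an estimate uniform in H as long as their
    coefficients are controlled. *)
Lemma pol_dual (S : 'M[R]_d) rad D : sym_posdef S -> 0 <= rad -> exists C : R, 0 <= C /\
  forall G H T B, supp rad G -> supp rad H -> pol D B T ->
  `|ev G T - ev H T| <= B * C * hel S G H.
Proof.
move=> pS r0; have [C [C0 HC]] := mon_dual pS D r0; exists C; split=> //.
move=> G H T B sG sH [l [lD lB lT]].
have evT K : ev K T = \sum_(q <- l) q.1 * ev K (mon q.2).
  under eq_bigr do rewrite -evZ.
  by rewrite -ev_sum; apply: eq_ev => i; rewrite lT.
rewrite !evT -sumrB (le_trans (ler_norm_sum _ _ _))//.
apply: (@le_trans _ _ (\sum_(q <- l) `|q.1| * (C * hel S G H))).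
  rewrite big_seq [in leRHS]big_seq; apply: ler_sum => q ql.
  by rewrite -mulrBr normrM ler_wpM2l// HC// lD.
by rewrite -mulr_suml -mulrA ler_wpM2r// mulr_ge0// hel_ge0.
Qed.

End bounded_polynomials.

(** * Couplings *)

Section transport_kernel.
Context {R : realType} (T : finType).

(* Moves a onto b inside the classes of cl: the mass common to a and b stays in place,
   the excess of a over b is spread proportionally to the excess of b over a. *)
Lemma transport_kernel (U : eqType) (cl : T -> U) (a b : T -> R) :
  (forall i, 0 <= a i) -> (forall i, 0 <= b i) ->
  (forall i, \sum_(j | cl j == cl i) a j = \sum_(j | cl j == cl i) b j) ->
  exists K : T -> T -> R,
  [/\ forall i j, 0 <= K i j, forall i, \sum_j K i j = 1,
      forall j, \sum_i a i * K i j = b j,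
      forall i j, cl i != cl j -> K i j = 0 &
      forall i, \sum_(j | j != i) a i * K i j <= `|a i - b i|].
Proof.
move=> a0 b0 ab.
(* [m i] is the fraction of the mass at [i] that stays, [e j] the deficit to be filled at [j], and
   [D i] the total deficit of the class of [i], which equals its total surplus since [a] and [b]
   have the same mass in each class. *)
pose m i : R := if a i <= b i then 1 else b i / a i.
pose e j : R := Num.max (b j - a j) 0.
pose D i : R := \sum_(j | cl j == cl i) e j.
have e0 j : 0 <= e j by rewrite le_max lexx orbT.
have D0 i : 0 <= D i by apply: sumr_ge0.
have m0 i : 0 <= m i by rewrite /m; case: ifP => // _; exact: divr_ge0.
have m1 i : m i <= 1.
  rewrite /m; case: (leP (a i) (b i)) => // ba; have ai : 0 < a i := le_lt_trans (b0 i) ba.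
  by rewrite ler_pdivrMr// mul1r ltW.
have ame i : a i * (1 - m i) = Num.max (a i - b i) 0.
  rewrite /m; case: (leP (a i) (b i)) => abi.
    by rewrite subrr mulr0 max_r// subr_le0.
  have ai : a i != 0 by rewrite gt_eqF// (le_lt_trans (b0 i)).
  by rewrite max_l ?subr_ge0 ?ltW// mulrBr mulr1 mulrCA divff// mulr1.
have De i : \sum_(j | cl j == cl i) a j * (1 - m j) = D i.
  rewrite /D; under eq_bigr do rewrite ame.
  apply/eqP; rewrite -subr_eq0 -sumrB; apply/eqP.
  transitivity (\sum_(j | cl j == cl i) (a j - b j)); last by rewrite sumrB ab subrr.
  apply: eq_bigr => j _; rewrite /e /Num.max.
  by case: ltP => h1; case: ltP => h2; lra.
(* A class without deficit has no surplus either: everything stays, and the quotients by [D i = 0]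
   in [K] are multiplied by 0. *)
have D0m i : D i = 0 -> m i = 1.
  move=> Di; have := De i; rewrite Di => /eqP; rewrite psumr_eq0; last first.
    by move=> j _; rewrite mulr_ge0// subr_ge0.
  move=> /allP/(_ i (mem_index_enum _)); rewrite eqxx/= mulf_eq0 subr_eq0 => /orP[/eqP ai0|/eqP //].
  by rewrite /m ai0 b0.
pose K i j : R := (if j == i then m i else 0) +
  (if cl j == cl i then (1 - m i) * (e j / D i) else 0).
have DE i j : cl i = cl j -> D i = D j by rewrite /D => ->.
have K1 i : \sum_j K i j = 1.
  rewrite big_split/=.
  rewrite -big_mkcond/= big_pred1_eq -big_mkcond/= -mulr_sumr -mulr_suml -/(D i).
  have [Di|Di] := eqVneq (D i) 0; first by rewrite D0m// subrr mul0r addr0.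
  by rewrite divff// mulr1 addrC subrK.
exists K; split.
- move=> i j; rewrite addr_ge0//; first by case: ifP.
  by case: ifP => // _; rewrite mulr_ge0 ?subr_ge0// divr_ge0.
- exact: K1.
- move=> j; under eq_bigr do rewrite mulrDr; rewrite big_split/=.
  have -> : \sum_i a i * (if j == i then m i else 0) = a j * m j.
    rewrite (bigD1 j)//= eqxx big1 ?addr0// => i; rewrite eq_sym => /negbTE ->.
    exact: mulr0.
  have -> : \sum_i a i * (if cl j == cl i then (1 - m i) * (e j / D i) else 0) = e j.
    transitivity (\sum_(i | cl i == cl j) a i * (1 - m i) * (e j / D j)).
      rewrite [in RHS]big_mkcond; apply: eq_bigr => i _; rewrite eq_sym.
      case: eqP => [cij|_]; last exact: mulr0.
      rewrite (DE i j cij); exact: mulrA.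
    rewrite -mulr_suml De.
    have [Dj|Dj] := eqVneq (D j) 0; last by rewrite mulrC divfK.
    rewrite Dj mul0r; apply/esym/eqP.
    move: Dj => /eqP; rewrite /D psumr_eq0// => /allP/(_ j (mem_index_enum _)).
    by rewrite eqxx.
  have := ame j; rewrite mulrBr mulr1 => /eqP; rewrite subr_eq => /eqP aE.
  have : a j = Num.max (a j - b j) 0 + a j * m j by [].
  rewrite /e /Num.max; case: ltP => h1; case: ltP => h2; lra.
- move=> i j cij; rewrite /K.
  have -> : (cl j == cl i) = false by rewrite eq_sym; exact: negbTE.
  have -> : (j == i) = false by apply/negbTE; apply: contraNneq cij => ->.
  by rewrite addr0.
- move=> i; rewrite -mulr_sumr.
  apply: (@le_trans _ _ (a i * (1 - m i))).
    rewrite ler_wpM2l//; have := K1 i; rewrite (bigD1 i)//= => H.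
    have Kii : m i <= K i i by rewrite /K !eqxx lerDl mulr_ge0 ?subr_ge0// divr_ge0.
    lra.
  rewrite ame ge_max normr_ge0 andbT; exact: ler_norm.
Qed.

End transport_kernel.

Section coupling_bound.
Context {R : realType} (d : nat).
Implicit Types G H : mixing R d.

Lemma wasserstein2_le G H (q : 'M[R]_(natoms G, natoms H)) : is_coupling q ->
  wasserstein2 G H ^+ 2 <= \sum_i \sum_j q i j * enorm (atom G i - atom H j) ^+ 2.
Proof.
move=> cq; set A := [set \sum_i \sum_j q' i j * enorm (atom G i - atom H j) ^+ 2
  | q' in @is_coupling R d G H].
have A0 : lbound A 0.
  move=> _ [q' [q0 _ _] <-]; apply: sumr_ge0 => i _; apply: sumr_ge0 => j _.
  by rewrite mulr_ge0// sqr_ge0.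
have Aq : A (\sum_i \sum_j q i j * enorm (atom G i - atom H j) ^+ 2) by exists q.
rewrite /wasserstein2 -/A sqr_sqrtr; last by apply: lb_le_inf => //; exists (\sum_i \sum_j q i j * enorm (atom G i - atom H j) ^+ 2).
by apply: ge_inf => //; exists 0.
Qed.

Lemma wasserstein2_ge0 G H : 0 <= wasserstein2 G H.
Proof. exact: sqrtr_ge0. Qed.

(* Move every atom of G to the atom t i, then rebalance inside the classes of cl by
   kernels of diameter r, then rebalance globally. *)
Lemma wasserstein2_transport G H (U : eqType) (cl : 'I_(natoms H) -> U)
    (t : 'I_(natoms G) -> 'I_(natoms H)) (w' : 'I_(natoms H) -> R) (r D : R) :
  let w j := \sum_(i | t i == j) weight G i in
  (forall j, 0 <= w' j) ->
  (forall j, \sum_(l | cl l == cl j) w l = \sum_(l | cl l == cl j) w' l) ->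
  (forall j l, cl j = cl l -> enorm (atom H j - atom H l) ^+ 2 <= r) ->
  (forall j l, enorm (atom H j - atom H l) ^+ 2 <= D) ->
  wasserstein2 G H ^+ 2 <= 3 * (\sum_i weight G i * enorm (atom G i - atom H (t i)) ^+ 2
    + r * \sum_j `|w j - w' j| + D * \sum_j `|w' j - weight H j|).
Proof.
move=> w w'0 ww' clr HD.
have w0 j : 0 <= w j by apply: sumr_ge0 => i _; exact: weight_ge0.
have [K1 [K10 K1s K1w K1c K1d]] := transport_kernel w0 w'0 ww'.
have sw' : \sum_j w' j = 1.
  transitivity (\sum_j w j).
    under eq_bigr do rewrite -K1w; rewrite exchange_big/=; apply: eq_bigr => i _.
    by rewrite -mulr_sumr K1s mulr1.
  rewrite -(weight_sum1 G) (partition_big t xpredT)//=.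
have [K2 [K20 K2s K2w _ K2d]] :
    exists K : 'I_(natoms H) -> 'I_(natoms H) -> R,
  [/\ forall i j, 0 <= K i j, forall i, \sum_j K i j = 1,
      forall j, \sum_i w' i * K i j = weight H j,
      forall i j, tt != tt -> K i j = 0 &
      forall i, \sum_(j | j != i) w' i * K i j <= `|w' i - weight H i|].
  apply: (@transport_kernel R _ _ (fun=> tt)) => // i; first exact: weight_ge0.
  by rewrite sw' weight_sum1.
pose q : 'M[R]_(natoms G, natoms H) :=
  \matrix_(i, l) (weight G i * \sum_j K1 (t i) j * K2 j l).
have sumG (F : 'I_(natoms H) -> R) : \sum_i weight G i * F (t i) = \sum_j w j * F j.
  rewrite (partition_big t xpredT)//=; apply: eq_bigr => j _.
  by rewrite mulr_suml; apply: eq_bigr => i /eqP <-.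
have cq : is_coupling q.
  split=> [i j|i|l].
  - rewrite mxE mulr_ge0 ?weight_ge0//; apply: sumr_ge0 => k _; exact: mulr_ge0.
  - under eq_bigr do rewrite mxE; rewrite -mulr_sumr exchange_big/=.
    rewrite (eq_bigr (fun j => K1 (t i) j)); first by rewrite K1s mulr1.
    by move=> j _; rewrite -mulr_sumr K2s mulr1.
  - under eq_bigr do rewrite mxE; rewrite (sumG (fun n => \sum_j K1 n j * K2 j l)).
    rewrite -K2w; under eq_bigr do rewrite mulr_sumr; rewrite exchange_big/=.
    by apply: eq_bigr => j _; rewrite -K1w mulr_suml; apply: eq_bigr => n _; rewrite mulrA.
apply: le_trans (wasserstein2_le cq) _.
pose c1 i := enorm (atom G i - atom H (t i)) ^+ 2.
pose c2 n j := enorm (atom H n - atom H j) ^+ 2.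
(* The three successive moves are the origin of the factor 3, by convexity of the square. *)
have tri i j l : enorm (atom G i - atom H l) ^+ 2 <= 3 * (c1 i + c2 (t i) j + c2 j l).
  rewrite /c1 /c2; have -> : atom G i - atom H l =
    (atom G i - atom H (t i)) + (atom H (t i) - atom H j) + (atom H j - atom H l).
    by apply/rowP => k; rewrite !mxE; ring.
  set u := atom G i - _; set v := atom H (t i) - _; set z := atom H j - _.
  clearbody u v z; rewrite !enorm_sqr; have := dot_ge0 (u - v); have := dot_ge0 (u - z); have := dot_ge0 (v - z).
  rewrite !(dotDl, dotDr, dotNl, dotNr) (dotC v u) (dotC z u) (dotC z v); lra.
apply: (@le_trans _ _ (\sum_i \sum_l \sum_j
   weight G i * (K1 (t i) j * K2 j l) * (3 * (c1 i + c2 (t i) j + c2 j l)))).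
  apply: ler_sum => i _; apply: ler_sum => l _; rewrite mxE mulr_sumr mulr_suml.
  apply: ler_sum => j _; apply: ler_wpM2l (tri i j l).
  by rewrite mulr_ge0 ?weight_ge0// mulr_ge0.
have E : \sum_i \sum_l \sum_j
   weight G i * (K1 (t i) j * K2 j l) * (3 * (c1 i + c2 (t i) j + c2 j l)) =
  3 * (\sum_i weight G i * c1 i + \sum_n \sum_j w n * K1 n j * c2 n j +
       \sum_j \sum_l w' j * K2 j l * c2 j l).
  have -> : \sum_j \sum_l w' j * K2 j l * c2 j l =
     \sum_i weight G i * \sum_j K1 (t i) j * \sum_l K2 j l * c2 j l.
    rewrite (sumG (fun n => \sum_j K1 n j * \sum_l K2 j l * c2 j l)).
    under [RHS]eq_bigr do rewrite mulr_sumr; rewrite [RHS]exchange_big/=; apply: eq_bigr => j _.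
    rewrite -K1w; under eq_bigr do rewrite -mulrA; rewrite -mulr_sumr mulr_suml.
    by apply: eq_bigr => n _; rewrite mulrA.
  have -> : \sum_n \sum_j w n * K1 n j * c2 n j =
     \sum_i weight G i * \sum_j K1 (t i) j * c2 (t i) j.
    rewrite (sumG (fun n => \sum_j K1 n j * c2 n j)); apply: eq_bigr => n _.
    by rewrite mulr_sumr; apply: eq_bigr => j _; rewrite mulrA.
  rewrite -!big_split/= mulr_sumr; apply: eq_bigr => i _.
  rewrite exchange_big/=.
  transitivity (\sum_j 3 * weight G i * (K1 (t i) j * (c1 i + c2 (t i) j + \sum_l K2 j l * c2 j l))).
    apply: eq_bigr => j _.
    transitivity (\sum_l 3 * weight G i * K1 (t i) j * ((c1 i + c2 (t i) j) * K2 j l + K2 j l * c2 j l)).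
      by apply: eq_bigr => l _; ring.
    by rewrite -mulr_sumr big_split/= -mulr_sumr K2s mulr1 !mulrA.
  rewrite -mulr_sumr -!mulrDr -mulrA; congr (_ * (_ * _)).
  transitivity (\sum_j (K1 (t i) j * c1 i + K1 (t i) j * c2 (t i) j +
      K1 (t i) j * \sum_l K2 j l * c2 j l)).
    by apply: eq_bigr => j _; rewrite !mulrDr.
  by rewrite !big_split/= -mulr_suml K1s mul1r.
rewrite E ler_wpM2l//.
have c20 n : c2 n n = 0 by rewrite /c2 subrr enorm0 expr0n.
apply: lerD; first apply: lerD => //.
  rewrite mulr_sumr; apply: ler_sum => n _; rewrite (bigD1 n)//= c20 mulr0 add0r.
  apply: (@le_trans _ _ (\sum_(j | j != n) r * (w n * K1 n j))).
    apply: ler_sum => j _; rewrite mulrC.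
    have [cnj|cnj] := eqVneq (cl n) (cl j); last by rewrite K1c// mulr0 !mulr0.
    by rewrite ler_wpM2r ?mulr_ge0// clr.
  rewrite -mulr_sumr ler_wpM2l//.
  by rewrite (le_trans _ (clr n n erefl))// sqr_ge0.
rewrite mulr_sumr; apply: ler_sum => n _; rewrite (bigD1 n)//= c20 mulr0 add0r.
apply: (@le_trans _ _ (\sum_(j | j != n) D * (w' n * K2 n j))).
  by apply: ler_sum => j _; rewrite mulrC ler_wpM2r ?mulr_ge0// HD.
rewrite -mulr_sumr ler_wpM2l//.
by rewrite (le_trans _ (HD n n))// sqr_ge0.
Qed.

End coupling_bound.

(** * Cells around the true atoms *)

Lemma size_filter_index_enum (T : finType) (P : pred T) :
  size [seq x <- index_enum T | P x] = #|P|.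
Proof. by rewrite -sum1_size big_filter sum1_card. Qed.

Lemma dotv0 (R : realType) (d : nat) (v : 'rV[R]_d) : dot v 0 = 0.
Proof. by rewrite -[X in dot v X](scale0r v) dotZr mul0r. Qed.

(** Fixed by choice as a function of [n] alone, so that it can enter a constant announced before G
    and H. *)
Definition cell_cst (R : realType) (n : nat) : R := projT1 (cid (@cell_estimate R n)).

Lemma cell_cst_ge0 (R : realType) (n : nat) : 0 <= cell_cst R n.
Proof. by rewrite /cell_cst; case: cid => K []. Qed.

Definition sqd_ub (R : realType) (rad : R) : R := (2 * rad) ^+ 2.

Lemma sqd_ub_ge1 (R : realType) (rad : R) : 1 <= rad -> 1 <= sqd_ub rad.
Proof. by move=> r1; apply: exprn_ege1; lra. Qed.

Lemma card_pred_ord (n : nat) (P : pred 'I_n) : (#|P| <= n)%N.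
Proof. by rewrite -[X in (_ <= X)%N](card_ord n) max_card. Qed.

Section cells.
Context {R : realType} (d : nat) (H : mixing R d).
Implicit Types (th : 'rV[R]_d) (j l : 'I_(natoms H)).

Local Notation a := (atom H).
Local Notation n := (natoms H).

Definition cellprod th : R := \prod_l sqd (a l) th.
Definition offprod j th : R := \prod_(l | l != j) sqd (a l) th.
Definition near_atom j th := forall l, sqd (a j) th <= sqd (a l) th.

Lemma sep_le j l : j != l -> sep H <= enorm (a j - a l).
Proof.
move=> jl; apply: ge_inf; last by exists (j, l).
by exists 0 => _ [p _ <-]; exact: enorm_ge0.
Qed.

Lemma cellprodE j th : cellprod th = sqd (a j) th * offprod j th.
Proof. by rewrite /cellprod (bigD1 j). Qed.

Lemma cellprod_ge0 th : 0 <= cellprod th.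
Proof. by apply: prodr_ge0 => l _; exact: sqd_ge0. Qed.

Lemma cellprod_atom j : cellprod (a j) = 0.
Proof. by rewrite (cellprodE j) sqd_id mul0r. Qed.

Lemma offprod_atom j l : l != j -> offprod j (a l) = 0.
Proof. by move=> lj; rewrite /offprod (bigD1 l)//= sqd_id mul0r. Qed.

(** In the Voronoi cell of [a j], the triangle inequality shows that a point is at least half as far
    from [a l] as [a j] is; the square gives 4. *)
Lemma near_atom_le j l th : near_atom j th -> sqd (a l) (a j) <= 4 * sqd (a l) th.
Proof.
move=> /(_ l) nj; rewrite (le_trans (sqd_triangle _ th _))// !(sqdC th).
by lra.
Qed.

Lemma near_prod (P : pred 'I_n) j th : near_atom j th ->
  \prod_(l | P l) sqd (a l) (a j) <= 4 ^+ n * \prod_(l | P l) sqd (a l) th.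
Proof.
move=> nj; apply: (@le_trans _ _ (\prod_(l | P l) (4 * sqd (a l) th))).
  by apply: ler_prod => l _; rewrite sqd_ge0 near_atom_le.
rewrite big_split/= prodr_const ler_wpM2r//.
  by apply: prodr_ge0 => l _; exact: sqd_ge0.
by rewrite ler_weXn2l// ?ler1n// -[X in (_ <= X)%N](card_ord n) max_card.
Qed.

Hypothesis sep0 : 0 < sep H.

Lemma sep_sqr_le j l : j != l -> sep H ^+ 2 <= sqd (a l) (a j).
Proof.
move=> jl; rewrite /sqd lerXn2r ?nnegrE ?enorm_ge0 ?(ltW sep0)//.
exact: sep_le.
Qed.

Lemma sqd_atom_gt0 j l : l != j -> 0 < sqd (a l) (a j).
Proof.
move=> lj; rewrite (lt_le_trans _ (sep_sqr_le _)) ?exprn_gt0//.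
by rewrite eq_sym.
Qed.

Lemma offprod_self_gt0 j : 0 < offprod j (a j).
Proof. by apply: prodr_gt0 => l lj; exact: sqd_atom_gt0. Qed.

(** The first-order part at [a j] of the ratio [sqd (a l) th / sqd (a l) (a j)]; see
    [sqd_ratioE]. *)
Definition lin_term j l th : R := 2 * dot (a j - a l) (th - a j) / sqd (a l) (a j).

(** A Hermite interpolation polynomial: value 1 and zero gradient at [a j], double zeros at the
    other atoms. The last factor removes the gradient of the normalized [offprod j] at [a j]. *)
Definition cell_test j th : R :=
  offprod j th / offprod j (a j) * (1 - \sum_(l | l != j) lin_term j l th).

Lemma cell_test_atom j l : cell_test j (a l) = (l == j)%:R.
Proof.
rewrite /cell_test; have [->|lj] := eqVneq l j; last first.
  by rewrite offprod_atom// !mul0r.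
rewrite divff ?gt_eqF ?offprod_self_gt0// big1 ?subr0 ?mulr1// => l' _.
by rewrite /lin_term subrr dotv0 mulr0 mul0r.
Qed.

Lemma sqd_ratioE j l th : l != j ->
  1 + lin_term j l th + sqd (a j) th / sqd (a l) (a j) = sqd (a l) th / sqd (a l) (a j).
Proof.
move=> lj; have E0 := sqd_atom_gt0 lj.
rewrite /lin_term -[X in X + _ + _](divff (lt0r_neq0 E0)) -!mulrDl; congr (_ / _).
rewrite /sqd !enorm_sqr.
rewrite [in RHS](_ : th - a l = (a j - a l) + (th - a j)); last first.
  by apply/rowP => k; rewrite !mxE; ring.
set v := a j - a l; set u := th - a j; clearbody u v.
by rewrite !(dotDl, dotDr) (dotC u v); ring.
Qed.

(** [cell_estimate] with [e] the distance to [a j] in units of [sep H]: then [e ^+ 2 * P] is exactly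
    [cellprod th / (sep H ^+ 2 * offprod j (a j))]. In the cell of [a j] the ratios are at least 1/4
    by [near_atom_le]; in another cell the distance to [a j] is at least half of [sep H]. *)
Lemma cell_test_approx j jj th : near_atom jj th ->
  `|(jj == j)%:R - cell_test j th| <=
  cell_cst R n.-1 * (cellprod th / (sep H ^+ 2 * offprod j (a j))).
Proof.
rewrite /cell_cst; case: cid => K [K0 HK] /= njj.
pose s := [seq l <- index_enum 'I_n | l != j].
have sn : size s = n.-1 by rewrite size_filter_index_enum cardC1 card_ord.
pose b l := if l != j then lin_term j l th else 0.
pose c l := if l != j then sqd (a j) th / sqd (a l) (a j) else 0.
pose e := enorm (th - a j) / sep H.
have e0 : 0 <= e by rewrite divr_ge0 ?enorm_ge0// ltW.
have e2E : e ^+ 2 = sqd (a j) th / sep H ^+ 2 by rewrite /e /sqd expr_div_n.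
have be l : `|b l| <= 2 * e.
  rewrite /b; case: ifPn => lj; last by rewrite normr0 mulr_ge0.
  have vl : sep H <= enorm (a j - a l) by apply: sep_le; rewrite eq_sym.
  have v0 : 0 < enorm (a j - a l) := lt_le_trans sep0 vl.
  rewrite /lin_term /sqd normrM normrM (ger0_norm (_ : 0 <= 2))//.
  rewrite (ger0_norm (_ : 0 <= (enorm (a j - a l) ^+ 2)^-1)) ?invr_ge0 ?sqr_ge0//.
  rewrite -mulrA ler_wpM2l// /e.
  apply: (@le_trans _ _ (enorm (th - a j) / enorm (a j - a l))).
    rewrite ler_pdivrMr ?exprn_gt0// expr2 mulrA divfK ?gt_eqF//.
    by rewrite mulrC dot_le.
  by rewrite ler_wpM2l ?enorm_ge0// lef_pV2 ?posrE.
have ce l : 0 <= c l <= e ^+ 2.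
  rewrite /c e2E; case: ifPn => lj; last by rewrite lexx divr_ge0 ?sqd_ge0 ?sqr_ge0.
  rewrite divr_ge0 ?sqd_ge0//= ler_wpM2l ?sqd_ge0// lef_pV2 ?posrE.
  - by apply: sep_sqr_le; rewrite eq_sym.
  - exact: sqd_atom_gt0.
  - exact: exprn_gt0.
have rE l : 1 + b l + c l = if l != j then sqd (a l) th / sqd (a l) (a j) else 1.
  by rewrite /b /c; case: ifPn => lj; rewrite ?sqd_ratioE// !addr0.
have r0 l : 0 <= 1 + b l + c l.
  by rewrite rE; case: ifP => // _; rewrite divr_ge0 ?sqd_ge0.
have [] := HK _ s b c e sn e0 be ce r0.
have -> : \prod_(l <- s) (1 + b l + c l) = offprod j th / offprod j (a j).
  rewrite big_filter /offprod -prodf_div; apply: eq_bigr => l lj.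
  by rewrite rE lj.
have -> : \sum_(l <- s) b l = \sum_(l | l != j) lin_term j l th.
  by rewrite big_filter; apply: eq_bigr => l lj; rewrite /b lj.
rewrite -/(cell_test j th).
have -> : K * e ^+ 2 * (offprod j th / offprod j (a j)) =
  K * (cellprod th / (sep H ^+ 2 * offprod j (a j))).
  rewrite e2E (cellprodE j); field.
  by rewrite !gt_eqF ?offprod_self_gt0.
have [jjE _|jj_j] := eqVneq jj j.
  move=> HK2; apply: HK2 => l; rewrite rE; case: ifPn => lj; last by lra.
  rewrite ler_pdivlMr; last exact: sqd_atom_gt0.
  by rewrite jjE in njj; have := near_atom_le l njj; lra.
move=> HK1 _; rewrite sub0r normrN; apply: HK1.
rewrite -ler_sqr ?nnegrE ?invr_ge0// e2E ler_pdivlMr ?exprn_gt0//.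
have := near_atom_le j njj; have := sep_sqr_le jj_j.
rewrite exprVn; lra.
Qed.

(** The coefficients of [lin_term] are of the order of the inverse distance of the two atoms, hence
    at most of the order of the inverse of [sep H], and the factor [sep H] makes them bounded
    uniformly in H. For [l = j] the term vanishes. *)
Lemma pol_lin_term rad j l : 1 <= rad -> supp rad H ->
  pol 1 (d%:R * (2 * (1 + rad))) (fun th => sep H * lin_term j l th).
Proof.
move=> r1 sH; pose c i := sep H * 2 * (a j - a l) 0 i / sqd (a l) (a j).
have c2 i : `|c i| <= 2.
  rewrite /c; have [->|lj] := eqVneq l j; first by rewrite subrr mxE mulr0 mul0r normr0.
  have vl : sep H <= enorm (a j - a l) by apply: sep_le; rewrite eq_sym.
  rewrite !normrM (gtr0_norm sep0) (ger0_norm (_ : 0 <= 2))// normfV.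
  rewrite (gtr0_norm (sqd_atom_gt0 lj)) ler_pdivrMr ?sqd_atom_gt0//.
  rewrite mulrAC mulrC ler_wpM2l// /sqd expr2 ler_pM// ?(ltW sep0)//.
  exact: coord_le_enorm.
have ci i : pol 1 (2 * (1 + rad)) (fun th => c i * (th 0 i - a j 0 i)).
  have := polZ (c i) (polB (pol_coord i) (pol_cst d 1 (a j 0 i))).
  apply: pol_mono => //; rewrite ler_pM// ?addr_ge0// lerD2l.
  exact: le_trans (coord_le_enorm _ _) (sH j).
have := pol_sum (index_enum 'I_d) ci.
rewrite size_index_enum card_ord; apply: pol_ext => th.
rewrite /lin_term /dot mulr_sumr mulr_suml mulr_sumr; apply: eq_bigr => i _.
by rewrite /c !mxE; ring.
Qed.

Lemma pol_sqd1 rad l : 1 <= rad -> supp rad H -> pol 2 (1 + d%:R * (1 + rad) ^+ 2) (sqd (a l)).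
Proof.
by move=> r1 sH; have := pol_sqd (sH l); apply: pol_mono => //; rewrite lerDr.
Qed.

Lemma pol_sqd_prod rad (P : pred 'I_n) : 1 <= rad -> supp rad H ->
  pol (n * 2) ((1 + d%:R * (1 + rad) ^+ 2) ^+ n) (fun th => \prod_(l | P l) sqd (a l) th).
Proof.
move=> r1 sH; pose s := [seq l <- index_enum 'I_n | P l].
have sn : (size s <= n)%N.
  by rewrite size_filter_index_enum -[X in (_ <= X)%N](card_ord n) max_card.
have := pol_prod s (fun l => pol_sqd1 l r1 sH).
move=> /(pol_mono (D' := (n * 2)%N) (B' := (1 + d%:R * (1 + rad) ^+ 2) ^+ n)) H1.
apply: pol_ext (H1 _ _) => [th||].
- by rewrite big_filter.
- by rewrite leq_mul2r sn orbT.
- by rewrite ler_weXn2l// lerDl mulr_ge0// sqr_ge0.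
Qed.

Definition cell_test_mass rad : R := (1 + d%:R * (1 + rad) ^+ 2) ^+ n *
      (2 * rad + n%:R * (d%:R * (2 * (1 + rad)))).

(** The factor [sep H] compensates the linear correction and [offprod j (a j)] clears the
    denominator of the product. Both reappear as the price of the mass estimate of a single cell. *)
Lemma pol_cell_test rad j : 1 <= rad -> supp rad H -> sep H <= 2 * rad ->
  pol ((n * 2) + 1) (cell_test_mass rad)
    (fun th => sep H * offprod j (a j) * cell_test j th).
Proof.
move=> r1 sH srad.
have p1 : pol 1 (n%:R * (d%:R * (2 * (1 + rad))))
    (fun th => \sum_(l | l != j) sep H * lin_term j l th).
  pose s := [seq l <- index_enum 'I_n | l != j].
  have := pol_sum s (fun l => pol_lin_term j l r1 sH).
  move=> H1; apply: pol_ext (pol_mono _ _ H1) => [th|//|].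
    by rewrite big_filter.
  apply: ler_wpM2r; last by rewrite ler_nat size_filter_index_enum card_pred_ord.
  apply: mulr_ge0 => //; apply: mulr_ge0 => //; apply: addr_ge0 => //.
  exact: le_trans ler01 r1.
have p0 : pol 1 (2 * rad) (fun _ : 'rV[R]_d => sep H).
  by have := pol_cst d 1 (sep H); apply: pol_mono; rewrite // gtr0_norm.
have := polM (pol_sqd_prod (fun l => l != j) r1 sH) (polB p0 p1).
apply: pol_ext => th; rewrite /cell_test -mulr_sumr -/(offprod j th).
by field; rewrite gt_eqF ?offprod_self_gt0.
Qed.

Lemma pol_cellprod rad : 1 <= rad -> supp rad H ->
  pol (n * 2) ((1 + d%:R * (1 + rad) ^+ 2) ^+ n) cellprod.
Proof. exact: pol_sqd_prod. Qed.

Definition block_prod (B : {set 'I_n}) th : R := \prod_(l in B) sqd (a l) th.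

(** With [q] the product of squared distances to the atoms outside of [B], the factor of [m] has a
    double zero at [a m] and equals 1 up to O(q) near the atoms outside of [B]. One minus the
    product thus matches the indicator function to second order at all atoms. Only distances between
    [B] and its complement occur in denominators, so that no power of [sep] is lost. *)
Definition block_test (B : {set 'I_n}) th : R :=
  1 - \prod_(m in B) (1 - block_prod (~: B) th / block_prod (~: B) (a m)) ^+ 2.

Lemma block_prodC B th : cellprod th = block_prod B th * block_prod (~: B) th.
Proof.
rewrite /cellprod (bigID (mem B))/=; congr (_ * _).
by apply: eq_bigl => l; rewrite inE.
Qed.

Lemma block_prod_ge0 B th : 0 <= block_prod B th.
Proof. by apply: prodr_ge0 => l _; exact: sqd_ge0. Qed.

Lemma block_prod_atom (B : {set 'I_n}) l : l \in B -> block_prod B (a l) = 0.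
Proof. by move=> lB; rewrite /block_prod (bigD1 l)//= sqd_id mul0r. Qed.

Section block.
Variables (rad e0 : R) (B : {set 'I_n}).
Hypothesis r1 : 1 <= rad.
Hypothesis sH : supp rad H.
Hypothesis e01 : 0 < e0 <= 1.
Hypothesis eB : forall m l, m \in B -> l \notin B -> e0 <= sqd (a l) (a m).

Let r0 : 0 <= rad := le_trans ler01 r1.
Let e00 : 0 < e0. Proof. by case/andP: e01. Qed.
Let en0 : 0 < e0 ^+ n. Proof. by rewrite exprn_gt0. Qed.
Local Notation M0 := (sqd_ub rad).
Let M01 : 1 <= M0. Proof. exact: sqd_ub_ge1. Qed.
Let M00 : 0 <= M0. Proof. exact: le_trans ler01 M01. Qed.

Lemma block_prodC_ge m : m \in B -> e0 ^+ n <= block_prod (~: B) (a m).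
Proof.
move=> mB; rewrite -[in X in X <= _](card_ord n); apply: prodr_const_ge => [|l].
  by case/andP: e01 => /ltW -> ->.
by rewrite inE => lB; exact: eB.
Qed.

Lemma block_prod_ge l : l \notin B -> e0 ^+ n <= block_prod B (a l).
Proof.
move=> lB; rewrite -[in X in X <= _](card_ord n); apply: prodr_const_ge => [|m mB].
  by case/andP: e01 => /ltW -> ->.
by rewrite sqdC; exact: eB.
Qed.

Lemma block_prod_le (B' : {set 'I_n}) th : enorm th <= rad -> block_prod B' th <= M0 ^+ n.
Proof.
move=> tr; apply: (@le_trans _ _ (\prod_(l in B') M0)).
  by apply: ler_prod => l _; rewrite sqd_ge0 sqd_le// sH.
rewrite prodr_const; apply: ler_weXn2l => //; exact: card_pred_ord.
Qed.

Lemma block_test_atom l : block_test B (a l) = (l \in B)%:R.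
Proof.
rewrite /block_test; case: (boolP (l \in B)) => lB.
  rewrite (bigD1 l)//= divff ?subrr ?expr0n/= ?mul0r ?subr0//.
  by rewrite gt_eqF// (lt_le_trans en0 (block_prodC_ge lB)).
rewrite block_prod_atom ?inE//.
by rewrite big1 ?subrr// => m _; rewrite mul0r subr0 expr1n.
Qed.

Definition block_cst : R :=
  (1 + (n%:R * M0 ^+ n * (4 * rad) / e0 ^+ n) ^+ 2) ^+ n * (4 ^+ n / e0 ^+ n) +
  n%:R * ((1 + M0 ^+ n / e0 ^+ n) ^+ 2) ^+ n * ((2 + M0 ^+ n / e0 ^+ n) / e0 ^+ n)
    * (4 ^+ n / e0 ^+ n).

Lemma sqd_lipschitz l m th : enorm th <= rad ->
  `|sqd (a l) (a m) - sqd (a l) th| <= 4 * rad * enorm (th - a m).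
Proof.
move=> tr.
have -> : sqd (a l) (a m) - sqd (a l) th =
   - (dot (th - a m) (th - a l) + dot (th - a m) (a m - a l)).
  rewrite /sqd !enorm_sqr [in LHS](_ : th - a l = (th - a m) + (a m - a l)); last first.
    by apply/rowP => k; rewrite !mxE; ring.
  rewrite [in RHS](_ : th - a l = (th - a m) + (a m - a l)); last first.
    by apply/rowP => k; rewrite !mxE; ring.
  set v := a m - a l; set u := th - a m; clearbody u v.
  by rewrite !(dotDl, dotDr) (dotC v u); ring.
rewrite normrN (le_trans (ler_normD _ _))//.
have H1 := dot_le (th - a m) (th - a l); have H2 := dot_le (th - a m) (a m - a l).
have H3 := enorm_le_sum tr (sH l); have H4 := enorm_le_sum (sH m) (sH l).
have u0 := enorm_ge0 (th - a m).
have := ler_wpM2l u0 H3; have := ler_wpM2l u0 H4; lra.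
Qed.

Let lip m th : m \in B -> enorm th <= rad ->
  `|1 - block_prod (~: B) th / block_prod (~: B) (a m)| <=
   n%:R * M0 ^+ n * (4 * rad) / e0 ^+ n * enorm (th - a m).
Proof.
move=> mB tr; have bm := block_prodC_ge mB; have bm0 := lt_le_trans en0 bm.
have -> : 1 - block_prod (~: B) th / block_prod (~: B) (a m) =
  (block_prod (~: B) (a m) - block_prod (~: B) th) / block_prod (~: B) (a m).
  by rewrite mulrBl divff ?gt_eqF.
rewrite normrM normfV (gtr0_norm bm0) ler_pdivrMr//.
have := @prod_lipschitz R 'I_n (index_enum 'I_n) (mem (~: B)) (fun l => sqd (a l) (a m))
  (fun l => sqd (a l) th) M0 (4 * rad * enorm (th - a m)) M01.
rewrite size_index_enum card_ord => /(_ _)/wrap[|HL].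
  by rewrite !mulr_ge0 ?enorm_ge0.
apply: le_trans (HL _ _ _) _ => [l _|l _|l _|].
- by rewrite ger0_norm ?sqd_ge0// sqd_le// sH.
- by rewrite ger0_norm ?sqd_ge0// sqd_le// sH.
- exact: sqd_lipschitz.
set X := n%:R * M0 ^+ n; have X0 : 0 <= X by rewrite mulr_ge0// exprn_ge0.
set u := enorm (th - a m); have u0 : 0 <= u := enorm_ge0 _.
rewrite -[leLHS]mulr1 [leRHS](_ : _ = (X * (4 * rad * u)) * (block_prod (~: B) (a m) / e0 ^+ n)).
  apply: ler_wpM2l; last by rewrite ler_pdivlMr// mul1r.
  by apply: mulr_ge0 => //; apply: mulr_ge0 => //; exact: mulr_ge0.
by field; rewrite gt_eqF.
Qed.

(** In a cell of the block, the error is a product of squares bounded by [block_prod B th], while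
    [block_prod (~: B) th] is bounded below. In a cell outside, the roles are exchanged: all factors
    are 1 up to a multiple of [block_prod (~: B) th], and [block_prod B th] is bounded below. Either
    way the missing factor can be inserted to form [cellprod]. *)
Lemma block_test_approx jj th : near_atom jj th -> enorm th <= rad ->
  `|(jj \in B)%:R - block_test B th| <= block_cst * cellprod th.
Proof.
move=> nj tr; rewrite (block_prodC B).
have b0 := block_prod_ge0 B th; have c0 := block_prod_ge0 (~: B) th.
have n4 : 0 <= 4 ^+ n :> R by rewrite exprn_ge0.
have q0 : 0 <= 4 ^+ n / e0 ^+ n by rewrite divr_ge0// ltW.
set x := block_prod B th in b0 *; set y := block_prod (~: B) th in c0 *.
pose L := 1 + (n%:R * M0 ^+ n * (4 * rad) / e0 ^+ n) ^+ 2.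
have L1 : 1 <= L by rewrite lerDl sqr_ge0.
pose X := M0 ^+ n / e0 ^+ n.
have X0 : 0 <= X by apply: divr_ge0; [exact: exprn_ge0|exact: ltW].
have A0 : 0 <= L ^+ n * (4 ^+ n / e0 ^+ n).
  by rewrite mulr_ge0// exprn_ge0// (le_trans ler01).
have A1 : 0 <= n%:R * ((1 + X) ^+ 2) ^+ n * ((2 + X) / e0 ^+ n) * (4 ^+ n / e0 ^+ n).
  by rewrite !mulr_ge0// ?exprn_ge0 ?sqr_ge0 ?addr_ge0// invr_ge0 ltW.
have xy0 : 0 <= x * y by exact: mulr_ge0.
rewrite /block_cst -/L -/X mulrDl.
case: (boolP (jj \in B)) => jB.
  have y1 : 1 <= (4 ^+ n / e0 ^+ n) * y.
    rewrite mulrAC ler_pdivlMr// mul1r (le_trans (block_prodC_ge jB))//.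
    exact: near_prod.
  rewrite /block_test opprB addrC subrK.
  rewrite ger0_norm; last by apply: prodr_ge0 => m _; exact: sqr_ge0.
  apply: (@le_trans _ _ (\prod_(m in B) (L * sqd (a m) th))).
    apply: ler_prod => m mB; rewrite sqr_ge0 /=.
    rewrite -[X in X <= _](@real_normK _ _) ?num_real//.
    apply: (@le_trans _ _ ((n%:R * M0 ^+ n * (4 * rad) / e0 ^+ n * enorm (th - a m)) ^+ 2)).
      have H1 := lip mB tr.
      by rewrite lerXn2r// nnegrE (le_trans _ H1).
    by rewrite exprMn -/(sqd (a m) th) ler_wpM2r ?sqd_ge0// lerDr.
  rewrite big_split/= prodr_const -/(block_prod B th) -/x.
  apply: (@le_trans _ _ (L ^+ n * (4 ^+ n / e0 ^+ n) * (x * y))); last by rewrite lerDl mulr_ge0.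
  have -> : L ^+ n * (4 ^+ n / e0 ^+ n) * (x * y) = L ^+ n * x * (4 ^+ n / e0 ^+ n * y) by ring.
  rewrite -[X in X <= _]mulr1 ler_pM ?mulr_ge0// ?exprn_ge0 ?(le_trans ler01 L1)//.
  rewrite ler_wpM2r//; apply: ler_weXn2l => //; exact: card_pred_ord.
have x1 : 1 <= (4 ^+ n / e0 ^+ n) * x.
  rewrite mulrAC ler_pdivlMr// mul1r (le_trans (block_prod_ge jB))//.
  exact: near_prod.
rewrite sub0r normrN /block_test.
have yX m : m \in B -> 0 <= y / block_prod (~: B) (a m) <= X.
  move=> mB; have bm := block_prodC_ge mB; have bm0 := lt_le_trans en0 bm.
  rewrite divr_ge0 ?(ltW bm0)//= /X ler_pM ?invr_ge0 ?(ltW bm0)//.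
    exact: block_prod_le.
  by rewrite lef_pV2 ?posrE.
have ye m : m \in B -> y / block_prod (~: B) (a m) <= y / e0 ^+ n.
  move=> mB; have bm := block_prodC_ge mB; have bm0 := lt_le_trans en0 bm.
  by rewrite ler_wpM2l// lef_pV2 ?posrE.
have := @prod_lipschitz R 'I_n (index_enum 'I_n) (mem B) (fun=> 1)
  (fun m => (1 - y / block_prod (~: B) (a m)) ^+ 2) ((1 + X) ^+ 2) ((2 + X) * (y / e0 ^+ n)).
rewrite size_index_enum card_ord big1// => HL.
apply: le_trans (HL _ _ _ _ _) _.
- by rewrite exprn_ege1// lerDl.
- by rewrite mulr_ge0 ?addr_ge0// divr_ge0// ltW.
- by move=> m _; rewrite normr1 exprn_ege1// lerDl.
- move=> m mB; have /andP[z0 z1] := yX m mB.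
  rewrite normrX lerXn2r ?nnegrE ?addr_ge0// (le_trans (ler_normB _ _))// normr1 lerD2l.
  by rewrite ger0_norm.
- move=> m mB; have /andP[z0 z1] := yX m mB; have z2 := ye m mB.
  set z := y / _ in z0 z1 z2 *.
  have -> : 1 - (1 - z) ^+ 2 = z * (2 - z) by ring.
  rewrite normrM (ger0_norm z0) mulrC ler_pM// ler_norml; apply/andP; split; lra.
set K := n%:R * ((1 + X) ^+ 2) ^+ n.
have K0 : 0 <= K by rewrite mulr_ge0// exprn_ge0// sqr_ge0.
have ye0 : 0 <= K * ((2 + X) * (y / e0 ^+ n)).
  by rewrite mulr_ge0// mulr_ge0 ?addr_ge0// divr_ge0// ltW.
apply: (@le_trans _ _ (K * ((2 + X) / e0 ^+ n) * (4 ^+ n / e0 ^+ n) * (x * y))).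
  have -> : K * ((2 + X) / e0 ^+ n) * (4 ^+ n / e0 ^+ n) * (x * y) =
    K * ((2 + X) * (y / e0 ^+ n)) * (4 ^+ n / e0 ^+ n * x) by field; rewrite gt_eqF.
  by rewrite -[X in X <= _]mulr1 ler_wpM2l.
by rewrite lerDr mulr_ge0.
Qed.

Definition block_test_mass : R :=
  1 + ((1 + (e0 ^+ n)^-1 * (1 + d%:R * (1 + rad) ^+ 2) ^+ n) ^+ 2) ^+ n.

Lemma pol_block_test : pol (n * (2 * (n * 2))) block_test_mass (block_test B).
Proof.
set Q := (1 + d%:R * (1 + rad) ^+ 2) ^+ n.
have Q0 : 0 <= Q by rewrite exprn_ge0// addr_ge0// mulr_ge0// sqr_ge0.
have qm (m : 'I_n) : pol (2 * (n * 2)) ((1 + (e0 ^+ n)^-1 * Q) ^+ 2)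
   (fun th => (1 - (if m \in B then (block_prod (~: B) (a m))^-1 else 0) * block_prod (~: B) th) ^+ 2).
  have pB := pol_sqd_prod (mem (~: B)) r1 sH.
  set c := if _ then _ else _.
  have := polX 2 (polB (pol_cst d (n * 2) 1) (polZ c pB)).
  apply: pol_mono => //; rewrite normr1.
  have cle : `|c| <= (e0 ^+ n)^-1.
    rewrite /c; case: ifP => mB; last by rewrite normr0 invr_ge0 ltW.
    have bm := block_prodC_ge mB; have bm0 := lt_le_trans en0 bm.
    by rewrite ger0_norm ?invr_ge0 ?(ltW bm0)// lef_pV2 ?posrE.
  rewrite lerXn2r ?nnegrE ?addr_ge0 ?mulr_ge0 ?invr_ge0 ?(ltW en0)//.
  by rewrite lerD2l ler_wpM2r.
pose s := [seq l <- index_enum 'I_n | l \in B].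
have sn : (size s <= n)%N.
  by rewrite size_filter_index_enum -[X in (_ <= X)%N](card_ord n) max_card.
have p1 := pol_prod s qm.
have := polB (pol_cst d (n * (2 * (n * 2))) 1) (pol_mono (D' := (n * (2 * (n * 2)))%N)
  (B' := ((1 + (e0 ^+ n)^-1 * Q) ^+ 2) ^+ n) _ _ p1).
rewrite normr1 => p2; apply: pol_ext (p2 _ _) => [th||].
- rewrite /block_test big_filter; congr (1 - _); apply: eq_bigr => m mB.
  by rewrite mB [in RHS]mulrC.
- by rewrite leq_mul2r sn orbT.
- by rewrite ler_weXn2l// exprn_ege1// lerDl mulr_ge0// invr_ge0 ltW.
Qed.

End block.

End cells.

Lemma double_split (m b : nat) : (b <= m)%N -> (0 < b)%N ->
  (2 * m - 2 = 2 * b.-1 + (2 * m - 2 * b))%N.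
Proof. lia. Qed.

(** * Masses of cells under both mixing measures *)

Section mass_comparison.
Context {R : realType} (d : nat).
Implicit Types G H : mixing R d.

Lemma natoms_gt0 H : (0 < natoms H)%N.
Proof.
rewrite lt0n; apply/eqP => n0; have := weight_sum1 H.
rewrite big1 => [/esym/eqP|i _]; first by rewrite oner_eq0.
by have := ltn_ord i; move: (nat_of_ord i) => k; rewrite n0.
Qed.

Lemma ex_near_atom H th : exists j, near_atom (H := H) j th.
Proof.
pose j0 := Ordinal (natoms_gt0 H).
pose j := [arg min_(i < j0) (sqd (atom H i) th)]%O.
exists j => l; rewrite /j; case: arg_minP => // i _ Hi; exact: Hi.
Qed.

(* Comparison of the mass of the union of the cells selected by b, under G and H, by means
   of a test function T that agrees with b on the atoms of H. *)
Lemma cell_mass_le G H (t : 'I_(natoms G) -> 'I_(natoms H)) (b : pred 'I_(natoms H))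
    (T : 'rV[R]_d -> R) (K : R) :
  (forall l, T (atom H l) = (b l)%:R) ->
  (forall i, `|(b (t i))%:R - T (atom G i)| <= K * cellprod H (atom G i)) ->
  `|\sum_(l | b l) \sum_(i | t i == l) weight G i - \sum_(l | b l) weight H l| <=
  K * ev G (cellprod H) + `|ev G T - ev H T|.
Proof.
move=> Tb TK.
have -> : \sum_(l | b l) \sum_(i | t i == l) weight G i = \sum_i weight G i * (b (t i))%:R.
  rewrite (partition_big t xpredT)//= [in RHS](bigID b)/= [X in _ + X]big1 ?addr0; last first.
    by move=> l /negbTE bl; apply: big1 => i /eqP ->; rewrite bl mulr0.
  apply: eq_bigr => l bl; apply: eq_bigr => i /eqP ->; by rewrite bl mulr1.
have -> : \sum_(l | b l) weight H l = ev H T.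
  rewrite /ev big_mkcond; apply: eq_bigr => l _; rewrite Tb.
  by case: (b l); rewrite ?mulr1 ?mulr0.
have -> : \sum_i weight G i * (b (t i))%:R - ev H T =
  \sum_i weight G i * ((b (t i))%:R - T (atom G i)) + (ev G T - ev H T).
  by under [in RHS]eq_bigr do rewrite mulrBr; rewrite sumrB /ev; ring.
rewrite (le_trans (ler_normD _ _))// lerD2r -evZ (le_trans (ler_norm_sum _ _ _))//.
by apply: ler_sum => i _; rewrite normrM (ger0_norm (weight_ge0 _)) ler_wpM2l ?weight_ge0.
Qed.

End mass_comparison.

(** * The lower bound of the Hellinger distance *)

Section wasserstein_hellinger.
Context {R : realType} (d ks : nat).
Implicit Types G H : mixing R d.

(** The other atoms of the cluster of [j] are at distance at least [sep H], all remaining ones at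
    distance at least [D0]. The division by a power of [2 * rad] pays for replacing the size of this
    cluster by the largest one in the exponent, as [sep H] may exceed 1. *)
Lemma offprod_self_ge (rad C0 D0 : R) H (C : {set {set 'I_(natoms H)}}) j :
  1 <= rad -> 0 < D0 -> 0 < sep H -> sep H <= 2 * rad -> multi_cluster C0 D0 C ->
  sep H ^+ (2 * max_cluster C - 2) *
    (Num.min 1 (D0 ^+ 2) ^+ natoms H / (2 * rad) ^+ (2 * natoms H)) <= offprod j (atom H j).
Proof.
move=> r1 D00 s0 srad [Cp Cin Cout _]; set e0 := Num.min 1 _; set n := natoms H.
have [/eqP covC trivC _] := and3P Cp.
have jC : j \in finset.cover C by rewrite covC inE.
set B := finset.pblock C j; have BC : B \in C by exact: finset.pblock_mem.
have jB : j \in B by rewrite finset.mem_pblock.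
have e00 : 0 < e0 by rewrite lt_min ltr01 exprn_gt0.
have e01 : e0 <= 1 by rewrite ge_min lexx.
have rho1 : 1 <= 2 * rad by lra.
set m := #|B|; have m0 : (0 < m)%N by apply/card_gt0P; exists j.
have ms : (m <= max_cluster C)%N by rewrite /max_cluster (bigD1 B)//= leq_maxl.
have sn : (max_cluster C <= n)%N by apply/bigmax_leqP => B' _; exact: card_pred_ord.
rewrite /offprod (bigID (mem B))/=.
apply: (@le_trans _ _ ((sep H ^+ 2) ^+ m.-1 * e0 ^+ n)); last first.
  apply: ler_pM; rewrite ?exprn_ge0 ?sqr_ge0 ?(ltW e00) ?(ltW s0)//.
    have -> : m.-1 = #|[pred l | (l != j) && (l \in B)]|.
      rewrite /m (cardD1 j) jB /=; apply: eq_card => l.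
      by rewrite !inE.
    rewrite -prodr_const; apply: ler_prod => l /andP[lj lB].
    by rewrite sqr_ge0/= sep_sqr_le// eq_sym.
  rewrite -[in X in X <= _](card_ord n); apply: prodr_const_ge; first by rewrite ltW.
  move=> l /andP[lj lB]; rewrite ge_min; apply/orP; right.
  by rewrite /sqd lerXn2r ?nnegrE ?enorm_ge0 ?(ltW D00)//; exact: (Cout B).
rewrite mulrA ler_pdivrMr ?exprn_gt0 ?(lt_le_trans ltr01)//.
rewrite mulrAC ler_wpM2r ?exprn_ge0 ?(ltW e00)//.
rewrite -exprM.
have -> : (2 * max_cluster C - 2 = 2 * m.-1 + (2 * max_cluster C - 2 * m))%N.
  exact: double_split.
rewrite exprD ler_wpM2l ?exprn_ge0 ?(ltW s0)//.
apply: le_trans (_ : (2 * rad) ^+ (2 * max_cluster C - 2 * m) <= _).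
  by rewrite lerXn2r ?nnegrE ?(ltW s0)// (le_trans ler01).
apply: ler_weXn2l => //; rewrite (leq_trans (leq_subr _ _))//.
by rewrite leq_mul2l sn.
Qed.

(** The three terms of [wasserstein2_transport] are estimated separately. Moving to the nearest atom
    costs O(h / sg). Inside clusters, the mass errors are O(h / (sep^2 sg)) but the squared
    distances O(sep^2). Between clusters, the distances are only bounded, but the mass errors are
    O(h). *)
Lemma wasserstein2_hellinger (S : 'M[R]_d) (rad0 C0 D0 : R) : sym_posdef S -> (2 <= ks)%N ->
  0 < rad0 -> 1 <= C0 -> 0 < D0 -> exists c : R, 0 < c /\
  forall G H (C : {set {set 'I_(natoms H)}}), natoms H = ks -> supp rad0 G -> supp rad0 H ->
  (forall j, 0 < weight H j) -> 0 < sep H -> multi_cluster C0 D0 C ->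
  c * sep H ^+ (2 * max_cluster C - 2) * wasserstein2 G H ^+ 2 <= hel S G H.
Proof.
move=> pS ks2 rad00 C01 D00.
(* Enlarging the radius to at least 1 makes its powers nondecreasing in the exponent. *)
pose rad := 1 + rad0; have r1 : 1 <= rad by rewrite lerDl ltW.
have r0 : 0 <= rad := le_trans ler01 r1.
pose rho := 2 * rad; have rho1 : 1 <= rho by rewrite /rho; lra.
have rho0 : 0 < rho := lt_le_trans ltr01 rho1.
pose deg := (ks * (2 * (ks * 2)) + ks * 2 + 1)%N.
have deg1 : (ks * 2 <= deg)%N by rewrite /deg; lia.
have deg2 : (ks * 2 + 1 <= deg)%N by rewrite /deg; lia.
have deg3 : (ks * (2 * (ks * 2)) <= deg)%N by rewrite /deg; lia.
have [CD [CD0 HCD]] := pol_dual deg pS r0.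
pose e0 := Num.min 1 (D0 ^+ 2).
have e00 : 0 < e0 by rewrite lt_min ltr01 exprn_gt0.
have e01 : e0 <= 1 by rewrite ge_min lexx.
pose b0 : R := 1 + d%:R * (1 + rad) ^+ 2.
have b00 : 0 <= b0 by rewrite addr_ge0// mulr_ge0// sqr_ge0.
pose KP := b0 ^+ ks * CD.
have KP0 : 0 <= KP by rewrite mulr_ge0// exprn_ge0.
pose mt := b0 ^+ ks * (2 * rad + ks%:R * (d%:R * (2 * (1 + rad)))).
pose KT := mt * CD.
have KT0 : 0 <= KT.
  by rewrite mulr_ge0// mulr_ge0 ?exprn_ge0// addr_ge0 ?mulr_ge0// addr_ge0.
pose mb := 1 + ((1 + (e0 ^+ ks)^-1 * b0 ^+ ks) ^+ 2) ^+ ks.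
pose cb := (1 + (ks%:R * sqd_ub rad ^+ ks * (4 * rad) / e0 ^+ ks) ^+ 2) ^+ ks * (4 ^+ ks / e0 ^+ ks) +
  ks%:R * ((1 + sqd_ub rad ^+ ks / e0 ^+ ks) ^+ 2) ^+ ks * ((2 + sqd_ub rad ^+ ks / e0 ^+ ks) / e0 ^+ ks)
    * (4 ^+ ks / e0 ^+ ks).
have ei0 : 0 <= (e0 ^+ ks)^-1 by rewrite invr_ge0 exprn_ge0// ltW.
have su0 : 0 <= sqd_ub rad ^+ ks by rewrite exprn_ge0// (le_trans ler01)// sqd_ub_ge1.
have cb0 : 0 <= cb.
  rewrite /cb; apply: addr_ge0.
    apply: mulr_ge0; first by rewrite exprn_ge0// addr_ge0// sqr_ge0.
    by rewrite mulr_ge0// exprn_ge0.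
  apply: mulr_ge0; last by rewrite mulr_ge0// exprn_ge0.
  apply: mulr_ge0; first by rewrite mulr_ge0// exprn_ge0// sqr_ge0.
  by rewrite mulr_ge0// addr_ge0// mulr_ge0.
pose KB := cb * KP + mb * CD.
have KB0 : 0 <= KB.
  apply: addr_ge0; first exact: mulr_ge0.
  by rewrite mulr_ge0// addr_ge0// exprn_ge0// sqr_ge0.
have [kap kapE kap0] : exists2 kap, kap = e0 ^+ ks / rho ^+ (2 * ks) & 0 < kap.
  by exists (e0 ^+ ks / rho ^+ (2 * ks)); rewrite // divr_gt0// exprn_gt0.
pose cc := cell_cst R ks.-1; have cc0 : 0 <= cc := cell_cst_ge0 R _.
(* [KA], [KI] and [KB] are attached to the move to the nearest atoms, to the masses of single cells
   and to the masses of clusters. The first two will be divided by [sg], the power of [sep H] in the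
   statement. *)
pose KA := 4 ^+ ks * KP / kap.
have KA0 : 0 <= KA by rewrite divr_ge0 ?(ltW kap0)// mulr_ge0// exprn_ge0.
pose KI := (cc * KP + KT * rho) / kap.
have KI0 : 0 <= KI.
  by rewrite divr_ge0 ?(ltW kap0)// addr_ge0// mulr_ge0// ltW.
pose Ktot := 3 * (KA + C0 ^+ 2 * (ks%:R * KI) +
   (C0 ^+ 2 + 1) * rho ^+ 2 * (ks%:R * (KB * rho ^+ (2 * ks)))).
have Ktot0 : 0 <= Ktot.
  rewrite /Ktot mulr_ge0// addr_ge0//.
    by rewrite addr_ge0// mulr_ge0 ?sqr_ge0// mulr_ge0.
  apply: mulr_ge0; first by rewrite mulr_ge0 ?sqr_ge0// addr_ge0// sqr_ge0.
  by rewrite mulr_ge0// mulr_ge0// exprn_ge0// ltW.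
exists (1 + Ktot)^-1; split; first by rewrite invr_gt0 ltr_pwDl.
move=> G H C nH sG0 sH0 wH s0 mC.
have sG : supp rad G by move=> i; rewrite (le_trans (sG0 i))// lerDr.
have sH : supp rad H by move=> i; rewrite (le_trans (sH0 i))// lerDr.
have [Cp Cin Cout _] := mC; have [/eqP covC trivC _] := and3P Cp.
pose P j := finset.pblock C j.
have jC j : j \in finset.cover C by rewrite covC inE.
have PC j : P j \in C by exact: finset.pblock_mem.
have jP j : j \in P j by rewrite finset.mem_pblock.
have PE l j : (P l == P j) = (l \in P j).
  by rewrite /P eq_sym finset.eq_pblock.
have srad : sep H <= 2 * rad.
  have h0 : (0 < natoms H)%N by rewrite nH (leq_trans _ ks2).
  have h1 : (1 < natoms H)%N by rewrite nH.
  exact: le_trans (sep_le (_ : Ordinal h0 != Ordinal h1)) (enorm_le_sum (sH _) (sH _)).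
set h := hel S G H; have h0 : 0 <= h := hel_ge0 S G H.
set sg := sep H ^+ (2 * max_cluster C - 2).
have sg0 : 0 < sg by rewrite exprn_gt0.
have Pj j : sg * kap <= offprod j (atom H j).
  have := offprod_self_ge j r1 D00 s0 srad mC.
  have -> // : Num.min 1 (D0 ^+ 2) ^+ natoms H / (2 * rad) ^+ (2 * natoms H) = kap.
  by rewrite kapE nH.
have KPh : ev G (cellprod H) <= KP * h.
  have := HCD G H (cellprod H) (b0 ^+ ks) sG sH.
  have -> : ev H (cellprod H) = 0.
    by apply: big1 => j _; rewrite cellprod_atom mulr0.
  rewrite subr0 => H1; apply: le_trans (ler_norm _) _; apply: H1.
  have := pol_cellprod r1 sH; rewrite nH; exact: pol_mono.
have [t nt] : exists t : 'I_(natoms G) -> 'I_(natoms H), forall i, near_atom (t i) (atom G i).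
  pose t i := projT1 (cid (ex_near_atom H (atom G i))).
  by exists t => i; rewrite /t; case: cid.
pose w j := \sum_(i | t i == j) weight G i.
have bA : \sum_i weight G i * enorm (atom G i - atom H (t i)) ^+ 2 <= KA / sg * h.
  apply: (@le_trans _ _ (4 ^+ ks / (sg * kap) * ev G (cellprod H))).
    rewrite -evZ; apply: ler_sum => i _; rewrite ler_wpM2l ?weight_ge0//.
    rewrite mulrAC ler_pdivlMr ?mulr_gt0// -/(sqd _ _).
    apply: le_trans (ler_wpM2l (sqd_ge0 _ _) (Pj (t i))) _.
    rewrite (cellprodE (t i)) mulrCA ler_wpM2l ?sqd_ge0//.
    by rewrite -nH; exact: near_prod (nt i).
  apply: le_trans (ler_wpM2l _ KPh) _; first by rewrite divr_ge0 ?exprn_ge0// ltW// mulr_gt0.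
  rewrite le_eqVlt; apply/orP; left; apply/eqP; rewrite /KA.
  by field; rewrite !gt_eqF.
(* The mass of a single cell is known only up to a multiple of [h / (sep H ^+ 2 * p)]. The factor
   [sep H ^+ 2] on the left is the one offered by the diameter of a cluster. *)
have bI j : sep H ^+ 2 * `|w j - weight H j| <= KI / sg * h.
  set p := offprod j (atom H j); have p0 : 0 < p := offprod_self_gt0 s0 j.
  have := @cell_mass_le R d G H t (pred1 j) (cell_test j) (cc / (sep H ^+ 2 * p)).
  rewrite !big_pred1_eq -/(w j) => H1.
  have {}H1 := H1 (fun l => cell_test_atom s0 j l) _.
  have Tpol : `|ev G (cell_test j) - ev H (cell_test j)| <= KT * h / (sep H * p).
    rewrite ler_pdivlMr ?mulr_gt0// mulrC -(gtr0_norm (_ : 0 < sep H * p)) ?mulr_gt0//.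
    rewrite -normrM mulrBr -!evZ; apply: HCD => //.
    have T := pol_cell_test s0 j r1 sH srad; rewrite /cell_test_mass nH in T.
    exact: (pol_mono deg2 (lexx _) T).
  apply: (@le_trans _ _ (sep H ^+ 2 * (cc / (sep H ^+ 2 * p) * (KP * h) + KT * h / (sep H * p)))).
    rewrite ler_wpM2l ?sqr_ge0//; apply: le_trans (H1 _) _.
      have ccE : cell_cst R (natoms H).-1 = cc by rewrite nH.
      by move=> i; have := cell_test_approx s0 j (nt i); rewrite ccE mulrCA mulrC.
    apply: lerD Tpol; apply: ler_wpM2l KPh; apply: divr_ge0 => //.
    by apply: mulr_ge0; [exact: sqr_ge0|exact: ltW].
  have -> : sep H ^+ 2 * (cc / (sep H ^+ 2 * p) * (KP * h) + KT * h / (sep H * p)) =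
    (cc * KP + KT * sep H) * h / p by field; rewrite !gt_eqF.
  apply: (@le_trans _ _ ((cc * KP + KT * rho) * h / (sg * kap))).
    rewrite ler_pM//.
    - by apply: mulr_ge0 => //; apply: addr_ge0; apply: mulr_ge0 => //; exact: ltW.
    - by rewrite invr_ge0 ltW.
    - by rewrite ler_wpM2r// lerD2l ler_wpM2l.
    - by rewrite lef_pV2 ?posrE ?mulr_gt0// Pj.
  rewrite le_eqVlt; apply/orP; left; apply/eqP; rewrite /KI.
  by field; rewrite !gt_eqF.
pose W j := \sum_(l | P l == P j) w l.
pose Q j := \sum_(l | P l == P j) weight H l.
have bW j : `|W j - Q j| <= KB * h.
  have eB m l : m \in P j -> l \notin P j -> e0 <= sqd (atom H l) (atom H m).
    move=> mP lP; rewrite ge_min; apply/orP; right.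
    by rewrite /sqd lerXn2r ?nnegrE ?enorm_ge0 ?(ltW D00)//; exact: (Cout (P j)).
  have e0' : 0 < e0 <= 1 by rewrite e00.
  have := @cell_mass_le R d G H t (mem (P j)) (block_test (P j)) cb.
  rewrite (eq_bigl (fun l => P l == P j)); last by move=> l; rewrite PE.
  rewrite [X in _ - X](eq_bigl (fun l => P l == P j)); last by move=> l; rewrite PE.
  rewrite -/(W j) -/(Q j) => H1; apply: le_trans (H1 _ _) _ => [l|i|].
  - exact: (block_test_atom e0' eB l).
  - have cbE : block_cst H rad e0 = cb by rewrite /block_cst nH.
    by have := block_test_approx r1 sH e0' eB (nt i) (sG i); rewrite cbE.
  have -> : KB * h = cb * (KP * h) + mb * CD * h by rewrite /KB; ring.
  apply: lerD; first exact: ler_wpM2l.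
  apply: HCD => //; have T := pol_block_test r1 sH e0' eB; rewrite /block_test_mass nH in T.
  exact: (pol_mono deg3 (lexx _) T).
have Q0 j : 0 < Q j.
  by rewrite /Q (bigD1 j)//= ltr_pwDl// sumr_ge0// => l _; exact: weight_ge0.
have W0 j : 0 <= W j.
  by apply: sumr_ge0 => l _; apply: sumr_ge0 => i _; exact: weight_ge0.
have QP l j : P l == P j -> Q l = Q j by move=> /eqP E; rewrite /Q E.
have WP l j : P l == P j -> W l = W j by move=> /eqP E; rewrite /W E.
(* The intermediate distribution has the cluster masses of G, split inside each cluster in the
   proportions of H. It is reached from [w] without leaving clusters, and differs from H by the
   errors of cluster masses only. *)
pose w' j := weight H j * (W j / Q j).
have wQ j : weight H j <= Q j.
  by rewrite /Q (bigD1 j)//= lerDl sumr_ge0// => l _; exact: weight_ge0.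
have w'd j : `|w' j - weight H j| <= KB * h.
  apply: le_trans (bW j); have -> : w' j - weight H j = weight H j / Q j * (W j - Q j).
    by rewrite /w'; field; rewrite gt_eqF.
  rewrite normrM ler_piMl// ger0_norm ?divr_ge0 ?weight_ge0 ?(ltW (Q0 j))//.
  by rewrite ler_pdivrMr// mul1r.
have w'0 j : 0 <= w' j.
  by apply: mulr_ge0; [exact: weight_ge0|apply: divr_ge0 => //; exact: ltW].
have ww' j : \sum_(l | P l == P j) w l = \sum_(l | P l == P j) w' l.
  rewrite -/(W j); transitivity (\sum_(l | P l == P j) weight H l * (W j / Q j)).
    by rewrite -mulr_suml -/(Q j) mulrC divfK ?gt_eqF.
  by apply: eq_bigr => l lj; rewrite /w' (WP _ _ lj) (QP _ _ lj).
have Pr j l : P j = P l -> enorm (atom H j - atom H l) ^+ 2 <= (C0 * sep H) ^+ 2.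
  move=> jl; have [->|jl'] := eqVneq j l; first by rewrite subrr enorm0 expr0n sqr_ge0.
  rewrite lerXn2r ?nnegrE ?enorm_ge0 ?mulr_ge0 ?(ltW s0) ?(le_trans ler01 C01)//.
  by apply: (Cin (P j)) => //; rewrite -PE; apply/eqP; exact/esym.
have rD j l : enorm (atom H j - atom H l) ^+ 2 <= rho ^+ 2.
  rewrite lerXn2r ?nnegrE ?enorm_ge0 ?(ltW rho0)//.
  exact: enorm_le_sum.
have HW := @wasserstein2_transport R d G H _ P t w' _ _ w'0 ww' Pr rD.
have cardks : \sum_(j < natoms H) (1 : R) = ks%:R.
  by rewrite sumr_const card_ord nH.
(* The term between clusters comes without the factor [1 / sg]; it can be inserted because [sg] is
   bounded. *)
have sgr : 1 <= rho ^+ (2 * ks) / sg.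
  rewrite ler_pdivlMr// mul1r /sg.
  apply: (@le_trans _ _ (rho ^+ (2 * max_cluster C - 2))).
    by rewrite lerXn2r ?nnegrE ?(ltW s0) ?(ltW rho0).
  apply: ler_weXn2l => //; rewrite (leq_trans (leq_subr _ _))// leq_mul2l /=.
  by rewrite -[X in (_ <= X)%N]nH; apply/bigmax_leqP => B' _; exact: card_pred_ord.
have sumKB : \sum_j `|w' j - weight H j| <= ks%:R * (KB * h).
  by rewrite -cardks mulr_suml; apply: ler_sum => j _; rewrite mul1r.
have sumI : sep H ^+ 2 * \sum_j `|w j - weight H j| <= ks%:R * (KI / sg * h).
  by rewrite -cardks mulr_suml mulr_sumr; apply: ler_sum => j _; rewrite mul1r.
have sumw : \sum_j `|w j - w' j| <= \sum_j `|w j - weight H j| + ks%:R * (KB * h).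
  apply: le_trans (lerD (lexx _) sumKB); rewrite -big_split/=; apply: ler_sum => j _.
  by rewrite (le_trans _ (ler_normB _ _))// opprB addrA subrK.
have W2K : wasserstein2 G H ^+ 2 <= Ktot / sg * h.
  pose X := ks%:R * (KB * h).
  have X0 : 0 <= X by rewrite mulr_ge0// mulr_ge0.
  have -> : Ktot / sg * h = 3 * (KA / sg * h + C0 ^+ 2 * (ks%:R * (KI / sg * h)) +
      (C0 ^+ 2 + 1) * (rho ^+ 2 * X) * (rho ^+ (2 * ks) / sg)).
    by rewrite /Ktot /X; ring.
  apply: le_trans HW _; rewrite -/X in sumKB sumw.
  move: bA sumw sumKB sumI; move: (\sum_i weight G i * _) => A.
  move: (\sum_j `|w j - w' j|) (\sum_j `|w' j - _|) (\sum_j `|w j - weight H j|) => Bw B' B1.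
  move=> bA sumw sumKB sumI.
  have sr : sep H ^+ 2 <= rho ^+ 2 by rewrite lerXn2r ?nnegrE ?(ltW s0) ?(ltW rho0).
  have C20 : 0 <= C0 ^+ 2 := sqr_ge0 _.
  have F1 : (C0 * sep H) ^+ 2 * Bw <= C0 ^+ 2 * (ks%:R * (KI / sg * h)) + C0 ^+ 2 * (rho ^+ 2 * X).
    have -> : (C0 * sep H) ^+ 2 * Bw = C0 ^+ 2 * (sep H ^+ 2 * Bw) by ring.
    rewrite -mulrDr; apply: ler_wpM2l => //.
    apply: le_trans (ler_wpM2l (sqr_ge0 _) sumw) _; rewrite mulrDr; apply: lerD => //.
    exact: ler_wpM2r.
  have F2 : rho ^+ 2 * B' <= rho ^+ 2 * X by apply: ler_wpM2l => //; exact: sqr_ge0.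
  have F3 : (C0 ^+ 2 + 1) * (rho ^+ 2 * X) <= (C0 ^+ 2 + 1) * (rho ^+ 2 * X) * (rho ^+ (2 * ks) / sg).
    by rewrite ler_peMr// mulr_ge0 ?addr_ge0// mulr_ge0// sqr_ge0.
  apply: ler_wpM2l => //; apply: le_trans (lerD (lerD bA F1) F2) _.
  rewrite -!addrA; apply: lerD => //; apply: lerD => //.
  by apply: le_trans F3; rewrite mulrDl mul1r.
rewrite mulrAC -mulrA ler_pdivrMl; last by rewrite ltr_pwDl.
apply: le_trans (_ : Ktot * h <= _); last by rewrite ler_wpM2r// lerDr.
have -> : Ktot * h = sg * (Ktot / sg * h) by field; rewrite gt_eqF.
by rewrite mulrC; apply: ler_wpM2l W2K; exact: ltW.
Qed.

End wasserstein_hellinger.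

(** * Integrals of products of independent variables *)

Section integral_extension.
Local Open Scope ereal_scope.
Context d1 d2 (T1 : measurableType d1) (T2 : measurableType d2) (R : realType).
Variables (m1 : {measure set T1 -> \bar R}) (m2 : {measure set T2 -> \bar R}).
Variables (g : T1 -> R) (Y : T1 -> T2) (c : R).
Hypotheses (mg : measurable_fun setT g) (g0 : forall x, (0 <= g x)%R).
Hypothesis mY : measurable_fun setT Y.
Hypothesis indicE : forall A, measurable A ->
  \int[m1]_x ((g x)%:E * (\1_A (Y x))%:E) = c%:E * m2 A.

Import HBNNSimple.

Let mgE : measurable_fun setT (EFin \o g). Proof. exact/measurable_EFinP. Qed.

Let integral_nnsfun (h : {nnsfun T2 >-> R}) :
  \int[m1]_x ((g x)%:E * (h (Y x))%:E) = c%:E * \int[m2]_y (h y)%:E.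
Proof.
have mI r : measurable_fun setT (fun x => (\1_(h @^-1` [set r]) (Y x))%:E : \bar R).
  by apply/measurable_EFinP; apply: (measurableT_comp _ mY).
transitivity (\int[m1]_x \sum_(r \in range h)
    (r%:E * ((g x)%:E * (\1_(h @^-1` [set r]) (Y x))%:E))).
  apply: eq_integral => x _; rewrite fimfunE -fsumEFin// ge0_mule_fsumr; last first.
    by move=> r; rewrite EFinM nnfun_muleindic_ge0.
  by apply: eq_fsbigr => r _; rewrite EFinM muleCA.
have r0 r : range h r -> (0 <= r)%R by case=> y _ <-.
rewrite ge0_integral_fsum//; last 2 first.
- by move=> r; apply: emeasurable_funM => //; exact: emeasurable_funM.
- by move=> r x _; rewrite muleCA mule_ge0 ?lee_fin//; exact: (nnfun_muleindic_ge0 h r (Y x)).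
transitivity (c%:E * \int[m2]_y \sum_(r \in range h) (r * \1_(h @^-1` [set r]) y)%:E); last first.
  by congr (_ * _); apply: eq_integral => y _; rewrite fimfunE -fsumEFin.
rewrite [in RHS]ge0_integral_fsum//; last 2 first.
- by move=> r; exact/measurable_EFinP/measurable_funM.
- by move=> r x _; rewrite nnfun_muleindic_ge0.
rewrite ge0_mule_fsumr; last first.
  by move=> r; apply: integral_ge0 => x _; rewrite nnfun_muleindic_ge0.
apply: eq_fsbigr => r /[!inE] /r0 r0'.
rewrite ge0_integralZl//; last 2 first.
- exact: emeasurable_funM.
- by move=> x _; rewrite mule_ge0// lee_fin.
by rewrite integralZl_indic_nnsfun// integral_indic// setIT indicE// muleCA.
Qed.

(** Passage from indicator functions to nonnegative functions, by simple functions and monotone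
    convergence. It is used with [g] the product of the other factors of an independent family, and
    with [g] a density and [Y] the identity. *)
Lemma integral_extension (f : T2 -> \bar R) : measurable_fun setT f ->
  (forall y, 0 <= f y) ->
  \int[m1]_x ((g x)%:E * f (Y x)) = c%:E * \int[m2]_y f y.
Proof.
move=> mf f0; pose f_ := nnsfun_approx measurableT mf.
have mf_ n : measurable_fun setT (fun x => (f_ n x)%:E) by exact/measurable_EFinP.
have mfY n : measurable_fun setT (fun x => (f_ n (Y x))%:E).
  by apply: (measurableT_comp (mf_ n) mY).
have ndf y : {homo (fun n => (f_ n y)%:E) : a b / (a <= b)%N >-> a <= b}.
  by move=> a b ab; rewrite lee_fin; exact/lefP/nd_nnsfun_approx.
have cvf y : (fun n => (f_ n y)%:E) @ \oo --> f y by apply: cvg_nnsfun_approx.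
transitivity (limn (fun n => \int[m1]_x ((g x)%:E * (f_ n (Y x))%:E))).
  rewrite -monotone_convergence//=.
  - apply: eq_integral => x _; apply/esym/cvg_lim => //.
    by apply: cvgeZl => //; exact: cvf.
  - by move=> n; exact: emeasurable_funM.
  - by move=> n x _; rewrite mule_ge0// lee_fin.
  - by move=> x _ a b ab; rewrite lee_wpmul2l ?lee_fin//; exact/lefP/nd_nnsfun_approx.
rewrite (_ : \int[m2]_y f y = limn (fun n => \int[m2]_x (f_ n x)%:E)); last first.
  rewrite -monotone_convergence//=.
  - by apply: eq_integral => x _; apply/esym/cvg_lim.
  - by move=> n x _; rewrite lee_fin.
rewrite -limeMl//.
  by congr (limn _); apply/funext => n /=; rewrite integral_nnsfun.
apply/ereal_nondecreasing_is_cvgn => a b ab; apply: ge0_le_integral => //.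
- by move=> x _; rewrite lee_fin.
- by move=> x _; exact: ndf.
Qed.

End integral_extension.

Section independent_product.
Local Open Scope ereal_scope.
Context d1 d2 (Omega : measurableType d1) (E : measurableType d2) (R : realType).
Variables (P : probability Omega R) (n : nat) (X : 'I_n -> {mfun Omega >-> E}).
Hypothesis indepX : forall A : 'I_n -> set E, (forall i, measurable (A i)) ->
  P (\bigcap_i (X i @^-1` A i)) = \prod_(i < n) P (X i @^-1` A i).

Let mX A i : measurable A -> measurable (X i @^-1` A).
Proof. by move=> mA; rewrite -[X in measurable X]setTI; exact: measurable_funP. Qed.

Let integral_indicX A i : measurable A ->
  \int[P]_w (\1_A (X i w) : R)%:E = P (X i @^-1` A).
Proof.
move=> mA; rewrite -[in RHS](setIT (X i @^-1` A)) -integral_indic//; last exact: mX.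
Qed.

(** [s] lists the factors that may be arbitrary; the others are indicator functions. With no
    arbitrary factor this is the independence of events. To free the factor [i], the induction
    hypothesis is applied with an indicator function in its place, and [integral_extension] then
    extends the identity in that variable. *)
Let integral_prod_seq (s : seq 'I_n) (phi : 'I_n -> E -> R) (I : 'I_n -> R) :
  (forall i, measurable_fun setT (phi i)) -> (forall i x, (0 <= phi i x)%R) ->
  (forall i, \int[P]_w (phi i (X i w))%:E = (I i)%:E) ->
  (forall i, i \notin s -> exists2 A, measurable A & phi i = \1_A) ->
  \int[P]_w (\prod_i phi i (X i w))%:E = (\prod_i I i)%:E.
Proof.
elim: s phi I => [|i s IH] phi I mphi phi0 phiI phis.
  pose A (i : 'I_n) : set E := projT1 (cid2 (phis i isT)).
  have mA (i : 'I_n) : measurable (A i) by rewrite /A; case: cid2.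
  have phiA i : phi i = \1_(A i) by rewrite /A; case: cid2.
  have IA i : (I i)%:E = P (X i @^-1` A i).
    by rewrite -integral_indicX// -phiI phiA.
  transitivity (\int[P]_w (\1_(\bigcap_i (X i @^-1` A i)) w : R)%:E).
    apply: eq_integral => w _; congr EFin.
    have -> : (\prod_i phi i (X i w) = \prod_i (X i w \in A i)%:R)%R.
      by apply: eq_bigr => i _; rewrite phiA indicE.
    rewrite indicE; case: (pselect ((\bigcap_i (X i @^-1` A i)) w)) => [Aw|nA].
      by rewrite mem_set// big1// => i _; rewrite mem_set//; exact: Aw.
    rewrite memNset//.
    have [i nAi] : exists i, ~ A i (X i w).
      by apply/existsNP => AA; apply: nA => i _; exact: AA.
    by rewrite (bigD1 i)//= memNset// mul0r.
  rewrite integral_indic// ?setIT; last first.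
    by apply: fin_bigcap_measurable => // i _; exact: mX.
  transitivity (\prod_(i < n) P (X i @^-1` A i)); first exact: indepX.
  by rewrite -prodEFin; apply: eq_bigr => i _; rewrite IA.
have mpX j (f : E -> R) : measurable_fun setT f -> measurable_fun setT (fun w => f (X j w)).
  by move=> mf; apply: (measurableT_comp mf).
rewrite (bigD1 i)//=; under eq_integral do rewrite (bigD1 i)//= mulrC EFinM.
pose g w := (\prod_(j < n | j != i) phi j (X j w))%R.
pose c := (\prod_(j < n | j != i) I j)%R.
have mg : measurable_fun setT g.
  rewrite /g; under eq_fun do rewrite -big_filter.
  by apply: measurable_prod => j _; exact: mpX.
have g0 w : (0 <= g w)%R by apply: prodr_ge0.
have gE A : measurable A ->
    \int[P]_w ((g w)%:E * (\1_A (X i w))%:E) = c%:E * pushforward P (X i) A.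
  move=> mA; pose phi' j := if j == i then \1_A : E -> R else phi j.
  pose I' j := if j == i then fine (P (X i @^-1` A)) else I j.
  transitivity (\int[P]_w (\prod_j phi' j (X j w))%:E).
    apply: eq_integral => w _; rewrite -EFinM; congr EFin.
    rewrite [RHS](bigD1 i)//= /phi' eqxx mulrC; congr (_ * _)%R.
    by apply: eq_bigr => j /negPf ->.
  rewrite (IH phi' I').
  + rewrite (bigD1 i)//= /I' eqxx EFinM fineK ?fin_num_measure//; last exact: mX.
    by rewrite muleC; congr (_%:E * _); apply: eq_bigr => j /negPf ->.
  + by move=> j; rewrite /phi'; case: ifP => // _; exact: measurable_indic.
  + by move=> j x; rewrite /phi'; case: ifP.
  + move=> j; rewrite /phi' /I'; case: ifP => // /eqP ->.
    by rewrite integral_indicX// fineK// fin_num_measure//; exact: mX.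
  + move=> j js; rewrite /phi'; case: ifPn => [_|ji]; first by exists A.
    by apply: phis; rewrite inE negb_or ji.
have mXi : measurable_fun setT (X i) by [].
have mphiE : measurable_fun setT (EFin \o phi i) by exact/measurable_EFinP.
have phiE0 x : 0 <= (EFin \o phi i) x by rewrite lee_fin.
rewrite -/c (integral_extension mg g0 mXi gE mphiE phiE0).
rewrite ge0_integral_pushforward//.
by rewrite preimage_setT phiI EFinM muleC.
Qed.

Lemma integral_prod_indep (phi : 'I_n -> E -> R) (I : 'I_n -> R) :
  (forall i, measurable_fun setT (phi i)) -> (forall i x, (0 <= phi i x)%R) ->
  (forall i, \int[P]_w (phi i (X i w))%:E = (I i)%:E) ->
  \int[P]_w (\prod_i phi i (X i w))%:E = (\prod_i I i)%:E.
Proof.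
move=> mphi phi0 phiI; apply: (integral_prod_seq (s := enum 'I_n)) => // i.
by rewrite mem_enum.
Qed.

End independent_product.

(** * Integrals over an i.i.d. sample *)

Section iid_integrals.
Context {R : realType} (d : nat) (disp : measure_display)
  (Omega : measurableType disp) (P : probability Omega R) (n : nat)
  (X : 'I_n -> {mfun Omega >-> d.-tuple (measurableTypeR R)}).
Variable p : 'rV[R]_d -> R.
Hypotheses (p0 : forall x, 0 <= p x) (ip : rv_integrable p) (iidX : iid_sample P X p).

Local Notation Z i w := (rv_of_tuple (X i w)).

Lemma measurable_sample (f : 'rV[R]_d -> R) i : rv_measurable f ->
  measurable_fun setT (fun w => f (Z i w)).
Proof. by move=> mf; apply: (measurableT_comp mf). Qed.

Lemma iid_marginal (f : 'rV[R]_d -> R) i : rv_measurable f -> (forall x, 0 <= f x) ->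
  rv_integrable (fun x => p x * f x) ->
  (\int[P]_w (f (Z i w))%:E)%E = (rv_int (fun x => p x * f x))%:E.
Proof.
move=> mf f0 ipf; rewrite (EFin_rv_int ipf).
have mp := rv_integrable_meas ip.
have mid : measurable_fun setT (@id (d.-tuple (measurableTypeR R))) by exact: measurable_id.
have indicE (A : set (d.-tuple (measurableTypeR R))) : measurable A ->
   (\int[lebesgue_tuple d]_t ((p (rv_of_tuple t))%:E * (\1_A t)%:E) =
    1%:E * pushforward P (X i) A)%E.
  move=> mA; rewrite mul1e [RHS](iidX.1 i A mA) [RHS]integral_mkcond.
  by apply: eq_integral => t _; rewrite epatch_indic.
have mfE : measurable_fun setT (fun t : d.-tuple (measurableTypeR R) => (f (rv_of_tuple t))%:E).
  exact/measurable_EFinP.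
have f0E (t : d.-tuple (measurableTypeR R)) : (0 <= (f (rv_of_tuple t))%:E)%E.
  by rewrite lee_fin.
transitivity (\int[lebesgue_tuple d]_t ((p (rv_of_tuple t))%:E * (f (rv_of_tuple t))%:E))%E; last first.
  by apply: eq_integral.
rewrite (integral_extension mp _ mid indicE mfE f0E)// mul1e.
by rewrite ge0_integral_pushforward.
Qed.

Lemma iid_prod (phi : 'I_n -> 'rV[R]_d -> R) : (forall i, rv_measurable (phi i)) ->
  (forall i x, 0 <= phi i x) -> (forall i, rv_integrable (fun x => p x * phi i x)) ->
  (\int[P]_w (\prod_i phi i (Z i w))%:E)%E = (\prod_i rv_int (fun x => p x * phi i x))%:E.
Proof.
move=> mphi phi0 iphi.
apply: (integral_prod_indep iidX.2 (phi := fun i t => phi i (rv_of_tuple t))) => // i.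
exact: iid_marginal.
Qed.

(** The total mass of [p] is read off the law of a sample point, which must exist. *)
Lemma iid_density_int : (0 < n)%N -> rv_int p = 1.
Proof.
case: n X iidX => // n' X' [XP _] _; have := XP ord0 setT measurableT.
rewrite preimage_setT probability_setT -(EFin_rv_int ip).
by move=> [].
Qed.

(** Chebyshev's inequality for a deviation of 1 of the empirical mean; the variance of the sum is at
    most [n%:R * mu2], the second moment serving as a bound of the variance. *)
Lemma iid_chebyshev (Y : 'rV[R]_d -> R) (mu1 mu2 : R) : (0 < n)%N -> rv_measurable Y ->
  (forall x, 0 <= Y x) -> rv_integrable (fun x => p x * Y x) ->
  rv_integrable (fun x => p x * Y x ^+ 2) ->
  rv_int (fun x => p x * Y x) <= mu1 -> rv_int (fun x => p x * Y x ^+ 2) <= mu2 ->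
  (P [set w | (n%:R * (mu1 + 1) < \sum_i Y (Z i w))%R] <= (mu2 / n%:R)%:E)%E.
Proof.
move=> n0 mY Y0 iY iY2 Ymu1 Ymu2.
have n0' : 0 < n%:R :> R by rewrite ltr0n.
pose mu := rv_int (fun x => p x * Y x).
pose S w := \sum_i Y (Z i w).
have mS : measurable_fun setT S by apply: measurable_sum => i; exact: measurable_sample.
have S0 w : 0 <= S w by apply: sumr_ge0.
pose A := [set w | n%:R * (mu + 1) < S w].
have mA : measurable A by rewrite -[A]setTI; exact: measurable_fun_ltr.
have muge0 : 0 <= mu by apply: rv_int_ge0 => x; rewrite mulr_ge0.
have ES : (\int[P]_w (S w)%:E = (n%:R * mu)%:E)%E.
  under eq_integral do rewrite -sumEFin.
  rewrite ge0_integral_sum//=; last 2 first.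
  - by move=> i; apply/measurable_EFinP; exact: measurable_sample.
  - by move=> i w _; rewrite lee_fin.
  under eq_bigr do rewrite iid_marginal//.
  by rewrite sumEFin sumr_const card_ord mulr_natl.
have EYY i j : i != j -> (\int[P]_w (Y (Z i w) * Y (Z j w))%:E = (mu ^+ 2)%:E)%E.
  move=> ij; pose phi (l : 'I_n) := if (l == i) || (l == j) then Y else fun=> 1.
  have phii : phi i = Y by rewrite /phi eqxx.
  have phij : phi j = Y by rewrite /phi eqxx orbT.
  have := @iid_prod phi.
  rewrite (bigD1 i)//= (bigD1 j) 1?eq_sym//= big1; last first.
    move=> l /andP[li lj]; rewrite /phi (negPf li) (negPf lj)/=.
    by rewrite -[RHS](iid_density_int n0); apply: eq_rv_int => x; rewrite mulr1.
  rewrite mulr1 phii phij -/mu -expr2 => <-.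
  - apply: eq_integral => w _; congr EFin.
    rewrite (bigD1 i)//= (bigD1 j) 1?eq_sym//= big1 ?mulr1.
      by rewrite phii phij.
    by move=> l /andP[li lj]; rewrite /phi (negPf li) (negPf lj).
  - by move=> l; rewrite /phi; case: ifP => _ //; exact: rv_measurable_cst.
  - by move=> l x; rewrite /phi; case: ifP.
  - move=> l; rewrite /phi; case: ifP => // _.
    by apply: eq_integrable ip => // t _; rewrite mulr1.
have ES2 : (\int[P]_w (S w ^+ 2)%:E <= (n%:R * mu2 + n%:R ^+ 2 * mu ^+ 2)%:E)%E.
  under eq_integral => w _.
    rewrite expr2 {1}/S mulr_suml -sumEFin.
    under eq_bigr do rewrite /S mulr_sumr -sumEFin.
    over.
  rewrite ge0_integral_sum//=; last 2 first.
  - move=> i; apply: emeasurable_sum => j; apply/measurable_EFinP.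
    by apply: measurable_funM; exact: measurable_sample.
  - by move=> i w _; apply: sume_ge0 => j _; rewrite lee_fin mulr_ge0.
  apply: (@le_trans _ _ (\sum_(i < n) (mu2 + n%:R * mu ^+ 2)%:E)%E); last first.
    rewrite sumEFin sumr_const card_ord lee_fin -[leLHS]mulr_natl.
    by rewrite mulrDr mulrA -(expr2 n%:R).
  apply: lee_sum => i _; rewrite ge0_integral_sum//=; last 2 first.
  - by move=> j; apply/measurable_EFinP; apply: measurable_funM; exact: measurable_sample.
  - by move=> j w _; rewrite lee_fin mulr_ge0.
  rewrite (bigD1 i)//= EFinD; apply: leeD.
    rewrite (_ : \int[P]_w _ = (rv_int (fun x => (p x * Y x ^+ 2)))%:E)%E ?lee_fin//.
    rewrite -(iid_marginal i)//; first exact: rv_measurableX.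
    by move=> x; exact: sqr_ge0.
  apply: (@le_trans _ _ (\sum_(j < n | j != i) (mu ^+ 2)%:E)%E).
    by apply: lee_sum => j ji; rewrite EYY// eq_sym.
  rewrite sumEFin sumr_const lee_fin -[leLHS]mulr_natl ler_wpM2r ?sqr_ge0// ler_nat.
  by rewrite (leq_trans (max_card _))// card_ord.
(* The pointwise inequality [n^2 <= (S - n mu)^2] on [A], with the square expanded and the cross
   term moved to the left: all integrands are then nonnegative. *)
have key : (\int[P]_w ((n%:R ^+ 2 * \1_A w) + 2 * n%:R * mu * S w)%:E <=
    \int[P]_w (S w ^+ 2 + n%:R ^+ 2 * mu ^+ 2)%:E)%E.
  apply: ge0_le_integral => //.
  - by move=> w _; rewrite lee_fin addr_ge0// !mulr_ge0// ?sqr_ge0.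
  - apply/measurable_EFinP; apply: measurable_funD; apply: measurable_funM => //.
  - apply/measurable_EFinP; apply: measurable_funD => //; exact: measurable_funX.
  - move=> w _; rewrite lee_fin indicE; case: (boolP (w \in A)) => [/set_mem wA|_].
      rewrite mulr1; rewrite /A/= in wA.
      have : n%:R ^+ 2 <= (S w - n%:R * mu) ^+ 2.
        by rewrite ler_sqr ?nnegrE; nra.
      by rewrite !expr2; nra.
    by rewrite mulr0 add0r -subr_ge0; have := sqr_ge0 (S w - n%:R * mu); rewrite !expr2; nra.
apply: (@le_trans _ _ (P A)).
  apply: le_measure; rewrite ?inE//.
    by rewrite -[X in measurable X]setTI; exact: measurable_fun_ltr.
  by move=> w /=; apply: le_lt_trans; rewrite ler_wpM2l ?(ltW n0')// lerD2r.
have [a PA] : exists a, P A = a%:E by exists (fine (P A)); rewrite fineK// fin_num_measure.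
move: key; under eq_integral do rewrite EFinD EFinM (EFinM (2 * n%:R * mu)).
have m1 : measurable_fun setT (fun w => ((n%:R ^+ 2 : R)%:E * (\1_A w)%:E)%E).
  by apply/measurable_EFinP; apply: measurable_funM.
have m2 : measurable_fun setT (fun w => ((2 * n%:R * mu)%:E * (S w)%:E)%E).
  by apply/measurable_EFinP; apply: measurable_funM.
have m3 : measurable_fun setT (fun w => (S w ^+ 2)%:E).
  by apply/measurable_EFinP; exact: measurable_funX.
have m4 : measurable_fun setT (fun w : Omega => (\1_A w : R)%:E).
  exact/measurable_EFinP.
have m5 : measurable_fun setT (fun w => (S w)%:E) by exact/measurable_EFinP.
have c0 : 0 <= n%:R ^+ 2 :> R by exact: sqr_ge0.
have c1 : 0 <= 2 * n%:R * mu by rewrite !mulr_ge0.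
have c2 : 0 <= n%:R ^+ 2 * mu ^+ 2 by rewrite mulr_ge0 ?sqr_ge0.
have p1 w : setT w -> (0 <= (n%:R ^+ 2)%:E * (\1_A w : R)%:E)%E.
  by move=> _; rewrite -EFinM lee_fin mulr_ge0.
have p2 w : setT w -> (0 <= (2 * n%:R * mu)%:E * (S w)%:E)%E.
  by move=> _; rewrite -EFinM lee_fin mulr_ge0.
rewrite (ge0_integralD P measurableT p1 m1 p2 m2).
have p4 w : setT w -> (0 <= (S w)%:E)%E by move=> _; rewrite lee_fin.
rewrite ge0_integralZl_EFin// (ge0_integralZl_EFin P measurableT p4 m5 c1).
rewrite integral_indic// setIT ES PA.
under eq_integral do rewrite EFinD.
have p3 w : setT w -> (0 <= (S w ^+ 2)%:E)%E by move=> _; rewrite lee_fin sqr_ge0.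
rewrite (ge0_integralD P measurableT p3 m3)//.
rewrite integral_cst//= probability_setT mule1 => key.
have := le_trans key (leeD2r _ ES2).
rewrite PA -!EFinM -!EFinD !lee_fin => {}key.
rewrite ler_pdivlMr// -(ler_pM2l n0'); move: key; rewrite !expr2.
lra.
Qed.

End iid_integrals.

(** * PAC-Bayesian bounds *)

(** Jensen's inequality, by the tangent to the exponential at [L]. *)
Lemma le_exp_mean {R : realType} (V : finType) (rho a : V -> R) (L : R) :
  (forall v, 0 <= rho v) -> \sum_v rho v = 1 ->
  \sum_v rho v * expR (a v) <= expR L -> \sum_v rho v * a v <= L.
Proof.
move=> rho0 rho1 H; have eL := expR_gt0 L.
suff : expR L * (1 + \sum_v rho v * a v - L) <= expR L.
  by rewrite -[leRHS]mulr1 ler_pM2l//; lra.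
apply: le_trans H.
have -> : expR L * (1 + \sum_v rho v * a v - L) =
    \sum_v rho v * (expR L * (1 + (a v - L))).
  rewrite -{1}rho1 -[X in _ - X]mul1r -{1}rho1 mulr_suml -big_split/= -sumrB mulr_sumr.
  by apply: eq_bigr => v _; ring.
apply: ler_sum => v _; rewrite ler_wpM2l// -[in leRHS](subrK L (a v)) expRD mulrC.
by rewrite ler_pM2r// expR_ge1Dx.
Qed.

Lemma sqrt_expR_ln {R : realType} (u : R) : 0 < u -> Num.sqrt u = expR (ln u / 2).
Proof.
move=> u0; apply/eqP; rewrite -(@eqrXn2 _ 2)// ?sqrtr_ge0 ?expR_ge0//.
rewrite sqr_sqrtr ?ltW// -expRM_natr.
by rewrite -mulrA mulVf// mulr1 lnK// posrE.
Qed.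

(** * Averages of independent draws *)

Section maurey.
Context {R : realType} (T : finType) (rho : T -> R) (m : nat).
Hypotheses (rho0 : forall t, 0 <= rho t) (rho1 : \sum_t rho t = 1).
Hypothesis m0 : (0 < m)%N.

Definition iidw (v : {ffun 'I_m -> T}) : R := \prod_i rho (v i).

Lemma iidw_ge0 v : 0 <= iidw v. Proof. by apply: prodr_ge0. Qed.

Lemma iidw_prod (F : 'I_m -> T -> R) :
  \sum_v iidw v * \prod_i F i (v i) = \prod_i \sum_t rho t * F i t.
Proof.
by rewrite bigA_distr_bigA/=; apply: eq_bigr => v _; rewrite -big_split.
Qed.

Lemma iidw_sum1 : \sum_v iidw v = 1.
Proof.
have := iidw_prod (fun _ _ => 1).
rewrite [X in _ = X]big1; last by move=> i _; under eq_bigr do rewrite mulr1.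
by move=> <-; apply: eq_bigr => v _; rewrite big1_eq mulr1.
Qed.

Lemma iidw_coord (F : T -> R) i : \sum_v iidw v * F (v i) = \sum_t rho t * F t.
Proof.
pose Fi (j : 'I_m) := if j == i then F else fun=> 1.
transitivity (\sum_v iidw v * \prod_j Fi j (v j)).
  apply: eq_bigr => v _; rewrite (bigD1 i)//= {1}/Fi eqxx big1 ?mulr1//.
  by move=> j /negPf ji; rewrite /Fi ji.
rewrite iidw_prod (bigD1 i)//= {1}/Fi eqxx [X in _ * X]big1 ?mulr1// => j /negPf ji.
by rewrite /Fi ji; under eq_bigr do rewrite mulr1.
Qed.

Lemma iidw_coord2 (F : T -> R) i j : i != j ->
  \sum_v iidw v * (F (v i) * F (v j)) = (\sum_t rho t * F t) ^+ 2.
Proof.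
move=> ij; have ji : j != i by rewrite eq_sym.
pose Fi (l : 'I_m) := if (l == i) || (l == j) then F else fun=> 1.
have Fii : Fi i = F by rewrite /Fi eqxx.
have Fij : Fi j = F by rewrite /Fi eqxx orbT.
transitivity (\sum_v iidw v * \prod_l Fi l (v l)).
  apply: eq_bigr => v _; rewrite (bigD1 i)//= (bigD1 j)//= Fii Fij big1 ?mulr1//.
  by move=> l /andP[/negPf li /negPf lj]; rewrite /Fi li lj.
rewrite iidw_prod (bigD1 i)//= (bigD1 j)//= Fii Fij [X in _ * (_ * X)]big1 ?mulr1//.
move=> l /andP[/negPf li /negPf lj]; rewrite /Fi li lj.
by under eq_bigr do rewrite mulr1.
Qed.

Definition avgw (psi : T -> R) (v : {ffun 'I_m -> T}) : R := m%:R^-1 * \sum_i psi (v i).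

Variables (psi : T -> R).
Let pb := \sum_t rho t * psi t.

Let mgt0 : 0 < m%:R :> R. Proof. by rewrite ltr0n. Qed.

Lemma iidw_avgw : \sum_v iidw v * avgw psi v = pb.
Proof.
rewrite /avgw; under eq_bigr do rewrite mulrCA mulr_sumr.
rewrite -mulr_sumr exchange_big/=; under eq_bigr do rewrite iidw_coord.
by rewrite -/pb sumr_const card_ord -[pb *+ m]mulr_natl mulKf// lt0r_neq0.
Qed.

(** The variance of one draw is at most the mean squared difference from an independent draw, hence
    at most [b]. The cross terms of the squared sum vanish by independence and centering, which
    leaves [m] terms out of [m ^ 2]. *)
Lemma iidw_variance (b : R) : (forall s t, (psi t - psi s) ^+ 2 <= b) ->
  \sum_v iidw v * (avgw psi v - pb) ^+ 2 <= b / m%:R.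
Proof.
move=> psib; pose F t := psi t - pb.
have F0 : \sum_t rho t * F t = 0.
  by rewrite /F; under eq_bigr do rewrite mulrBr; rewrite sumrB -mulr_suml rho1 mul1r subrr.
have F2 : \sum_t rho t * F t ^+ 2 <= b.
  rewrite -[leRHS]mul1r -rho1 mulr_suml; apply: ler_sum => t _; rewrite ler_wpM2l//.
  have -> : F t = \sum_s rho s * (psi t - psi s).
    by under eq_bigr do rewrite mulrBr; rewrite sumrB -mulr_suml rho1 mul1r.
  have [u uE] : exists u, u = \sum_s rho s * (psi t - psi s) by eexists.
  have : 0 <= \sum_s rho s * (psi t - psi s - u) ^+ 2.
    by apply: sumr_ge0 => s _; rewrite mulr_ge0 ?sqr_ge0.
  have -> : \sum_s rho s * (psi t - psi s - u) ^+ 2 =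
      \sum_s rho s * (psi t - psi s) ^+ 2 - 2 * u * (\sum_s rho s * (psi t - psi s))
      + u ^+ 2 * \sum_s rho s.
    rewrite !mulr_sumr -sumrB -big_split/=.
    by apply: eq_bigr => s _; ring.
  rewrite rho1 -uE.
  have : \sum_s rho s * (psi t - psi s) ^+ 2 <= b.
    rewrite -[leRHS]mul1r -rho1 mulr_suml; apply: ler_sum => s _.
    by rewrite ler_wpM2l.
  rewrite !expr2; lra.
have -> : \sum_v iidw v * (avgw psi v - pb) ^+ 2 =
    m%:R^-1 ^+ 2 * \sum_i \sum_j \sum_v iidw v * (F (v i) * F (v j)).
  transitivity (m%:R^-1 ^+ 2 * \sum_v iidw v * (\sum_i \sum_j F (v i) * F (v j))).
    rewrite mulr_sumr; apply: eq_bigr => v _; rewrite [RHS]mulrCA; congr (_ * _).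
    under eq_bigr do rewrite -mulr_sumr.
    rewrite -mulr_suml -expr2 -exprMn; congr (_ ^+ 2).
    rewrite /avgw /F sumrB mulrBr sumr_const card_ord -[pb *+ m]mulr_natl mulKf//.
    exact: lt0r_neq0.
  congr (_ * _); under eq_bigr do rewrite mulr_sumr.
  rewrite exchange_big/=; apply: eq_bigr => i _.
  under eq_bigr do rewrite mulr_sumr.
  by rewrite exchange_big.
have -> : b / m%:R = m%:R^-1 ^+ 2 * \sum_(i < m) b.
  rewrite sumr_const card_ord -[b *+ m]mulr_natl expr2 -mulrA (mulrA m%:R^-1 m%:R) mulVf ?lt0r_neq0//.
  by rewrite mul1r mulrC.
rewrite ler_wpM2l ?sqr_ge0//; apply: ler_sum => i _.
rewrite (bigD1 i)//= [X in _ + X <= _]big1 ?addr0; last first.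
  by move=> j ji; rewrite iidw_coord2 1?eq_sym// F0 expr2 mul0r.
by under eq_bigr do rewrite -expr2; rewrite (iidw_coord (fun t => F t ^+ 2)).
Qed.

Variables (a : R).
Hypotheses (a0 : 0 < a) (apsi : forall t, a <= psi t).

Lemma avgw_ge v : a <= avgw psi v.
Proof.
rewrite /avgw ler_pdivlMl//; have -> : m%:R * a = \sum_(i < m) a.
  by rewrite sumr_const card_ord -[a *+ m]mulr_natl.
exact: ler_sum.
Qed.

Lemma mean_ge : a <= pb.
Proof.
rewrite -[leLHS]mul1r -rho1 mulr_suml; apply: ler_sum => t _; exact: ler_wpM2l.
Qed.

(** The inequality [ln q - ln pb >= 1 - pb / q] splits into a term linear in [q - pb], of mean 0,
    and a quadratic one with denominator [pb * q], which the lower bound [a] controls. *)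
Lemma iidw_ln_avgw (b : R) : (forall s t, (psi t - psi s) ^+ 2 <= b) ->
  ln pb - b / (m%:R * a ^+ 2) <= \sum_v iidw v * ln (avgw psi v).
Proof.
move=> psib; have pb0 : 0 < pb := lt_le_trans a0 mean_ge.
apply: (@le_trans _ _ (\sum_v iidw v *
    (ln pb + (avgw psi v - pb) / pb - (avgw psi v - pb) ^+ 2 / a ^+ 2))).
  have -> : \sum_v iidw v * (ln pb + (avgw psi v - pb) / pb - (avgw psi v - pb) ^+ 2 / a ^+ 2)
    = (\sum_v iidw v) * ln pb + ((\sum_v iidw v * avgw psi v) - (\sum_v iidw v) * pb) / pb
      - (\sum_v iidw v * (avgw psi v - pb) ^+ 2) / a ^+ 2.
    rewrite !mulr_suml -sumrB mulr_suml -big_split/= -sumrB.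
    by apply: eq_bigr => v _; ring.
  rewrite iidw_sum1 iidw_avgw !mul1r subrr mul0r addr0 lerD2l lerN2.
  have -> : b / (m%:R * a ^+ 2) = b / m%:R / a ^+ 2.
      by field; rewrite !lt0r_neq0.
    by apply: ler_wpM2r; [rewrite invr_ge0 sqr_ge0|exact: iidw_variance].
apply: ler_sum => v _; rewrite ler_wpM2l ?iidw_ge0//.
have qa := avgw_ge v; set q := avgw psi v in qa *; have q0 := lt_le_trans a0 qa.
have pa := mean_ge; rewrite -/pb in pa.
clearbody q; have H1 : 1 - pb / q <= ln q - ln pb.
  have := @expR_ge1Dx _ (ln pb - ln q); rewrite expRB !lnK ?posrE//; lra.
have H2 : 1 - pb / q = (q - pb) / pb - (q - pb) ^+ 2 / (pb * q).
  by field; rewrite !lt0r_neq0.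
have H3 : (q - pb) ^+ 2 / (pb * q) <= (q - pb) ^+ 2 / a ^+ 2.
  rewrite ler_wpM2l ?sqr_ge0// lef_pV2 ?posrE ?mulr_gt0 ?exprn_gt0//.
  by rewrite expr2; apply: ler_pM => //; exact: ltW.
rewrite H2 in H1.
move: ((q - pb) / pb) ((q - pb) ^+ 2 / (pb * q)) ((q - pb) ^+ 2 / a ^+ 2) H1 H3.
by move=> u1 u2 u3; lra.
Qed.

Lemma iidw_sqrt_avgw : \sum_v iidw v * Num.sqrt (avgw psi v) <= Num.sqrt pb.
Proof.
have pb0 : 0 < pb := lt_le_trans a0 mean_ge.
have s0 : 0 < Num.sqrt pb by rewrite sqrtr_gt0.
apply: (@le_trans _ _ (\sum_v iidw v *
    (Num.sqrt pb + (avgw psi v - pb) / (2 * Num.sqrt pb)))).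
  apply: ler_sum => v _; rewrite ler_wpM2l ?iidw_ge0//.
  have q0 := lt_le_trans a0 (avgw_ge v); set q := avgw psi v in q0 *.
  rewrite -lerBlDl ler_pdivlMr ?mulr_gt0//.
  have := sqr_sqrtr (ltW q0); have := sqr_sqrtr (ltW pb0).
  by have := sqr_ge0 (Num.sqrt q - Num.sqrt pb); rewrite !expr2; lra.
under eq_bigr do rewrite mulrDr mulrA mulrBr.
rewrite big_split/= -!mulr_suml sumrB iidw_avgw -!mulr_suml iidw_sum1 !mul1r.
by rewrite subrr mul0r addr0.
Qed.

End maurey.

(** * The bound for a fixed prior and for averages of draws *)

Section pac_bayes.
Context {R : realType} (d : nat) (disp : measure_display)
  (Omega : measurableType disp) (P : probability Omega R) (n : nat)
  (X : 'I_n -> {mfun Omega >-> d.-tuple (measurableTypeR R)}).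
Variable p : 'rV[R]_d -> R.
Hypotheses (p0 : forall x, 0 < p x) (ip : rv_integrable p) (iidX : iid_sample P X p).
Hypothesis n0 : (0 < n)%N.

Local Notation Z i w := (rv_of_tuple (X i w)).

(* [sqrt (q / p)], in a form whose measurability is immediate. *)
Let hratio (q : 'rV[R]_d -> R) x := expR ((ln (q x) - ln (p x)) / 2).

Let hratioE q x : 0 < q x -> p x * hratio q x = Num.sqrt (q x * p x).
Proof.
move=> q0; rewrite sqrt_expR_ln ?mulr_gt0// lnM ?posrE//.
rewrite -{1}[p x]lnK ?posrE// /hratio -expRD; congr expR; lra.
Qed.

Definition affinity (q : 'rV[R]_d -> R) : R := rv_int (fun x => Num.sqrt (q x * p x)).

Let hratio_measurable q : rv_measurable q -> rv_measurable (hratio q).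
Proof.
move=> mq; apply: rv_measurable_expR; apply: rv_measurableM; last exact: rv_measurable_cst.
by apply: rv_measurableB; apply: rv_measurable_ln => //; exact: rv_integrable_meas.
Qed.

Let hratio_integrable q : (forall x, 0 < q x) -> rv_integrable q ->
  rv_integrable (fun x => p x * hratio q x).
Proof.
move=> q0 iq; apply: (@rv_integrable_le _ _ _ (fun x => q x + p x)).
- apply: rv_measurableM; first exact: rv_integrable_meas.
  by apply: hratio_measurable; exact: rv_integrable_meas.
- exact: rv_integrableD.
move=> x; rewrite hratioE// ger0_norm ?sqrtr_ge0//.
have := q0 x; have := p0 x => px qx.
rewrite -(@ler_sqr R) ?nnegrE ?sqrtr_ge0//; last by rewrite addr_ge0// ltW.
by rewrite sqr_sqrtr ?mulr_ge0// ?(ltW px) ?(ltW qx)// expr2; nra.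
Qed.

Lemma affinity_integrable q : (forall x, 0 < q x) -> rv_integrable q ->
  rv_integrable (fun x => Num.sqrt (q x * p x)).
Proof.
move=> q0 iq; apply: eq_integrable (hratio_integrable q0 iq) => // t _.
by rewrite hratioE.
Qed.

Section prior.
Variables (V : finType) (pi0 : V -> R) (q : V -> 'rV[R]_d -> R).
Hypotheses (pi00 : forall v, 0 <= pi0 v) (pi01 : \sum_v pi0 v = 1).
Hypotheses (q0 : forall v x, 0 < q v x) (iq : forall v, rv_integrable (q v)).

Let W w := \sum_v pi0 v * (\prod_i hratio (q v) (Z i w) * expR (n%:R * (1 - affinity (q v)))).

Let mW : measurable_fun setT W.
Proof.
apply: measurable_sum => v; apply: measurable_funM => //.
apply: measurable_funM => //; apply: measurable_prod => i _.
by apply: measurable_sample; apply: hratio_measurable; exact: rv_integrable_meas.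
Qed.

Let W0 w : 0 <= W w.
Proof.
apply: sumr_ge0 => v _; rewrite mulr_ge0// mulr_ge0 ?expR_ge0//.
by apply: prodr_ge0 => i _; exact: expR_ge0.
Qed.

Let intW : (\int[P]_w (W w)%:E <= 1)%E.
Proof.
have mh v : measurable_fun setT (fun w => \prod_i hratio (q v) (Z i w)).
  apply: measurable_prod => i _.
  by apply: measurable_sample; apply: hratio_measurable; exact: rv_integrable_meas.
have h0 v w : 0 <= \prod_i hratio (q v) (Z i w).
  by apply: prodr_ge0 => i _; exact: expR_ge0.
have c0 v : 0 <= pi0 v * expR (n%:R * (1 - affinity (q v))).
  by rewrite mulr_ge0 ?expR_ge0.
under eq_integral do rewrite -sumEFin.
rewrite ge0_integral_sum//=; last 2 first.
- move=> v; apply/measurable_EFinP; apply: measurable_funM => //.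
  by apply: measurable_funM => //; exact: mh.
- by move=> v w _; rewrite lee_fin mulr_ge0// mulr_ge0 ?expR_ge0.
apply: (@le_trans _ _ (\sum_v (pi0 v)%:E)%E); last by rewrite sumEFin pi01.
apply: lee_sum => v _.
under eq_integral do rewrite mulrA mulrAC EFinM.
have h0E w : setT w -> (0 <= (\prod_i hratio (q v) (Z i w))%:E)%E.
  by move=> _; rewrite lee_fin.
have mhE : measurable_fun setT (fun w => (\prod_i hratio (q v) (Z i w))%:E).
  exact/measurable_EFinP/mh.
rewrite (ge0_integralZl_EFin P measurableT h0E mhE (c0 v)).
rewrite (iid_prod (fun x => ltW (p0 x)) ip iidX (phi := fun=> hratio (q v))); last 3 first.
- by move=> _; apply: hratio_measurable; exact: rv_integrable_meas.
- by move=> _ x; exact: expR_ge0.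
- by move=> _; exact: hratio_integrable.
rewrite -EFinM lee_fin -mulrA -[leRHS]mulr1 ler_wpM2l//.
have -> : rv_int (fun x => p x * hratio (q v) x) = affinity (q v).
  by apply: eq_rv_int => x; rewrite hratioE.
rewrite prodr_const card_ord mulrC expRM_natl -exprMn.
set z := affinity (q v).
have z0 : 0 <= z by apply: rv_int_ge0 => x; exact: sqrtr_ge0.
rewrite exprn_ile1 ?mulr_ge0 ?expR_ge0//.
rewrite -(opprB z) expRN ler_pdivrMr ?expR_gt0// mul1r.
by have := expR_ge1Dx (z - 1); rewrite addrC subrK.
Qed.

(* [W] has mean at most 1 because [z * exp (1 - z) <= 1], hence [W <= n ^ 2] outside of an
   event of probability [n ^ -2]; Jensen's inequality then bounds the means under [rho]. *)
Lemma pac_bayes_prior : exists Bad : set Omega,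
  [/\ measurable Bad, (P Bad <= ((n%:R ^+ 2)^-1)%:E)%E &
   forall w, ~ Bad w -> forall (rho : V -> R) (kappa : R), 0 < kappa ->
     (forall v, 0 <= rho v <= kappa * pi0 v) -> \sum_v rho v = 1 ->
     \sum_v rho v * (\sum_i (ln (q v (Z i w)) - ln (p (Z i w))) / 2
       + n%:R * (1 - affinity (q v))) <= ln kappa + 2 * ln n%:R].
Proof.
have nn : 0 < n%:R :> R by rewrite ltr0n.
have nn2 : 0 < n%:R ^+ 2 :> R by rewrite exprn_gt0.
pose Bad := [set w | n%:R ^+ 2 < W w].
have mB : measurable Bad by rewrite -[Bad]setTI; exact: measurable_fun_ltr.
exists Bad; split => //.
  have [b PB] : exists b, P Bad = b%:E.
    by exists (fine (P Bad)); rewrite fineK// fin_num_measure.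
  have : (\int[P]_w (n%:R ^+ 2 * \1_Bad w)%:E <= 1)%E.
    apply: le_trans intW; apply: ge0_le_integral => //.
    - by apply/measurable_EFinP; exact: measurable_funM.
    - exact/measurable_EFinP.
    - move=> w _; rewrite lee_fin indicE; case: (boolP (w \in Bad)) => [/set_mem wA|_].
        by rewrite mulr1 ltW.
      by rewrite mulr0.
  under eq_integral do rewrite EFinM.
  have I0 w : setT w -> (0 <= (\1_Bad w : R)%:E)%E by [].
  have mI : measurable_fun setT (fun w : Omega => (\1_Bad w : R)%:E).
    exact/measurable_EFinP.
  rewrite (ge0_integralZl_EFin P measurableT I0 mI (ltW nn2)).
  have -> : (\int[P]_w (\1_Bad w : R)%:E = b%:E)%E by rewrite integral_indic// setIT -PB.
  rewrite PB -EFinM !lee_fin => H.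
  by rewrite -[leRHS]mul1r ler_pdivlMr// mulrC.
move=> w /negP; rewrite -leNgt => Ww rho kappa k0 rhok rho1.
have -> : ln kappa + 2 * ln n%:R = ln (kappa * n%:R ^+ 2).
  by rewrite lnM ?posrE// lnXn// mulr_natl.
apply: le_exp_mean => //; first by move=> v; case/andP: (rhok v).
rewrite lnK ?posrE ?mulr_gt0//.
apply: le_trans (_ : kappa * W w <= _); last by rewrite ler_wpM2l// ltW.
rewrite /W mulr_sumr; apply: ler_sum => v _; rewrite mulrA.
case/andP: (rhok v) => r0 rk.
by rewrite expRD -expR_sum; exact: ler_wpM2r.
Qed.

End prior.

Section mixture_prior.
Variables (T : finType) (pi0 : T -> R) (psi : T -> 'rV[R]_d -> R) (m : nat).
Variables (a V : 'rV[R]_d -> R).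
Hypotheses (pi00 : forall t, 0 <= pi0 t) (pi01 : \sum_t pi0 t = 1) (m0 : (0 < m)%N).
Hypotheses (ipsi : forall t, rv_integrable (psi t)) (a0 : forall x, 0 < a x).
Hypothesis apsi : forall t x, a x <= psi t x.
Hypothesis psiV : forall s t x, (psi t x - psi s x) ^+ 2 <= V x * a x ^+ 2.

(* Maurey's argument: the prior charges the averages of [m] independent draws of [psi], so
   that passing from the mean of [rho] to such averages costs a variance [V / m], while the
   density of [rho] with respect to [pi0] costs only [m * ln kappa]. *)
Lemma pac_bayes_mixture : exists Bad : set Omega,
  [/\ measurable Bad, (P Bad <= ((n%:R ^+ 2)^-1)%:E)%E &
   forall w, ~ Bad w -> forall (rho : T -> R) (kappa : R), 0 < kappa ->
     (forall t, 0 <= rho t <= kappa * pi0 t) -> \sum_t rho t = 1 ->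
     forall pb : 'rV[R]_d -> R, (forall x, pb x = \sum_t rho t * psi t x) ->
     \sum_i (ln (pb (Z i w)) - V (Z i w) / m%:R - ln (p (Z i w))) / 2
       + n%:R * (1 - affinity pb) <= m%:R * ln kappa + 2 * ln n%:R].
Proof.
pose q (v : {ffun 'I_m -> T}) x := avgw (fun t => psi t x) v.
have q0 v x : 0 < q v x by apply: lt_le_trans (a0 x) (avgw_ge m0 (fun t => apsi t x) v).
have iq v : rv_integrable (q v).
  by apply: rv_integrableZ; apply: rv_integrable_sum => i; exact: ipsi.
have [Bad [mBad PBad badP]] := pac_bayes_prior (iidw_ge0 pi00) (iidw_sum1 m pi01) q0 iq.
exists Bad; split => // w nBw rho kappa k0 rhok rho1 pb' pbE.
have -> : pb' = fun x => \sum_t rho t * psi t x by apply/funext.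
pose pb x := \sum_t rho t * psi t x; rewrite -/pb.
have rho0 t : 0 <= rho t by case/andP: (rhok t).
have rhok' (v : {ffun 'I_m -> T}) : 0 <= iidw rho v <= kappa ^+ m * iidw pi0 v.
  have -> : kappa ^+ m = \prod_(i < m) kappa by rewrite prodr_const card_ord.
  rewrite iidw_ge0//= /iidw -big_split/=.
  by apply: ler_prod => i _.
have := badP w nBw _ _ (exprn_gt0 m k0) rhok' (iidw_sum1 m rho1).
rewrite lnXn// -[ln kappa *+ m]mulr_natl; apply: le_trans.
have pb0 x : 0 < pb x by apply: lt_le_trans (a0 x) (mean_ge rho0 rho1 (fun t => apsi t x)).
have ipb : rv_integrable pb.
  by apply: rv_integrable_sum => t; apply: rv_integrableZ; exact: ipsi.
(* Concavity of the square root: the mean density has the larger affinity, so that replacing the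
   draws by their mean only decreases the term [1 - affinity]. *)
have H1 : affinity pb >= \sum_v iidw rho v * affinity (q v).
  have -> : \sum_v iidw rho v * affinity (q v) =
      rv_int (fun x => \sum_v iidw rho v * Num.sqrt (q v x * p x)).
    rewrite rv_int_sum; last first.
      by move=> v; apply: rv_integrableZ; exact: affinity_integrable.
    apply: eq_bigr => v _; rewrite rv_intZ//; exact: affinity_integrable.
  apply: le_rv_int; last 1 first.
  - move=> x; rewrite sqrtrM ?(ltW (pb0 x))//.
    under eq_bigr do rewrite sqrtrM ?(ltW (q0 _ x))// mulrA.
    rewrite -mulr_suml ler_wpM2r ?sqrtr_ge0//.
    exact: (iidw_sqrt_avgw rho0 rho1 m0 (a0 x) (fun t => apsi t x)).
  - apply: rv_integrable_sum => v; apply: rv_integrableZ; exact: affinity_integrable.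
  - exact: affinity_integrable.
have H2 x : ln (pb x) - V x / m%:R <= \sum_v iidw rho v * ln (q v x).
  have := iidw_ln_avgw rho0 rho1 m0 (a0 x) (fun t => apsi t x) (fun s t => psiV s t x).
  rewrite -/(pb x) => H; apply: le_trans H; rewrite lerD2l lerN2.
  rewrite invfM mulrCA -mulrA mulfV ?mulr1 1?mulrC// lt0r_neq0//.
  by rewrite exprn_gt0.
have -> : \sum_v iidw rho v * (\sum_i (ln (q v (Z i w)) - ln (p (Z i w))) / 2
       + n%:R * (1 - affinity (q v))) =
  \sum_i ((\sum_v iidw rho v * ln (q v (Z i w))) - ln (p (Z i w))) / 2 +
  n%:R * (1 - \sum_v iidw rho v * affinity (q v)).
  under eq_bigr do rewrite mulrDr.
  rewrite big_split/=; congr (_ + _).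
    under eq_bigr do rewrite mulr_sumr.
    rewrite exchange_big/=; apply: eq_bigr => i _.
    rewrite -[X in _ - X]mul1r -(iidw_sum1 m rho1) !mulr_suml -sumrB mulr_suml.
    by apply: eq_bigr => v _; ring.
  under eq_bigr do rewrite mulrCA mulrBr mulr1.
  by rewrite -mulr_sumr sumrB iidw_sum1.
apply: lerD; last by rewrite ler_wpM2l// lerD2l lerN2.
apply: ler_sum => i _; rewrite ler_wpM2r// lerD2r; exact: H2.
Qed.

End mixture_prior.

End pac_bayes.

(** * From the PAC-Bayesian bound to maximum likelihood *)

Section likelihood_step.
Context {R : realType} (d : nat).
Variables (S : 'M[R]_d) (rad : R).
Hypotheses (pS : sym_posdef S) (rad0 : 0 <= rad).
Local Notation g := (gauss_pdf 0 S).

Let g0 x : 0 < g x. Proof. exact: gauss_pdf_gt0. Qed.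

Lemma rv_integrable_mixture G : rv_integrable (mixture_pdf S G).
Proof.
have := rv_integrable_mixture_mul pS G (K := 1) (c := 0) (rv_measurable_cst 1).
move=> /(_ _)/wrap[|].
  by move=> x; rewrite normr1 mul1r /ewt mul0r expR0.
by apply: eq_integrable => // t _; rewrite mul1r.
Qed.

Lemma rv_int_mixture G H : rv_int (mixture_pdf S G) = rv_int (mixture_pdf S H).
Proof.
have E G' : rv_int (mixture_pdf S G') = rv_int (fun x => 1 * g x).
  transitivity (rv_int (fun x => 1 * mixture_pdf S G' x)).
    by apply: eq_rv_int => x; rewrite mul1r.
  rewrite (rv_int_mixture_mul pS G' (K := 1) (c := 0) (rv_measurable_cst 1)).
    by rewrite ev_cst.
  by move=> x; rewrite normr1 mul1r /ewt mul0r expR0.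
by rewrite !E.
Qed.

Lemma hel_affinity G H : rv_int (mixture_pdf S H) = 1 ->
  hel S G H ^+ 2 = 1 - affinity (mixture_pdf S H) (mixture_pdf S G).
Proof.
move=> H1; rewrite hel_sqr.
have iG := rv_integrable_mixture G; have iH := rv_integrable_mixture H.
have G0 x := mixture_pdf_gt0 pS G x; have H0 x := mixture_pdf_gt0 pS H x.
have iA := affinity_integrable H0 iH G0 iG.
transitivity (2^-1 * rv_int (fun x => (mixture_pdf S G x + mixture_pdf S H x)
   - 2 * Num.sqrt (mixture_pdf S G x * mixture_pdf S H x))).
  congr (_ * _); apply: eq_rv_int => x; rewrite /sqdiff sqrtrM ?(ltW (G0 x))//.
  have := sqr_sqrtr (ltW (G0 x)); have := sqr_sqrtr (ltW (H0 x)).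
  by rewrite !expr2; lra.
rewrite rv_intB ?rv_intD ?rv_intZ//; [|exact: rv_integrableD|exact: rv_integrableZ].
by rewrite (rv_int_mixture G H) H1 /affinity; lra.
Qed.

Definition mom (c : R) : R := rv_int (fun x => g x * ewt (c + gc S rad) x).

Lemma mom_ge0 c : 0 <= mom c.
Proof. by apply: rv_int_ge0 => x; rewrite mulr_ge0 ?expR_ge0 ?(ltW (g0 x)). Qed.

Lemma mixture_ewt_integrable H c : supp rad H ->
  rv_integrable (fun x => mixture_pdf S H x * ewt c x).
Proof.
move=> sH; apply: (@rv_integrable_ewtM _ _ _ pS _ 1 (c + gc S rad)).
  apply: rv_measurableM; last exact: rv_measurable_ewt.
  exact: rv_measurable_mixture.
move=> x; rewrite ger0_norm ?mulr_ge0 ?expR_ge0 ?(ltW (mixture_pdf_gt0 pS _ _))//.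
rewrite mul1r ewtD mulrCA mulrC ler_wpM2l ?expR_ge0//.
exact: mixture_pdf_le.
Qed.

Lemma mixture_ewt_le H c : supp rad H ->
  rv_int (fun x => mixture_pdf S H x * ewt c x) <= mom c.
Proof.
move=> sH; apply: le_rv_int; [exact: mixture_ewt_integrable|exact: rv_integrable_ewt|].
move=> x; rewrite ewtD mulrCA mulrC ler_wpM2l ?expR_ge0//.
exact: mixture_pdf_le.
Qed.

(** Where [q] exceeds the mixture of G, the difference of the square roots is at most [q - p_G]
    divided by the square root of [p_G]. The square root of [p_H] compensates that denominator up to
    an exponential weight, since both mixtures are comparable to [g]. *)
Lemma le_affinity G H (q : 'rV[R]_d -> R) c e : supp rad G -> supp rad H ->
  (forall x, 0 < q x) -> rv_integrable q -> 0 <= e ->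
  (forall x, q x <= mixture_pdf S G x + e * (g x * ewt c x)) ->
  affinity (mixture_pdf S H) q <= affinity (mixture_pdf S H) (mixture_pdf S G) + e * mom c.
Proof.
move=> sG sH q0 iq e0 qG.
have iG := rv_integrable_mixture G; have iH := rv_integrable_mixture H.
have G0 x := mixture_pdf_gt0 pS G x; have H0 x := mixture_pdf_gt0 pS H x.
have iE := rv_integrable_ewt pS (c + gc S rad).
rewrite /affinity /mom -rv_intZ// -rv_intD; [|exact: affinity_integrable|exact: rv_integrableZ].
apply: le_rv_int => [| |x].
- exact: affinity_integrable.
- by apply: rv_integrableD; [exact: affinity_integrable|exact: rv_integrableZ].
rewrite !sqrtrM ?(ltW (q0 x)) ?(ltW (G0 x))//.
have q0' := q0 x; have G0' := G0 x; have H0' := H0 x; have qG' := qG x.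
have w0 := ewt_gt0 (gc S rad) x; have v0 := ewt_gt0 c x; have gx := g0 x.
have HG : mixture_pdf S H x <= ewt (gc S rad) x ^+ 2 * mixture_pdf S G x.
  apply: le_trans (mixture_pdf_le pS x rad0 sH) _.
  apply: le_trans (_ : ewt (gc S rad) x ^+ 2 * (g x * ewt (- gc S rad) x) <= _); last first.
    by rewrite ler_wpM2l ?sqr_ge0//; exact: mixture_pdf_ge.
  rewrite /ewt mulNr expRN le_eqVlt; apply/orP; left; apply/eqP; field.
  by rewrite lt0r_neq0// expR_gt0.
have sHG : Num.sqrt (mixture_pdf S H x) <= ewt (gc S rad) x * Num.sqrt (mixture_pdf S G x).
  have := ler_wsqrtr HG; rewrite sqrtrM ?sqr_ge0// sqrtr_sqr gtr0_norm//.
have eq := sqr_sqrtr (ltW q0'); have eG := sqr_sqrtr (ltW G0').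
have sq0 := sqrtr_ge0 (q x).
have sG0 : 0 < Num.sqrt (mixture_pdf S G x) by rewrite sqrtr_gt0.
have sH0 := sqrtr_ge0 (mixture_pdf S H x).
rewrite -lerBlDl -mulrBl ewtD.
set sq := Num.sqrt (q x) in eq sq0 *.
set sg := Num.sqrt (mixture_pdf S G x) in eG sG0 sHG *.
set sh := Num.sqrt (mixture_pdf S H x) in sHG sH0 *.
set E := e * (g x * ewt c x); have E0 : 0 <= E by rewrite !mulr_ge0// ltW.
have -> : e * (g x * (ewt c x * ewt (gc S rad) x)) = E * ewt (gc S rad) x by rewrite /E !mulrA.
case: (leP sq sg) => [sqg|sgq].
  apply: le_trans (_ : 0 <= _); last by rewrite mulr_ge0// ltW.
  by rewrite mulr_le0_ge0// subr_le0.
apply: le_trans (_ : (sq - sg) * (ewt (gc S rad) x * sg) <= _).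
  by rewrite ler_wpM2l// subr_ge0 ltW.
rewrite mulrCA mulrC ler_wpM2r// ?(ltW w0)//.
move: qG'; rewrite -/E -eq -eG !expr2; nra.
Qed.

(** An upper bound of the empirical mean of the weights outside of an event of probability O(1/n);
    the 1 is the deviation in [iid_chebyshev]. *)
Definition ewt_avg b c : R := mom (2 * c + 2 * b) + 1.

Lemma le_ln_sub (u v a e : R) : 0 < a -> a <= v -> 0 < u -> u <= v + e * a -> 0 <= e ->
  ln u - e <= ln v.
Proof.
move=> a0 av u0 uv e0; have v0 := lt_le_trans a0 av.
have : u <= v * expR e.
  apply: le_trans uv _; have := expR_ge1Dx e; nra.
by move=> H; have := ler_ln u0 (mulr_gt0 v0 (expR_gt0 e)); rewrite ?posrE// lnM ?posrE ?expR_gt0// expRK H; lra.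
Qed.

Lemma step_arith (n B e1 e2 E M l UL A1 A2 Sg c0 : R) : 0 <= n -> 0 <= B -> 0 <= e1 ->
  0 <= e2 -> 0 <= E -> 0 <= M -> 0 <= l -> l - UL <= Sg ->
  UL <= n * ((e1 + 2 * B) * E) -> A1 <= A2 + e2 * M -> Sg + n * (1 - A1) <= c0 ->
  n * (1 - A2) <= c0 + n * ((2 * E + M) * (B + e1 + e2)).
Proof.
move=> n0 B0 e10 e20 E0 M0 l0 H1 H2 H3 H4.
have H5 : (e1 + 2 * B) * E + e2 * M <= (2 * E + M) * (B + e1 + e2).
  have := mulr_ge0 E0 e10; have := mulr_ge0 E0 e20; have := mulr_ge0 M0 e10.
  have := mulr_ge0 M0 B0; lra.
have := ler_wpM2l n0 H3; have := ler_wpM2l n0 H5; rewrite !mulrDr !mulrN; lra.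
Qed.

(** [e1] bounds the loss of log-likelihood from p_G to the mean of [rho], [e2] the gain of affinity.
    Together with the variance [beta / m] they are paid through the empirical mean of the weights,
    and the likelihood inequality removes the log-ratios. [Bad] precedes G and [rho], so that both
    may depend on the sample. *)
Lemma likelihood_step (b c : R) (Gs : mixing R d) : 0 <= b -> 0 <= c -> supp rad Gs ->
  forall (disp : measure_display) (Omega : measurableType disp) (P : probability Omega R)
    (n : nat) (X : 'I_n -> {mfun Omega >-> d.-tuple (measurableTypeR R)}), (0 < n)%N ->
  iid_sample P X (mixture_pdf S Gs) ->
  forall (T : finType) (pi0 : T -> R) (psi : T -> 'rV[R]_d -> R) (m : nat) (beta : R),
  (forall t, 0 <= pi0 t) -> \sum_t pi0 t = 1 -> (0 < m)%N -> 0 <= beta ->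
  (forall t, rv_integrable (psi t)) ->
  (forall t x, g x * ewt (- b) x / 2 <= psi t x) ->
  (forall s t x, (psi t x - psi s x) ^+ 2 <= beta * (g x * ewt c x) ^+ 2) ->
  exists Bad : set Omega, [/\ measurable Bad, (P Bad <= ((n%:R ^+ 2)^-1)%:E)%E &
   forall w, ~ Bad w ->
     \sum_i ewt (2 * c + 2 * b) (rv_of_tuple (X i w)) <= n%:R * ewt_avg b c ->
   forall (G : mixing R d) (rho : T -> R) (kappa e1 e2 : R), supp rad G ->
     \sum_i ln (mixture_pdf S Gs (rv_of_tuple (X i w))) <=
     \sum_i ln (mixture_pdf S G (rv_of_tuple (X i w))) ->
     0 < kappa -> (forall t, 0 <= rho t <= kappa * pi0 t) -> \sum_t rho t = 1 ->
     0 <= e1 -> 0 <= e2 ->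
     (forall x, mixture_pdf S G x <= \sum_t rho t * psi t x + e1 * (g x * ewt c x)) ->
     (forall x, \sum_t rho t * psi t x <= mixture_pdf S G x + e2 * (g x * ewt c x)) ->
     n%:R * hel S G Gs ^+ 2 <= m%:R * ln kappa + 2 * ln n%:R
       + n%:R * ((2 * ewt_avg b c + mom c) * (beta / m%:R + e1 + e2))].
Proof.
move=> b0 c0 sGs disp Omega P n X n0 iidX T pi0 psi m beta pi00 pi01 m0 beta0 ipsi psia psib.
have Gs0 x := mixture_pdf_gt0 pS Gs x; have iGs := rv_integrable_mixture Gs.
pose a x := g x * ewt (- b) x / 2.
have a0 x : 0 < a x by rewrite /a divr_gt0// mulr_gt0 ?expR_gt0.
pose Y := ewt (2 * c + 2 * b) : 'rV[R]_d -> R.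
(* Relative to the lower bound [a], the weight [g * ewt c] costs [2 * ewt (c + b)]; its square in
   the variance explains the parameter [2 * c + 2 * b] of [Y]. *)
have gaY x : g x * ewt c x = 2 * ewt (c + b) x * a x.
  rewrite /a ewtD /ewt mulNr expRN; field.
  by rewrite lt0r_neq0// expR_gt0.
have Y1 x : ewt (c + b) x <= Y x.
  by rewrite /Y; apply: le_ewt; lra.
have psiV s t x : (psi t x - psi s x) ^+ 2 <= 4 * beta * Y x * a x ^+ 2.
  apply: le_trans (psib s t x) _; rewrite gaY.
  have -> : Y x = ewt (c + b) x ^+ 2.
    by rewrite /Y expr2 -ewtD; congr (ewt _ x); lra.
  by rewrite le_eqVlt; apply/orP; left; apply/eqP; ring.
have [Bad [mBad PBad badP]] := pac_bayes_mixture Gs0 iGs iidX n0 pi00 pi01 m0 ipsi a0 psia psiV.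
exists Bad; split => // w nBw SY G rho kappa e1 e2 sG lik k0 rhok rho1 e10 e20 h1 h2.
have nn : 0 < n%:R :> R by rewrite ltr0n.
have mm : 0 < m%:R :> R by rewrite ltr0n.
pose pb x := \sum_t rho t * psi t x.
have rho0 t : 0 <= rho t by case/andP: (rhok t).
have apb x : a x <= pb x by exact: (mean_ge rho0 rho1 (fun t => psia t x)).
have pb0 x : 0 < pb x := lt_le_trans (a0 x) (apb x).
have ipb : rv_integrable pb by apply: rv_integrable_sum => t; exact: rv_integrableZ.
have aff := le_affinity sG sGs pb0 ipb e20 h2.
have Gs1 := iid_density_int iGs iidX n0.
have := badP w nBw rho kappa k0 rhok rho1 pb (fun=> erefl).
rewrite (hel_affinity G Gs1).
set A1 := affinity _ pb in aff *; set A2 := affinity _ _ in aff *.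
have G0 x := mixture_pdf_gt0 pS G x.
have lnb x : ln (mixture_pdf S G x) - 2 * e1 * Y x <= ln (pb x).
  apply: (le_ln_sub (a0 x) (apb x) (G0 x)); last by rewrite !mulr_ge0// expR_ge0.
  apply: le_trans (h1 x) _; rewrite lerD2l gaY (mulrC _ e1) -!mulrA ler_wpM2l//.
  by rewrite ler_pM2l// ler_pM2r.
set L1 := \sum_i _ in SY *; set L2 := \sum_i _ in lik; set L3 := \sum_i _ in lik.
move=> key.
have k1 : (L3 - L2) / 2 - (e1 + 2 * beta / m%:R) * L1 <=
   \sum_i (ln (pb (rv_of_tuple (X i w))) -
      4 * beta * Y (rv_of_tuple (X i w)) / m%:R -
      ln (mixture_pdf S Gs (rv_of_tuple (X i w)))) / 2.
  rewrite /L1 /L2 /L3 -sumrB mulr_suml mulr_sumr -sumrB.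
  apply: ler_sum => i _; have := lnb (rv_of_tuple (X i w)); rewrite -/(Y _).
  set y := Y _; set l1 := ln _; set l2 := ln (pb _); set l3 := ln _ => H.
  have -> : 4 * beta * y / m%:R = 4 * (beta / m%:R * y) by field; rewrite lt0r_neq0.
  have -> : 2 * beta / m%:R = 2 * (beta / m%:R) by rewrite mulrA.
  rewrite mulrDl -mulrA; lra.
have k2 : (e1 + 2 * beta / m%:R) * L1 <= n%:R * ((e1 + 2 * beta / m%:R) * ewt_avg b c).
  by rewrite mulrCA ler_wpM2l// addr_ge0// divr_ge0// mulr_ge0.
have k3 : n%:R * A1 <= n%:R * (A2 + e2 * mom c) by rewrite ler_wpM2l// ltW.
have l0 : 0 <= (L3 - L2) / 2 by rewrite divr_ge0// subr_ge0.
have B0 : 0 <= beta / m%:R by rewrite divr_ge0// ltW.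
have E0 : 0 <= ewt_avg b c by rewrite addr_ge0// mom_ge0.
apply: (step_arith (ltW nn) B0 e10 e20 E0 (mom_ge0 c) l0 k1 _ aff key).
by rewrite [2 * (beta / _)]mulrA.
Qed.

End likelihood_step.

(** * Moments of all orders *)

Lemma sum_count_mem (T : finType) (s : seq T) : (\sum_i count_mem i s)%N = size s.
Proof.
elim: s => [|a s IH]; first by rewrite big1.
rewrite /= -IH big_split/= (bigD1 a)//= eqxx big1 ?addn0//.
by move=> i /negPf ia; rewrite eq_sym ia.
Qed.

Lemma ex_frequent_letter (T : finType) (s : seq T) r : (#|T| * r < size s)%N ->
  exists i s', perm_eq s (nseq r i ++ s').
Proof.
move=> sr; have [i ri] : exists i, (r <= count_mem i s)%N.
  apply/existsP; apply: contraLR sr => /existsPn H.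
  rewrite -leqNgt -sum_count_mem -sum_nat_const; apply: leq_sum => i _.
  by rewrite ltnW// ltnNge H.
exists i, (nseq (count_mem i s - r) i ++ [seq x <- s | predC (pred1 i) x]).
rewrite catA -nseqD subnKC//.
have -> : nseq (count_mem i s) i = [seq x <- s | pred1 i x].
  by apply/esym; rewrite -size_filter; apply/all_pred1P; exact: filter_all.
by rewrite perm_sym perm_filterC.
Qed.

Section moments.
Context {R : realType} (d : nat).
Implicit Types (G H : mixing R d) (s : seq 'I_d) (l : seq R).

Lemma mon_perm s s' (x : 'rV[R]_d) : perm_eq s s' -> mon s x = mon s' x.
Proof. by move=> ss'; rewrite /mon (perm_big _ ss'). Qed.

Local Notation L G H T := (ev G T - ev H T).
Local Notation shifted i l s := (fun th : 'rV[R]_d => (\prod_(a <- l) (th 0 i - a)) * mon s th).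

(* The leading monomial of [shifted i l s] is [i ^ size l * s], and the other ones are shorter. *)
Lemma moment_shift G H rad M N i l s : 0 <= rad ->
  (forall t, (size t < N)%N -> `|L G H (mon t)| <= M) ->
  all (fun a => `|a| <= rad) l -> (size l + size s <= N)%N ->
  `|L G H (mon (nseq (size l) i ++ s)) - L G H (shifted i l s)| <=
   ((1 + rad) ^+ size l - 1) * M.
Proof.
move=> r0 HM; elim: l s => [|a l IH] s.
  move=> _ _; rewrite expr0 subrr mul0r.
  have -> : (shifted i [::] s) = mon s by apply/funext => th; rewrite big_nil mul1r.
  by rewrite subrr normr0.
move=> /andP[ar lr] sN; have M0 : 0 <= M.
  by apply: le_trans (HM [::] _) => //; apply: leq_trans sN; rewrite addSn.
have sN' : (size l + size s < N)%N by rewrite /= addSn in sN.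
have IH1 := IH (i :: s) lr; rewrite /= addnS in IH1; have {}IH1 := IH1 sN'.
have IH2 := IH s lr (ltnW sN').
have HM2 := HM (nseq (size l) i ++ s); rewrite size_cat size_nseq in HM2.
have {}HM2 := HM2 sN'.
have e1 : mon (nseq (size (a :: l)) i ++ s) = mon (nseq (size l) i ++ i :: s) :> ('rV[R]_d -> R).
  apply/funext => th; apply: mon_perm.
  by rewrite perm_sym -[i :: s]cat1s perm_catCA.
have e2 K : ev K (shifted i (a :: l) s) =
    ev K (shifted i l (i :: s)) - a * ev K (shifted i l s).
  by rewrite -evZ -evB; apply: eq_ev => j; rewrite big_cons mon_cons; ring.
rewrite e1 !e2.
set u := ev G (mon (nseq _ i ++ i :: s)) in IH1 *; set u' := ev H (mon (nseq _ i ++ i :: s)) in IH1 *.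
set v := ev G (shifted i l (i :: s)) in IH1 *; set v' := ev H (shifted i l (i :: s)) in IH1 *.
set w := ev G (shifted i l s) in IH2 *; set w' := ev H (shifted i l s) in IH2 *.
set z := ev G (mon (nseq _ i ++ s)) in IH2 HM2; set z' := ev H (mon (nseq _ i ++ s)) in IH2 HM2.
set Q := (1 + rad) ^+ size l in IH1 IH2.
have -> : u - u' - (v - a * w - (v' - a * w')) = (u - u' - (v - v')) + a * (w - w') by ring.
apply: (le_trans (ler_normD _ _)); rewrite normrM.
have Hw : `|w - w'| <= Q * M.
  have -> : w - w' = (z - z') - ((z - z') - (w - w')) by ring.
  by apply: (le_trans (ler_normB _ _)); lra.
have : `|a| * `|w - w'| <= rad * (Q * M) by apply: ler_pM.
rewrite /= exprS -/Q; lra.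
Qed.

(** The square of one coordinate of [th - atom H l] is at most its squared norm, so that the product
    over the atoms is at most [cellprod], whose mean under G is O(h). *)
Lemma ev_coord_prod G H rad i s : 1 <= rad -> supp rad G ->
  `|ev G (fun th => (\prod_l (th 0 i - atom H l 0 i) ^+ 2) * mon s th)| <=
  rad ^+ size s * ev G (cellprod H).
Proof.
move=> r1 sG; apply: (le_trans (ev_norm _ _)); rewrite -evZ.
apply: (le_ev sG) => th thr; rewrite normrM mulrC ler_pM//.
  exact: mon_le_enorm.
rewrite normr_prod; apply: ler_prod => l _.
rewrite normr_ge0 ger0_norm ?sqr_ge0//= sqdE (bigD1 i)//= lerDl.
by apply: sumr_ge0 => k _; exact: sqr_ge0.
Qed.

Lemma ev_cellprod_le (S : 'M[R]_d) rad ks : sym_posdef S -> 1 <= rad ->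
  exists C : R, 0 <= C /\ forall G H, natoms H = ks -> supp rad G -> supp rad H ->
    ev G (cellprod H) <= C * hel S G H.
Proof.
move=> pS r1; have r0 : 0 <= rad by lra.
have [C [C0 HC]] := pol_dual (ks * 2) pS r0.
pose B := (1 + d%:R * (1 + rad) ^+ 2) ^+ ks.
exists (B * C); split.
  by rewrite mulr_ge0// exprn_ge0// addr_ge0// mulr_ge0// sqr_ge0.
move=> G H Hks sG sH; have pc := pol_cellprod r1 sH; rewrite Hks -/B in pc.
have := HC G H (cellprod H) B sG sH pc.
rewrite (_ : ev H (cellprod H) = 0) ?subr0; last first.
  by apply: big1 => j _; rewrite cellprod_atom mulr0.
exact: le_trans (ler_norm _).
Qed.

(* A long word contains some letter [i] at least [2 * ks] times. In that word, the power of
   the coordinate [i] is traded for the product of the squares [(th 0 i - atom H l 0 i) ^+ 2],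
   which vanishes on H and has small mean under G, up to shorter words. *)
Lemma moment_dual (S : 'M[R]_d) rad ks : sym_posdef S -> 1 <= rad ->
  exists K A : R, [/\ 1 <= K, 1 <= A & forall G H s,
    natoms H = ks -> supp rad G -> supp rad H ->
    `|L G H (mon s)| <= K * A ^+ size s * hel S G H].
Proof.
move=> pS r1; have r0 : 0 <= rad by lra.
pose r := (ks + ks)%N; pose D := (d * r)%N.
have [C1 [C10 HC1]] := mon_dual pS D r0.
have [C2 [C20 HC2]] := ev_cellprod_le ks pS r1.
(* [C1] covers the words of length at most [D] and [C2] the mean of [cellprod]. [A] dominates the
   bound [rad] on each letter of the rest of the word, and the factor [(1 + rad) ^+ r] that one
   trade of [r] letters costs. *)
pose A := rad + (1 + rad) ^+ r; pose K := 1 + C1 + C2.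
have Q1 : 1 <= (1 + rad) ^+ r by apply: exprn_ege1; lra.
have A1 : 1 <= A by rewrite /A; lra.
have Ar : rad <= A by rewrite /A; lra.
have A0 : 0 <= A by lra.
have K0 : 0 <= K by rewrite /K; lra.
exists K, A; split => //; first by rewrite /K; lra.
move=> G H s Hks sG sH; have h0 := hel_ge0 S G H.
have [N] := ubnP (size s); elim: N s => // N IH s; rewrite ltnS => sN.
have [sD|sD] := leqP (size s) D.
  apply: (le_trans (HC1 _ _ _ sG sH sD)); rewrite ler_wpM2r//.
  have := exprn_ege1 (size s) A1; have : C1 <= K by rewrite /K; lra.
  by move=> ? ?; nra.
have [|i [s' ss']] := @ex_frequent_letter _ s r; first by rewrite card_ord.
have size_s : size s = (r + size s')%N by rewrite (perm_size ss') size_cat size_nseq.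
have r_gt0 : (0 < r)%N by rewrite addn_gt0 -Hks natoms_gt0.
pose l : seq R := [seq atom H j 0 i | j <- enum 'I_(natoms H)].
have size_l : size (l ++ l) = r by rewrite size_cat size_map -cardE card_ord Hks.
have lr : all (fun a => `|a| <= rad) (l ++ l).
  rewrite all_cat andbb; apply/allP => _ /mapP[j _ ->].
  exact: le_trans (coord_le_enorm _ _) (sH j).
pose M := K * A ^+ (size s).-1 * hel S G H.
have HM t : (size t < size s)%N -> `|L G H (mon t)| <= M.
  move=> ts; apply: le_trans (IH t (leq_trans ts sN)) _.
  rewrite /M ler_wpM2r// ler_wpM2l// ler_weXn2l//.
  by rewrite -ltnS prednK// (leq_ltn_trans _ ts).
have := moment_shift i r0 HM lr (s := s'); rewrite size_l -size_s => /(_ (leqnn _)).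
have -> : mon (nseq r i ++ s') = mon s :> ('rV[R]_d -> R) by apply/funext => th; exact/esym/mon_perm.
have E (th : 'rV[R]_d) : \prod_(a <- l ++ l) (th 0 i - a) = \prod_l (th 0 i - atom H l 0 i) ^+ 2.
  rewrite big_cat/= /l big_map big_enum -big_split/=.
  by apply: eq_bigr => j _; rewrite expr2.
have -> : shifted i (l ++ l) s' = (fun th => (\prod_l (th 0 i - atom H l 0 i) ^+ 2) * mon s' th).
  by apply/funext => th; rewrite E.
set T := fun th : 'rV[R]_d => _.
have -> : ev H T = 0.
  apply: big1 => j _; rewrite /T (bigD1 j)//= subrr expr0n/= !mul0r mulr0//.
have HT : `|ev G T| <= M.
  apply: (le_trans (ev_coord_prod H i s' r1 sG)).
  have c0 : 0 <= ev G (cellprod H).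
    by apply: sumr_ge0 => j _; rewrite mulr_ge0 ?weight_ge0// cellprod_ge0.
  rewrite /M (mulrC K) -mulrA; apply: ler_pM => //; first exact: exprn_ge0.
    apply: le_trans (_ : A ^+ size s' <= _); first by rewrite lerXn2r ?nnegrE.
    by rewrite ler_weXn2l// size_s; case: (r) r_gt0 => // r' _; rewrite addSn/= leq_addl.
  apply: (le_trans (HC2 _ _ Hks sG sH)); rewrite ler_wpM2r// /K; lra.
rewrite subr0 => HS.
have -> : size s = (size s).-1.+1 by rewrite prednK// size_s addn_gt0 r_gt0.
rewrite exprS mulrCA -!mulrA (mulrA K) -/M.
have -> : L G H (mon s) = (L G H (mon s) - ev G T) + ev G T by rewrite subrK.
apply: (le_trans (ler_normD _ _)).
have M0 : 0 <= M by rewrite /M !mulr_ge0// exprn_ge0.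
have : (1 + rad) ^+ r * M <= A * M by rewrite ler_wpM2r// /A; lra.
lra.
Qed.

End moments.

(** * Tails of the exponential series *)

Section exponential_series.
Context {R : realType}.
Implicit Types x q : R.

Definition expsum N x : R := \sum_(k < N) x ^+ k / k`!%:R.

Lemma expsumE x : expR x = limn (expsum^~ x).
Proof. by rewrite /expR; congr (limn _); apply/funext => N; rewrite /series/= big_mkord. Qed.

Lemma is_cvg_expsum x : cvgn (expsum^~ x).
Proof.
have := is_cvg_series_exp_coeff x; rewrite (_ : series _ = expsum^~ x)//.
by apply/funext => N; rewrite /series/= big_mkord.
Qed.

Lemma expsum_le N x : 0 <= x -> expsum N x <= expR x.
Proof.
move=> x0; rewrite expsumE; apply: (nondecreasing_cvgn_le (u_ := expsum^~ x)).
  apply/nondecreasing_seqP => n; rewrite /expsum big_ord_recr/= lerDl.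
  by rewrite divr_ge0// exprn_ge0.
exact: is_cvg_expsum.
Qed.

Lemma expr_fact_le k x : 0 <= x -> x ^+ k / k`!%:R <= expR x.
Proof.
move=> x0; apply: le_trans (expsum_le k.+1 x0).
rewrite /expsum big_ord_recr/= lerDr; apply: sumr_ge0 => i _.
by rewrite divr_ge0// exprn_ge0.
Qed.

(** A term of order at least [M] is at most [2 ^- M] times the same term of the series at [2 * q].
    The geometric rate makes a truncation at order [n] negligible for a sample of size [n]. *)
Lemma expsum_tail M x q : `|x| <= q -> `|expR x - expsum M x| <= 2^-1 ^+ M * expR (2 * q).
Proof.
move=> xq; have q0 : 0 <= q := le_trans (normr_ge0 _) xq.
have key N : `|expsum (M + N) x - expsum M x| <= 2^-1 ^+ M * expR (2 * q).
  rewrite /expsum big_split_ord/= [X in X - _]addrC addrK.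
  apply: le_trans (_ : 2^-1 ^+ M * expsum (M + N) (2 * q) <= _); last first.
    by rewrite ler_wpM2l ?exprn_ge0// expsum_le// mulr_ge0.
  apply: (le_trans (ler_norm_sum _ _ _)).
  rewrite /expsum big_split_ord/= mulrDr; apply: ler_wpDl.
    rewrite mulr_ge0 ?exprn_ge0//; apply: sumr_ge0 => i _.
    by rewrite divr_ge0// exprn_ge0// mulr_ge0.
  rewrite mulr_sumr; apply: ler_sum => i _.
  rewrite normrM normfV normr_nat mulrA ler_wpM2r ?invr_ge0// normrX.
  rewrite exprMn mulrA (exprD 2) mulrA -exprMn mulVf// expr1n mul1r.
  rewrite -[leLHS]mul1r; apply: ler_pM => //; first by rewrite exprn_ege1 ?ler1n.
  by rewrite lerXn2r ?nnegrE.
have nearM P : (forall N, P (M + N)%N) -> \forall N \near \oo, P N.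
  by move=> HP; exists M => // N /= MN; rewrite -(subnKC MN).
move: (_ * expR _) key => B key.
rewrite ler_norml; apply/andP; split.
- rewrite lerBrDr addrC expsumE; apply: limr_ge; first exact: is_cvg_expsum.
  by apply: nearM => N; have := key N; rewrite ler_norml; lra.
- rewrite lerBlDr expsumE; apply: limr_le; first exact: is_cvg_expsum.
  by apply: nearM => N; have := key N; rewrite ler_norml; lra.
Qed.

End exponential_series.

(** * Powers of the log-likelihood ratio as sums over words *)

Section word_expansion.
Context {R : realType} (d : nat).
Variables (S : 'M[R]_d).
Hypothesis pS : sym_posdef S.
Local Notation iS := (invmx S).
Local Notation g := (gauss_pdf 0 S).

Local Notation letter := ('I_d + 'I_d * 'I_d)%type.

(** A letter is a term of the polynomial [gexp S x] in the parameter: linear for [inl], quadratic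
    for [inr]. [lword] gives its monomial and [lcoef] its coefficient. *)
Definition lword (a : letter) : seq 'I_d :=
  match a with inl i => [:: i] | inr ij => [:: ij.1; ij.2] end.

Definition lcoef (x : 'rV[R]_d) (a : letter) : R :=
  match a with inl j => \sum_i x 0 i * iS i j | inr ij => - (iS ij.1 ij.2 / 2) end.

Lemma gexp_letters x th : gexp S x th = \sum_a lcoef x a * mon (lword a) th.
Proof.
rewrite big_sumType/= /gexp !bilE; congr (_ + _).
  by apply: eq_bigr => j _; rewrite /mon big_seq1 mulr_suml.
rewrite mulr_suml -sumrN -[RHS](pair_big xpredT xpredT
  (fun i j => - (iS i j / 2) * mon [:: i; j] th))/= exchange_big/=.
apply: eq_bigr => j _; rewrite mulr_suml -sumrN; apply: eq_bigr => i _.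
by rewrite /mon !big_cons big_nil; ring.
Qed.

Definition lbound : R := \sum_i \sum_j `|iS i j|.

Lemma lbound_ge0 : 0 <= lbound.
Proof. by apply: sumr_ge0 => i _; apply: sumr_ge0. Qed.

Lemma entry_le_lbound i j : `|iS i j| <= lbound.
Proof.
rewrite /lbound (bigD1 i)//= (bigD1 j)//= -addrA lerDl addr_ge0//.
  by apply: sumr_ge0.
by apply: sumr_ge0 => k _; apply: sumr_ge0.
Qed.

Lemma lcoef_le x a : `|lcoef x a| <= lbound * (1 + norm1 x).
Proof.
have N0 := norm1_ge0 x; have L0 := lbound_ge0.
case: a => [j|[i j]] /=.
  apply: le_trans (_ : lbound * norm1 x <= _); last by rewrite ler_wpM2l// lerDr.
  apply: (le_trans (ler_norm_sum _ _ _)); rewrite /norm1 mulr_sumr.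
  by apply: ler_sum => i _; rewrite normrM mulrC ler_wpM2r// entry_le_lbound.
have := entry_le_lbound i j; rewrite normrN normrM (ger0_norm (_ : 0 <= 2^-1))// => H.
have := normr_ge0 (iS i j); nra.
Qed.

Lemma rv_measurable_lcoef a : rv_measurable (fun x => lcoef x a).
Proof.
case: a => [j|[i j]] /=; last exact: rv_measurable_cst.
apply: (@rv_measurable_sum R d _ _ (fun i x => x 0 i * iS i j)) => i.
by apply: rv_measurableM; [exact: rv_measurable_coord|exact: rv_measurable_cst].
Qed.

Variable M : nat.
Local Notation idx := ('I_M * {ffun 'I_M -> letter})%type.

(** An index is a degree [k < M] with [M] letters, of which only the first [k] count. This padding
    makes all degrees share one finite type. *)
Definition word (t : idx) : seq 'I_d :=
  flatten [seq (if (i < t.1)%N then lword (t.2 i) else [::]) | i : 'I_M <- index_enum _].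

Definition wcoef (t : idx) x : R := \prod_(i < M) (if (i < t.1)%N then lcoef x (t.2 i) else 1).

Lemma mon_word t (th : 'rV[R]_d) :
  mon (word t) th = \prod_(i < M) (if (i < t.1)%N then mon (lword (t.2 i)) th else 1).
Proof.
rewrite /mon /word big_flatten big_map; apply: eq_bigr => i _.
by case: ifP => // _; rewrite big_nil.
Qed.

Lemma prod_ord_lt (c : R) (k : 'I_M) : \prod_(i < M) (if (i < k)%N then c else 1) = c ^+ k.
Proof.
by rewrite -big_mkcond/= (big_ord_narrow (ltnW (ltn_ord k))) prodr_const card_ord.
Qed.

Lemma size_word t : (size (word t) <= 2 * t.1)%N.
Proof.
rewrite /word size_flatten /shape -map_comp sumnE big_map/=.
apply: (@leq_trans (\sum_(i < M) (if (i < t.1)%N then 2 else 0))%N).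
  by apply: leq_sum => i _; case: ifP => // _; case: (t.2 i).
rewrite -big_mkcond/= (big_ord_narrow (ltnW (ltn_ord t.1))).
by rewrite sum_nat_const card_ord mulnC.
Qed.

Lemma wcoef_le t x : `|wcoef t x| <= (lbound * (1 + norm1 x)) ^+ t.1.
Proof.
rewrite /wcoef normr_prod -prod_ord_lt; apply: ler_prod => i _.
by rewrite normr_ge0/=; case: ifP => _; [exact: lcoef_le|rewrite normr1].
Qed.

Lemma rv_measurable_wcoef t : rv_measurable (wcoef t).
Proof.
have := @rv_measurable_prod R d _ (index_enum 'I_M)
  (fun i x => if (i < t.1)%N then lcoef x (t.2 i) else 1); apply => i.
by case: (i < t.1)%N; [exact: rv_measurable_lcoef|exact: rv_measurable_cst].
Qed.

(** The power is expanded by distributivity; each of the [M - k] idle letters is summed freely,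
    which gives the last factor. *)
Lemma gexp_pow (k : 'I_M) x th :
  \sum_(f : {ffun 'I_M -> letter}) wcoef (k, f) x * mon (word (k, f)) th =
  gexp S x th ^+ k * (#|{: letter}|%:R) ^+ (M - k).
Proof.
transitivity (\prod_(i < M) \sum_a
    ((if (i < k)%N then lcoef x a else 1) * (if (i < k)%N then mon (lword a) th else 1))).
  by rewrite bigA_distr_bigA/=; apply: eq_bigr => f _; rewrite mon_word -big_split.
transitivity (\prod_(i < M) ((if (i < k)%N then gexp S x th else 1) *
    (if (i < k)%N then 1 else #|{: letter}|%:R))).
  apply: eq_bigr => i _; case: ifP => _.
    by rewrite mulr1 gexp_letters.
  by rewrite !mul1r sumr_const.
rewrite big_split/= prod_ord_lt; congr (_ * _).
rewrite (eq_bigr (fun i : 'I_M => if ~~ (i < k)%N then #|{: letter}|%:R else 1)); last first.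
  by move=> i _; case: ifP.
rewrite -big_mkcond/= prodr_const; congr (_ ^+ _).
have := cardC [pred i : 'I_M | (i < k)%N]; rewrite card_ord.
have -> : #|[pred i : 'I_M | (i < k)%N]| = k.
  by rewrite -sum1_card (big_ord_narrow (ltnW (ltn_ord k))) sum1_card card_ord.
by move=> kM; rewrite -[X in (X - k)%N]kM addKn; apply: eq_card => i; rewrite !inE.
Qed.

End word_expansion.

(** * Expansion of a mixture around the true one *)

Section mixture_expansion.
Context {R : realType} (d : nat).
Variables (S : 'M[R]_d).
Hypothesis pS : sym_posdef S.
Local Notation g := (gauss_pdf 0 S).
Local Notation letter := ('I_d + 'I_d * 'I_d)%type.
Local Notation na := (#|{: letter}|%:R : R).

Lemma geom_half_bounds M : (0 < M)%N -> 1 <= \sum_(k < M) (2^-1 : R) ^+ k <= 2.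
Proof.
case: M => // M _; apply/andP; split.
  by rewrite big_ord_recl expr0 lerDl; apply: sumr_ge0 => i _; rewrite exprn_ge0.
suff -> : \sum_(k < M.+1) (2^-1 : R) ^+ k = 2 - 2^-1 ^+ M by rewrite gerBl exprn_ge0.
elim: M => [|M IH]; first by rewrite big_ord1 !expr0; lra.
by rewrite big_ord_recr/= IH exprS; lra.
Qed.

Lemma card_letter_ge1 : (0 < d)%N -> 1 <= na.
Proof.
by move=> d0; rewrite ler1n card_sum card_ord (leq_trans d0)// leq_addr.
Qed.

(* The prior and the functions [U] do not depend on G, which enters only through [lam]. *)
Lemma mixture_expansion rad ks : (0 < d)%N -> 1 <= rad -> exists E c : R, [/\ 0 <= E, 0 <= c &
  forall M, (0 < M)%N -> exists (T : finType) (pi0 : T -> R) (U : T -> 'rV[R]_d -> R),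
  [/\ (forall t, 0 <= pi0 t) /\ \sum_t pi0 t = 1, forall t, rv_measurable (U t),
      forall t x, `|U t x| <= E * ewt c x &
  forall G H (eta : R), natoms H = ks -> supp rad G -> supp rad H -> 0 < eta ->
    hel S G H <= eta -> exists lam : T -> R, (forall t, `|lam t| <= 1) /\
    forall x, `|mixture_pdf S G x - mixture_pdf S H x
                 - eta * (g x * \sum_t pi0 t * (lam t * U t x))|
              <= 2 * 2^-1 ^+ M * (g x * ewt c x)]].
Proof.
move=> d0 r1; have r0 : 0 <= rad by lra.
have [K [A [K1 A1 KA]]] := moment_dual ks pS r1.
have na1 := card_letter_ge1 d0; have na0 : 0 < na by lra.
have A0 : 0 < A by lra.
have K0 : 0 < K by lra.
have A0' := ltW A0; have K0' := ltW K0; have na0' := ltW na0.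
have L0 := lbound_ge0 S; have gc0 := gc_ge0 S r0.
(* [c1] bounds the functions [U], since [y ^+ k / k!] is at most [expR y]; [c2] is the exponent of
   the truncation error in [expsum_tail]. *)
pose c1 := 2 * na * A ^+ 2 * lbound S; pose c2 := 2 * gc S rad.
have c10 : 0 <= c1 by rewrite !mulr_ge0.
have c20 : 0 <= c2 by rewrite mulr_ge0.
exists (2 * K), (c1 + c2); split; [lra|lra|] => M M0.
have [Z1 Z2] := andP (geom_half_bounds M0).
set Z := \sum_(k < M) 2^-1 ^+ k in Z1 Z2; have ZE : Z = \sum_(k < M) 2^-1 ^+ k by [].
clearbody Z; have Z0 : 0 < Z by lra.
have Z0' := ltW Z0.
pose T := ('I_M * {ffun 'I_M -> letter})%type.
(* A geometric law on the degree and a uniform law on the letters. [U] undoes these weights and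
   carries the factor [K * A ^+ (2 * k)], by which the moments are normalized in [lam]; the
   factorial compensates its growth in [k]. *)
pose pi0 (t : T) := 2^-1 ^+ t.1 / Z / na ^+ M.
pose U (t : T) x := Z * ((2 * na * A ^+ 2) ^+ t.1 / (t.1)`!%:R) * K * wcoef S t x.
exists T, pi0, U; split.
- split=> [t|]; first by rewrite /pi0 !mulr_ge0 ?invr_ge0 ?exprn_ge0.
  rewrite -(pair_big xpredT xpredT (fun (k : 'I_M) (f : {ffun 'I_M -> letter}) => pi0 (k, f)))/=.
  under eq_bigr do rewrite /pi0/= sumr_const card_ffun card_ord -[_ *+ _]mulr_natr natrX mulfVK ?expf_neq0 ?lt0r_neq0//.
  by rewrite -mulr_suml -ZE divff// lt0r_neq0.
- move=> t; apply: rv_measurableM; first exact: rv_measurable_cst.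
  exact: rv_measurable_wcoef.
- move=> t x; rewrite ewtD /U normrM.
  have e1 : 1 <= ewt c2 x by exact: ewt_ge1.
  have F0 : 0 <= (2 * na * A ^+ 2) ^+ t.1 / (t.1)`!%:R.
    by rewrite divr_ge0// exprn_ge0// !mulr_ge0.
  have ZFK := mulr_ge0 (mulr_ge0 Z0' F0) K0'; rewrite (ger0_norm ZFK).
  apply: le_trans (_ : 2 * K * (ewt c1 x * 1) <= _); last first.
    by rewrite ler_wpM2l ?ler_wpM2l ?expR_ge0 ?mulr_ge0.
  rewrite mulr1.
  apply: le_trans (_ : Z * ((2 * na * A ^+ 2) ^+ t.1 / (t.1)`!%:R) * K *
     (lbound S * (1 + norm1 x)) ^+ t.1 <= _).
    by rewrite ler_wpM2l ?wcoef_le.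
  have -> : Z * ((2 * na * A ^+ 2) ^+ t.1 / (t.1)`!%:R) * K * (lbound S * (1 + norm1 x)) ^+ t.1
     = Z * K * ((c1 * (1 + norm1 x)) ^+ t.1 / (t.1)`!%:R).
    have -> : c1 * (1 + norm1 x) = (2 * na * A ^+ 2) * (lbound S * (1 + norm1 x)).
      by rewrite /c1; ring.
    by rewrite [in RHS]exprMn; ring.
  have x0 := norm1_ge0 x.
  apply: ler_pM; [by rewrite mulr_ge0| | by rewrite ler_wpM2r|].
    by rewrite divr_ge0// exprn_ge0// mulr_ge0// addr_ge0.
  by apply: expr_fact_le; rewrite mulr_ge0// addr_ge0.
move=> G H eta Hks sG sH eta0 heta.
(* A word of degree [k] has at most [2 * k] coordinates, so that [moment_dual] and
   [hel S G H <= eta] bound this quotient by 1. *)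
pose lam (t : T) := (ev G (mon (word t)) - ev H (mon (word t))) / (K * A ^+ (2 * t.1) * eta).
have den0 (t : T) : 0 < K * A ^+ (2 * t.1) * eta by rewrite !mulr_gt0// exprn_gt0.
exists lam; split=> [t|x].
  rewrite /lam normrM normfV (gtr0_norm (den0 t)) ler_pdivrMr// mul1r.
  apply: (le_trans (KA _ _ _ Hks sG sH)); apply: ler_pM => //.
  - by rewrite mulr_ge0 ?exprn_ge0.
  - exact: hel_ge0.
  - by rewrite ler_wpM2l ?(ltW K0)// ler_weXn2l// size_word.
have LE G' : mixture_pdf S G' x = g x * ev G' (fun th => expR (gexp S x th)).
  by rewrite mixture_pdfE -evZ; apply: eq_ev => i; rewrite gauss_pdfE.
have -> : eta * (g x * \sum_t pi0 t * (lam t * U t x)) =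
   g x * (ev G (fun th => expsum M (gexp S x th)) - ev H (fun th => expsum M (gexp S x th))).
  rewrite mulrCA; congr (_ * _).
  have EE G' : ev G' (fun th => expsum M (gexp S x th)) =
     \sum_(t : T) (wcoef S t x * na ^+ t.1 / na ^+ M / (t.1)`!%:R) * ev G' (mon (word t)).
    transitivity (ev G' (fun th => \sum_(t : T)
        (wcoef S t x * na ^+ t.1 / na ^+ M / (t.1)`!%:R) * mon (word t) th)); last first.
      by rewrite ev_sum; apply: eq_bigr => t _; rewrite evZ.
    apply: eq_ev => j; rewrite -(pair_big xpredT xpredT
      (fun (k : 'I_M) (f : {ffun 'I_M -> letter}) =>
       wcoef S (k, f) x * na ^+ k / na ^+ M / k`!%:R * mon (word (k, f)) (atom G' j)))/=.
    apply: eq_bigr => k _.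
    transitivity ((na ^+ k / na ^+ M / k`!%:R) *
      \sum_(f : {ffun 'I_M -> letter}) wcoef S (k, f) x * mon (word (k, f)) (atom G' j)); last first.
      by rewrite mulr_sumr; apply: eq_bigr => f _; ring.
    rewrite gexp_pow.
    have -> : na ^+ M = na ^+ k * na ^+ (M - k) by rewrite -exprD subnKC// ltnW.
    by field; rewrite !expf_neq0 ?lt0r_neq0// pnatr_eq0 -lt0n fact_gt0.
  rewrite !EE -sumrB mulr_sumr; apply: eq_bigr => t _; rewrite -mulrBr /lam /pi0 /U.
  set W := wcoef S t x; set D := ev G _ - _; rewrite exprVn.
  have -> : (2 * na * A ^+ 2) ^+ t.1 = 2 ^+ t.1 * na ^+ t.1 * A ^+ (2 * t.1).
    by rewrite exprM -!exprMn.
  have f0 : (t.1)`!%:R != 0 :> R by rewrite pnatr_eq0 -lt0n fact_gt0.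
  field; rewrite f0 !expf_neq0 ?lt0r_neq0//.
rewrite !LE -mulrBr -mulrBr normrM (gtr0_norm (gauss_pdf_gt0 pS _ _)).
rewrite [leRHS]mulrCA ler_wpM2l ?(ltW (gauss_pdf_gt0 pS _ _))//.
set a1 := ev G _; set a2 := ev H _; set b1 := ev G _; set b2 := ev H _.
have -> : a1 - a2 - (b1 - b2) = (a1 - b1) - (a2 - b2) by ring.
have tail G' : supp rad G' ->
  `|ev G' (fun th => expR (gexp S x th)) - ev G' (fun th => expsum M (gexp S x th))|
   <= 2^-1 ^+ M * ewt (c1 + c2) x.
  move=> sG'; rewrite -evB; apply: (le_trans (ev_norm _ _)).
  rewrite -[leRHS](ev_cst G'); apply: (le_ev sG') => th thr.
  apply: (le_trans (expsum_tail M (gexp_le S x r0 thr))).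
  rewrite ler_wpM2l ?exprn_ge0// /ewt ler_expR mulrA ler_wpM2r ?addr_ge0 ?norm1_ge0//.
  by rewrite -/c2; lra.
apply: (le_trans (ler_normB _ _)); have := tail G sG; have := tail H sH.
rewrite -/a1 -/a2 -/b1 -/b2 -mulrA; lra.
Qed.

End mixture_expansion.

(** * Density estimation near the true mixture *)

Section local_regime.
Context {R : realType} (d : nat).
Variables (S : 'M[R]_d).
Hypothesis pS : sym_posdef S.
Local Notation g := (gauss_pdf 0 S).

Definition bsgn (s : bool) : R := if s then 1 else -1.

Lemma sum_signed (T : finType) (pi0 lam U : T -> R) (c : R) :
  \sum_t pi0 t = 1 ->
  \sum_(t : T * bool) pi0 t.1 * (1 + bsgn t.2 * lam t.1) / 2 * (c + bsgn t.2 * U t.1) =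
  c + \sum_t pi0 t * (lam t * U t).
Proof.
move=> pi01; rewrite -(pair_big xpredT xpredT
  (fun t s => pi0 t * (1 + bsgn s * lam t) / 2 * (c + bsgn s * U t)))/=.
have -> : c + \sum_t pi0 t * (lam t * U t) = \sum_t pi0 t * (c + lam t * U t).
  by under [RHS]eq_bigr do rewrite mulrDr; rewrite big_split/= -mulr_suml pi01 mul1r.
apply: eq_bigr => t _; rewrite big_bool/= /bsgn; lra.
Qed.

Lemma signed_weight (q l : R) s : 0 <= q -> `|l| <= 1 ->
  0 <= q * (1 + bsgn s * l) / 2 <= 2 * (q / 2).
Proof.
by move=> q0; rewrite ler_norml /bsgn => /andP[l1 l2]; case: s; apply/andP; split; nra.
Qed.

(** The truncation at [p / 2], which keeps the perturbed densities positive, acts only where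
    [2 * |y| > p]. There the excess is at most [|y|], hence at most [|y|] times
    [(2 * |y| / p) ^+ 2]. The cubic order makes it negligible against [h ^+ 2]. *)
Lemma max_half_excess (p y : R) : 0 < p ->
  Num.max (p + y) (p / 2) - (p + y) <= 4 * `|y| ^+ 3 / p ^+ 2.
Proof.
move=> p0; have rhs0 : 0 <= 4 * `|y| ^+ 3 / p ^+ 2.
  by rewrite !mulr_ge0 ?invr_ge0 ?exprn_ge0 ?(ltW p0).
case: (leP (p / 2) (p + y)) => [_|H]; first by rewrite subrr.
have y0 : y < 0 by lra.
rewrite ler_pdivlMr ?exprn_gt0// ltr0_norm//.
have u : p < 2 * - y by lra.
have : p ^+ 2 <= (2 * - y) ^+ 2 by rewrite ler_sqr ?nnegrE; lra.
move=> H2; apply: le_trans (_ : - y * (2 * - y) ^+ 2 <= _).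
  by apply: ler_pM => //; [lra|exact: sqr_ge0|lra].
by rewrite !exprSr expr0; lra.
Qed.

Lemma max_half_dist (p y z : R) :
  `|Num.max (p + y) (p / 2) - Num.max (p + z) (p / 2)| <= `|y| + `|z|.
Proof.
have := ler_norm y; have := ler_norm (- y); have := ler_norm z; have := ler_norm (- z).
rewrite !normrN => h1 h2 h3 h4.
case: (leP (p / 2) (p + y)) => ?; case: (leP (p / 2) (p + z)) => ?;
  rewrite ler_norml; apply/andP; split; lra.
Qed.

(** The lower bound on [m] makes the variance term at most [h ^+ 2 / 4], and the upper bound on [h]
    does the same for the cubic term. Half of the left side remains, which doubles the other terms;
    the remainders [2 ^- n] add up to a constant, as [n <= 2 ^ n]. *)
Lemma local_arith (n m : nat) (KK E eta h L : R) : (0 < n)%N -> (0 < m)%N ->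
  0 <= KK -> 64 * KK * E ^+ 2 <= m%:R ->
  0 <= E -> 0 <= eta -> eta <= 2 * h -> 0 <= h -> h <= (1 + 128 * KK * E ^+ 3)^-1 ->
  n%:R * h ^+ 2 <= m%:R * ln 2 + 2 * L + n%:R * (KK * (4 * eta ^+ 2 * E ^+ 2 / m%:R +
     2 * 2^-1 ^+ n + (2 * 2^-1 ^+ n + 4 * eta ^+ 3 * E ^+ 3))) ->
  n%:R * h ^+ 2 <= 2 * m%:R * ln 2 + 8 * KK + 4 * L.
Proof.
move=> n0 m0 KK0 mE E0 eta0 eta2 h0 hh H.
have nn : 0 < n%:R :> R by rewrite ltr0n.
have mm : 0 < m%:R :> R by rewrite ltr0n.
have K2 : 0 <= KK * E ^+ 2 by rewrite mulr_ge0// sqr_ge0.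
have K3 : 0 <= KK * E ^+ 3 by rewrite mulr_ge0// exprn_ge0.
have h2 : 0 <= h ^+ 2 by exact: sqr_ge0.
have e2 : eta ^+ 2 <= 4 * h ^+ 2.
  by have := lerXn2r 2 eta0 (mulr_ge0 (ler0n R 2) h0) eta2; rewrite exprMn; lra.
have e3 : eta ^+ 3 <= 8 * (h * h ^+ 2).
  have := lerXn2r 3 eta0 (mulr_ge0 (ler0n R 2) h0) eta2; rewrite exprMn exprS; lra.
have a1 : KK * (4 * eta ^+ 2 * E ^+ 2 / m%:R) <= h ^+ 2 / 4.
  rewrite mulrA ler_pdivrMr//.
  have := ler_wpM2l K2 e2; have := ler_wpM2l h2 mE; lra.
have a2 : KK * (4 * eta ^+ 3 * E ^+ 3) <= h ^+ 2 / 4.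
  have h128 : 128 * (KK * E ^+ 3) * h <= 1.
    have D0 : 0 < 1 + 128 * KK * E ^+ 3 by rewrite ltr_pwDl// -mulrA mulr_ge0.
    have : h * (1 + 128 * KK * E ^+ 3) <= 1 by rewrite -ler_pdivlMr// mul1r.
    by rewrite mulrDr mulr1; lra.
  have := ler_wpM2l K3 e3; have := ler_wpM2l h2 h128; lra.
have a3 : n%:R * (2^-1 ^+ n) <= 1 :> R.
  rewrite exprVn ler_pdivrMr ?exprn_gt0// mul1r -natrX ler_nat.
  by rewrite ltnW// ltn_expl.
have := ler_wpM2l (ltW nn) (lerD a1 a2); have := ler_wpM2l KK0 a3.
move: H; rewrite !mulrDr; lra.
Qed.

(* Each [U t] comes with both signs, and the posterior only biases the signs by [lam]: it has
   density at most 2 with respect to the prior, whatever the number of components of G. *)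
Lemma local_rate rad ks : (0 < d)%N -> 1 <= rad ->
  exists K h0 b c : R, [/\ 0 < h0, 0 <= b, 0 <= c &
  forall Gs : mixing R d, natoms Gs = ks -> supp rad Gs ->
  forall (disp : measure_display) (Omega : measurableType disp) (P : probability Omega R)
    (n : nat) (X : 'I_n -> {mfun Omega >-> d.-tuple (measurableTypeR R)}), (0 < n)%N ->
  iid_sample P X (mixture_pdf S Gs) -> forall eta : R, 0 < eta ->
  exists Bad : set Omega, [/\ measurable Bad, (P Bad <= ((n%:R ^+ 2)^-1)%:E)%E &
   forall w, ~ Bad w ->
     \sum_i ewt (2 * c + 2 * b) (rv_of_tuple (X i w)) <= n%:R * ewt_avg S rad b c ->
   forall (G : mixing R d), supp rad G ->
     \sum_i ln (mixture_pdf S Gs (rv_of_tuple (X i w))) <=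
     \sum_i ln (mixture_pdf S G (rv_of_tuple (X i w))) ->
     hel S G Gs <= eta -> eta <= 2 * hel S G Gs -> hel S G Gs <= h0 ->
     n%:R * hel S G Gs ^+ 2 <= K + 4 * ln n%:R]].
Proof.
move=> d0 r1; have r0 : 0 <= rad by lra.
have [E [c0 [E0 c00 HE]]] := mixture_expansion pS ks d0 r1.
pose b := gc S rad; have b0 : 0 <= b := gc_ge0 S r0.
(* The weight of the cubic excess: the cube of a perturbation of weight [c0], divided by the square
   of the lower bound of weight [- b]. *)
pose c := 3 * c0 + 2 * b; have cge0 : 0 <= c by rewrite /c; lra.
pose KK := 2 * ewt_avg S rad b c + mom S rad c.
have KK0 : 0 <= KK.
  by rewrite addr_ge0 ?mulr_ge0 ?addr_ge0 ?mom_ge0.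
pose m := (Num.truncn (64 * KK * E ^+ 2)).+1.
have mE : 64 * KK * E ^+ 2 <= m%:R by rewrite ltW// truncnS_gt.
have mm : 0 < m%:R :> R by rewrite ltr0n.
pose h0 := (1 + 128 * KK * E ^+ 3)^-1.
have E3 : 0 <= KK * E ^+ 3 by rewrite mulr_ge0// exprn_ge0.
have h00 : 0 < h0 by rewrite invr_gt0; lra.
exists (2 * m%:R * ln 2 + 8 * KK), h0, b, c; split=> //.
move=> Gs Hks sGs disp Omega P n X n0 iidX eta eta0.
(* The expansion is truncated at the order [n]. The prior may depend on [n], since the bound
   involves the density 2 and not the number of words. *)
have [T [pi0 [U [[pi00 pi01] mU UE HT]]]] := HE n n0.
pose psi (t : T * bool) x :=
  Num.max (mixture_pdf S Gs x + bsgn t.2 * (eta * g x * U t.1 x)) (mixture_pdf S Gs x / 2).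
pose pi2 (t : T * bool) := pi0 t.1 / 2.
have pi20 t : 0 <= pi2 t by rewrite divr_ge0.
have pi21 : \sum_t pi2 t = 1.
  rewrite -(pair_big xpredT xpredT (fun t (s : bool) => pi2 (t, s)))/= -pi01.
  by apply: eq_bigr => t _; rewrite big_bool/= /pi2/=; lra.
have gx x : 0 < g x := gauss_pdf_gt0 pS 0 x.
have p0 x : 0 < mixture_pdf S Gs x := mixture_pdf_gt0 pS Gs x.
have Uy (t : T * bool) x : `|bsgn t.2 * (eta * g x * U t.1 x)| <= eta * g x * (E * ewt c0 x).
  rewrite normrM (_ : `|bsgn t.2| = 1) ?mul1r; last first.
    by rewrite /bsgn; case: t.2; rewrite ?normrN normr1.
  have eg : 0 < eta * g x by exact: mulr_gt0.
  by rewrite normrM (gtr0_norm eg); apply: ler_wpM2l; [exact: ltW|exact: UE].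
have cc (x : 'rV[R]_d) : ewt c0 x <= ewt c x by apply: le_ewt; rewrite /c; lra.
have mpsi t : rv_measurable (psi t).
  have mp := rv_measurable_mixture S Gs.
  apply: rv_measurable_max; last by apply: rv_measurableM => //; exact: rv_measurable_cst.
  apply: rv_measurableD => //; apply: rv_measurableM; first exact: rv_measurable_cst.
  apply: rv_measurableM => //; apply: rv_measurableM; first exact: rv_measurable_cst.
  exact: rv_measurable_gauss.
have ipsi t : rv_integrable (psi t).
  apply: (@rv_integrable_ewtM _ _ _ pS _ (1 + eta * E) c) => // x.
  have H1 := mixture_pdf_le pS x r0 sGs.
  have H2 := Uy t x; have H3 : ewt (gc S rad) x <= ewt c x.
    by apply: le_ewt; rewrite /c -/b; lra.
  have H4 := ler_wpM2l (ltW (gx x)) H3.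
  have H5 : eta * g x * (E * ewt c0 x) <= eta * E * (g x * ewt c x).
    have -> : eta * g x * (E * ewt c0 x) = eta * E * (g x * ewt c0 x) by ring.
    by rewrite ler_wpM2l ?ler_wpM2l// ?(ltW (gx x))// mulr_ge0// ltW.
  have p0' := p0 x; have ab : 0 <= psi t x.
    by rewrite /psi le_max; apply/orP; right; lra.
  rewrite ger0_norm// /psi ge_max mulrDl mul1r.
  set y := bsgn t.2 * _ in H2 *; have := ler_norm y; have := normr_ge0 y => y0 yy.
  apply/andP; split; lra.
have psia t x : g x * ewt (- b) x / 2 <= psi t x.
  rewrite /psi le_max; apply/orP; right; rewrite ler_wpM2r//.
  exact: mixture_pdf_ge.
have psib s t x : (psi t x - psi s x) ^+ 2 <= (4 * eta ^+ 2 * E ^+ 2) * (g x * ewt c x) ^+ 2.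
  rewrite -[leLHS]real_normK ?num_real//.
  have -> : 4 * eta ^+ 2 * E ^+ 2 * (g x * ewt c x) ^+ 2 = (2 * (eta * g x * (E * ewt c x))) ^+ 2.
    by ring.
  have W0 : 0 <= eta * g x * (E * ewt c x).
    by rewrite !mulr_ge0 ?expR_ge0// ltW.
  rewrite lerXn2r ?nnegrE//; first by rewrite mulr_ge0.
  apply: le_trans (max_half_dist _ _ _) _.
  have H5 : eta * g x * (E * ewt c0 x) <= eta * g x * (E * ewt c x).
    by rewrite ler_wpM2l ?ler_wpM2l// mulr_ge0 ?ltW.
  have := Uy t x; have := Uy s x; lra.
have [|Bad [mBad PBad badP]] := likelihood_step pS r0 b0 cge0 sGs n0 iidX pi20 pi21
   (m := m) (beta := 4 * eta ^+ 2 * E ^+ 2) isT _ ipsi psia psib.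
  by apply: mulr_ge0; [apply: mulr_ge0 => //|]; exact: sqr_ge0.
exists Bad; split => // w nBw SY G sG lik hG1 hG2 hG3.
have [lam [lam1 Hlam]] := HT G Gs eta Hks sG sGs eta0 hG1.
pose rho (t : T * bool) := pi0 t.1 * (1 + bsgn t.2 * lam t.1) / 2.
have rhok t : 0 <= rho t <= 2 * pi2 t.
  exact: signed_weight.
have rho1 : \sum_t rho t = 1.
  have := sum_signed lam (fun=> 0) 1 pi01.
  rewrite [X in _ = _ + X -> _]big1 ?addr0; last by move=> t _; rewrite !mulr0.
  by under eq_bigr do rewrite mulr0 addr0 mulr1.
have mean x : \sum_t rho t * (mixture_pdf S Gs x + bsgn t.2 * (eta * g x * U t.1 x)) =
   mixture_pdf S Gs x + eta * (g x * \sum_t pi0 t * (lam t * U t x)).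
  rewrite (sum_signed lam (fun t => eta * g x * U t x) _ pi01); congr (_ + _).
  by rewrite mulrA mulr_sumr; apply: eq_bigr => t _; ring.
pose e1 : R := 2 * 2^-1 ^+ n; have e10 : 0 <= e1 by rewrite mulr_ge0// exprn_ge0.
pose e2 : R := e1 + 4 * eta ^+ 3 * E ^+ 3.
have e20 : 0 <= e2 by rewrite addr_ge0// !mulr_ge0// ?exprn_ge0// ltW.
have rem x : `|mixture_pdf S G x - (mixture_pdf S Gs x + eta * (g x * \sum_t pi0 t * (lam t * U t x)))|
   <= e1 * (g x * ewt c x).
  rewrite opprD addrA; apply: (le_trans (Hlam x)); rewrite ler_wpM2l// ler_wpM2l//.
  exact: ltW.
have rho0 t : 0 <= rho t by case/andP: (rhok t).
have h1 x : mixture_pdf S G x <= \sum_t rho t * psi t x + e1 * (g x * ewt c x).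
  have : \sum_t rho t * (mixture_pdf S Gs x + bsgn t.2 * (eta * g x * U t.1 x)) <=
      \sum_t rho t * psi t x.
    by apply: ler_sum => t _; rewrite ler_wpM2l// /psi le_max lexx.
  rewrite mean; have := rem x; rewrite ler_norml => /andP[_]; lra.
have h2 x : \sum_t rho t * psi t x <= mixture_pdf S G x + e2 * (g x * ewt c x).
  have : \sum_t rho t * psi t x - \sum_t rho t * (mixture_pdf S Gs x + bsgn t.2 * (eta * g x * U t.1 x))
     <= 4 * eta ^+ 3 * E ^+ 3 * (g x * ewt c x).
    have sumc z : z = \sum_t rho t * z by rewrite -mulr_suml rho1 mul1r.
    rewrite -sumrB [leRHS]sumc; apply: ler_sum => t _.
    rewrite -mulrBr ler_wpM2l//; apply: le_trans (max_half_excess _ (p0 x)) _.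
    have pge := mixture_pdf_ge pS x r0 sGs.
    have gb0 : 0 < g x * ewt (- gc S rad) x by rewrite mulr_gt0// expR_gt0.
    have -> : 4 * eta ^+ 3 * E ^+ 3 * (g x * ewt c x) =
      4 * (eta * g x * (E * ewt c0 x)) ^+ 3 / (g x * ewt (- gc S rad) x) ^+ 2.
      have -> : ewt c x = ewt c0 x ^+ 3 * ewt b x ^+ 2.
        by rewrite /c !exprS !expr0 !mulr1 -!ewtD; congr (ewt _ x); lra.
      rewrite /ewt mulNr expRN -/b; field.
      by rewrite !lt0r_neq0// expR_gt0.
    apply: ler_pM; rewrite ?invr_ge0 ?exprn_ge0 ?mulr_ge0 ?(ltW (p0 x))//.
      by rewrite ler_wpM2l// lerXn2r ?nnegrE// ?Uy// (le_trans _ (Uy t x)).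
    by rewrite lef_pV2 ?posrE ?exprn_gt0// lerXn2r ?nnegrE// ?(ltW (p0 x)) ?(ltW gb0).
  rewrite mean /e2 mulrDl; have := rem x; rewrite ler_norml => /andP[]; lra.
have two0 : 0 < 2 :> R by [].
have := badP w nBw SY G rho 2 e1 e2 sG lik two0 rhok rho1 e10 e20 h1 h2.
rewrite -/KK => H; apply: (local_arith _ _ KK0 mE E0 (ltW eta0) hG2 (hel_ge0 S G Gs) hG3 H) => //.
Qed.

End local_regime.

(** * Density estimation away from the true mixture *)

Section global_regime.
Context {R : realType} (d : nat).
Variables (S : 'M[R]_d).
Hypothesis pS : sym_posdef S.
Local Notation g := (gauss_pdf 0 S).
Local Notation iS := (invmx S).

Lemma expR_lipschitz (a b c : R) : a <= c -> b <= c -> `|expR a - expR b| <= `|a - b| * expR c.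
Proof.
wlog ab : a b / b <= a => [W ac bc|ac bc].
  case: (leP b a) => [/W|/ltW/W]; first exact.
  by rewrite distrC (distrC a); exact.
rewrite !ger0_norm ?subr_ge0 ?ler_expR//.
apply: le_trans (_ : (a - b) * expR a <= _); last by rewrite ler_wpM2l ?subr_ge0 ?ler_expR.
have := expR_ge1Dx (b - a); rewrite expRB.
have ea := expR_gt0 a; have -> : expR b = (expR b / expR a) * expR a.
  by rewrite divfK// lt0r_neq0.
rewrite mulfK ?lt0r_neq0//; move: (expR b / expR a) => u; nra.
Qed.

Definition lip_cst (rad : R) : R := lbound S * (1 + d%:R * rad).

Lemma gexp_lipschitz rad x th u : 0 <= rad -> norm1 th <= d%:R * rad -> norm1 u <= d%:R * rad ->
  `|gexp S x th - gexp S x u| <= lip_cst rad * norm1 (th - u) * (1 + norm1 x).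
Proof.
move=> r0 tr ur; have L0 := lbound_ge0 S; have x0 := norm1_ge0 x.
have -> : gexp S x th - gexp S x u = bil iS x (th - u) - bil iS (th - u) (th + u) / 2.
  rewrite /gexp !(bilDl, bilDr, bilNl, bilNr) (bilC u th) ?posdef_inv_sym//; lra.
have n0 := norm1_ge0 (th - u); have s0 := norm1D th u.
have H1 := bil_le iS x (th - u); have H2 := bil_le iS (th - u) (th + u).
rewrite -/(lbound S) in H1 H2.
apply: (le_trans (ler_normB _ _)); rewrite normrM (ger0_norm (_ : 0 <= 2^-1))//.
have H3 : lbound S * norm1 (th - u) * norm1 (th + u) <=
    lbound S * norm1 (th - u) * (2 * (d%:R * rad)).
  by rewrite ler_wpM2l ?mulr_ge0//; lra.
have D0 : 0 <= d%:R * rad by rewrite mulr_ge0.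
rewrite /lip_cst; set D := d%:R * rad in D0 H3 *; set L := lbound S in H1 H2 H3 L0 *.
set N := norm1 (th - u) in H1 H2 H3 n0 *; set y := norm1 x in H1 x0 *.
have LN := mulr_ge0 L0 n0.
have := mulr_ge0 LN (mulr_ge0 D0 x0); lra.
Qed.

Section grid.
Variables (rad : R) (N : nat).
Hypotheses (rad1 : 1 <= rad) (N0 : (0 < N)%N) (d0 : (0 < d)%N).
Local Notation T := {ffun 'I_d -> 'I_N.+1}.

Definition mesh : R := 2 * rad / N%:R.

Definition gridpt (f : T) : 'rV[R]_d := \row_i (mesh * (f i)%:R - rad).

Definition to_grid (th : 'rV[R]_d) : T := [ffun i => inord (Num.truncn ((th 0 i + rad) / mesh))].

Let rad_gt0 : 0 < rad := lt_le_trans ltr01 rad1.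
Let r0 : 0 <= rad := ltW rad_gt0.

Lemma mesh_gt0 : 0 < mesh.
Proof. by rewrite divr_gt0 ?ltr0n// mulr_gt0. Qed.

Lemma gridpt_coord f i : `|gridpt f 0 i| <= rad.
Proof.
rewrite mxE ler_norml; have m0 := mesh_gt0.
have NE : mesh * N%:R = 2 * rad by rewrite /mesh divfK// pnatr_eq0 -lt0n.
have fN : mesh * (f i)%:R <= mesh * N%:R.
  by rewrite ler_wpM2l ?(ltW m0)// ler_nat -ltnS.
have f0 : 0 <= mesh * (f i)%:R by rewrite mulr_ge0// ltW.
by apply/andP; split; lra.
Qed.

(** The grid fills a cube, whose points may leave the ball of radius [rad]; hence the radius
    [d%:R * rad] in the constants of this regime. *)
Lemma gridpt_enorm f : enorm (gridpt f) <= d%:R * rad.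
Proof.
rewrite -(@ler_sqr R) ?nnegrE ?enorm_ge0 ?mulr_ge0// enorm_sqr.
have dd : d%:R * rad ^+ 2 <= (d%:R * rad) ^+ 2.
  rewrite exprMn ler_wpM2r ?sqr_ge0// expr2 -[leLHS]mulr1 ler_wpM2l//.
  by rewrite ler1n.
apply: le_trans dd; rewrite mulr_natl -[d in leRHS]card_ord -sumr_const.
apply: ler_sum => i _; rewrite -expr2 -real_normK ?num_real//.
by rewrite lerXn2r ?nnegrE// gridpt_coord.
Qed.

Lemma to_grid_norm1 th : enorm th <= rad -> norm1 (th - gridpt (to_grid th)) <= d%:R * mesh.
Proof.
move=> thr; rewrite /norm1 mulr_natl -[d in leRHS]card_ord -sumr_const.
apply: ler_sum => i _; have m0 := mesh_gt0.
have := le_trans (coord_le_enorm th i) thr; rewrite ler_norml => /andP[t1 t2].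
rewrite !mxE ffunE; set y := (th 0 i + rad) / mesh.
have y0 : 0 <= y by rewrite divr_ge0 ?(ltW m0)//; lra.
have NE : mesh * N%:R = 2 * rad by rewrite /mesh divfK// pnatr_eq0 -lt0n.
have [yl yu] := andP (truncn_itv y0).
rewrite inordK; last first.
  rewrite ltnS -(ler_nat R); apply: (le_trans yl).
  by rewrite /y ler_pdivrMr// mulrC NE; lra.
have tE : th 0 i = mesh * y - rad by rewrite /y mulrC divfK ?lt0r_neq0// addrK.
rewrite tE -natr1 in yu *.
have H1 := ler_wpM2l (ltW m0) yl; have H2 := ler_wpM2l (ltW m0) (ltW yu).
by rewrite ler_norml; apply/andP; split; lra.
Qed.

Lemma gauss_pdf_grid x th : enorm th <= rad ->
  `|gauss_pdf th S x - gauss_pdf (gridpt (to_grid th)) S x| <=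
  mesh * (d%:R * lip_cst rad) * (g x * ewt (1 + gc S (d%:R * rad)) x).
Proof.
move=> thr.
have d1 : 1 <= d%:R :> R by rewrite ler1n.
have rd : rad <= d%:R * rad by rewrite -[leLHS]mul1r ler_wpM2r.
have dr0 : 0 <= d%:R * rad by rewrite mulr_ge0.
have thr' := le_trans thr rd; have gr := gridpt_enorm (to_grid th).
have g0 := gauss_pdf_gt0 pS 0 x.
rewrite (gauss_pdfE pS th x) (gauss_pdfE pS (gridpt _) x) -mulrBr normrM (gtr0_norm g0) [leRHS]mulrCA ler_wpM2l ?(ltW g0)//.
have u1 := le_trans (ler_norm _) (gexp_le S x dr0 thr').
have u2 := le_trans (ler_norm _) (gexp_le S x dr0 gr).
apply: (le_trans (expR_lipschitz u1 u2)).
rewrite -[expR _]/(ewt (gc S (d%:R * rad)) x) ewtD (mulrA (mesh * _)).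
rewrite ler_wpM2r ?expR_ge0//.
have n1 := norm1_le_enorm thr.
have n2 : norm1 (gridpt (to_grid th)) <= d%:R * rad.
  rewrite /norm1 mulr_natl -[d in leRHS]card_ord -sumr_const.
  by apply: ler_sum => i _; exact: gridpt_coord.
apply: (le_trans (gexp_lipschitz x r0 n1 n2)).
have L0 : 0 <= lip_cst rad by rewrite mulr_ge0 ?lbound_ge0// addr_ge0.
have x0 := norm1_ge0 x.
apply: ler_pM.
- by rewrite mulr_ge0// norm1_ge0.
- by rewrite addr_ge0.
- rewrite mulrCA mulrC; have := to_grid_norm1 thr => H.
  by rewrite mulrA ler_wpM2r// mulrC.
- rewrite /ewt mul1r; have := expR_ge1Dx (1 + norm1 x); lra.
Qed.

End grid.

Lemma sqr_diff_le (u v w : R) : 0 < u <= w -> 0 < v <= w -> (u - v) ^+ 2 <= w ^+ 2.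
Proof. by move=> /andP[? ?] /andP[? ?]; rewrite !expr2; nra. Qed.

(** The posterior gives each grid point the mass of the atoms of G rounded to it, under a uniform
    prior of density bound [#|{: T}|]. As [h0] is fixed, the mesh and the number of draws do not
    depend on [n], and the complexity is a constant. The conclusion fails for large [n], which
    excludes this regime. *)
Lemma global_rate (rad h0 : R) : (0 < d)%N -> 1 <= rad -> 0 < h0 ->
  exists K b c : R, [/\ 0 <= b, 0 <= c &
  forall Gs : mixing R d, supp rad Gs ->
  forall (disp : measure_display) (Omega : measurableType disp) (P : probability Omega R)
    (n : nat) (X : 'I_n -> {mfun Omega >-> d.-tuple (measurableTypeR R)}), (0 < n)%N ->
  iid_sample P X (mixture_pdf S Gs) ->
  exists Bad : set Omega, [/\ measurable Bad, (P Bad <= ((n%:R ^+ 2)^-1)%:E)%E &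
   forall w, ~ Bad w ->
     \sum_i ewt (2 * c + 2 * b) (rv_of_tuple (X i w)) <= n%:R * ewt_avg S rad b c ->
   forall (G : mixing R d), supp rad G ->
     \sum_i ln (mixture_pdf S Gs (rv_of_tuple (X i w))) <=
     \sum_i ln (mixture_pdf S G (rv_of_tuple (X i w))) ->
     h0 <= hel S G Gs -> n%:R * h0 ^+ 2 <= K + 4 * ln n%:R]].
Proof.
move=> d0 r1 h00; have r0 : 0 <= rad by lra.
have dr0 : 0 <= d%:R * rad by rewrite mulr_ge0.
pose b := gc S (d%:R * rad); have b0 : 0 <= b := gc_ge0 S dr0.
pose c := 1 + b; have c0 : 0 <= c by rewrite addr_ge0.
pose KK := 2 * ewt_avg S rad b c + mom S rad c.
have KK0 : 0 <= KK by rewrite addr_ge0 ?mulr_ge0 ?addr_ge0 ?mom_ge0.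
have h20 : 0 < h0 ^+ 2 by rewrite exprn_gt0.
(* [m] and [N] are chosen so that the variance and the two rounding errors cost at most
   [h0 ^+ 2 / 4] each. *)
pose m := (Num.truncn (4 * KK / h0 ^+ 2)).+1.
have m0 : (0 < m)%N by [].
have mm : 0 < m%:R :> R by rewrite ltr0n.
have mE : KK / m%:R <= h0 ^+ 2 / 4.
  have : 4 * KK / h0 ^+ 2 <= m%:R by rewrite ltW// truncnS_gt.
  by rewrite !ler_pdivrMr//; lra.
clearbody m; pose L := d%:R * lip_cst rad.
have L0 : 0 <= L by rewrite !mulr_ge0 ?lbound_ge0// addr_ge0.
pose N := (Num.truncn (16 * rad * L * KK / h0 ^+ 2)).+1.
have N0 : (0 < N)%N by [].
have NN : 0 < N%:R :> R by rewrite ltr0n.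
have NE : KK * (2 * (mesh rad N * L)) <= h0 ^+ 2 / 4.
  have : 16 * rad * L * KK / h0 ^+ 2 <= N%:R by rewrite ltW// truncnS_gt.
  rewrite ler_pdivrMr// /mesh => H.
  have -> : KK * (2 * (2 * rad / N%:R * L)) = (4 * rad * L * KK) / N%:R.
    by field; rewrite lt0r_neq0.
  by rewrite ler_pdivrMr//; lra.
clearbody N; pose T := {ffun 'I_d -> 'I_N.+1}.
have cT : 0 < #|{: T}|%:R :> R.
  by rewrite ltr0n; apply/card_gt0P; exists [ffun=> ord0].
exists (2 * m%:R * ln #|{: T}|%:R), b, c; split=> //.
move=> Gs sGs disp Omega P n X n0 iidX.
pose psi (t : T) := gauss_pdf (gridpt rad t) S.
pose pi0 (t : T) : R := #|{: T}|%:R^-1.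
have pi00 t : 0 <= pi0 t by rewrite invr_ge0.
have pi01 : \sum_t pi0 t = 1.
  by rewrite sumr_const -[_ *+ _]mulr_natr mulVf// lt0r_neq0.
have gx x : 0 < g x := gauss_pdf_gt0 pS 0 x.
have ge (t : T) : enorm (gridpt rad t) <= d%:R * rad by exact: (gridpt_enorm r1 N0 d0 t).
have psi_le t x : 0 < psi t x <= g x * ewt c x.
  rewrite gauss_pdf_gt0//=; apply: (le_trans (gauss_pdf_le pS x dr0 (ge t))).
  by rewrite ler_wpM2l ?(ltW (gx x))// le_ewt// /c -/b lerDr.
have ipsi t : rv_integrable (psi t).
  apply: (@rv_integrable_ewtM _ _ _ pS _ 1 c); first exact: rv_measurable_gauss.
  by move=> x; have /andP[p1 p2] := psi_le t x; rewrite gtr0_norm// mul1r.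
have psia t x : g x * ewt (- b) x / 2 <= psi t x.
  have H := gauss_pdf_ge pS x dr0 (ge t); rewrite -/b -/(psi t) in H.
  have : 0 < g x * ewt (- b) x by rewrite mulr_gt0// expR_gt0.
  lra.
have psib s t x : (psi t x - psi s x) ^+ 2 <= 1 * (g x * ewt c x) ^+ 2.
  by rewrite mul1r; exact: sqr_diff_le.
have [Bad [mBad PBad badP]] := likelihood_step pS r0 b0 c0 sGs n0 iidX pi00 pi01
   (m := m) (beta := 1) m0 ler01 ipsi psia psib.
exists Bad; split => // w nBw SY G sG lik hG.
pose f i := to_grid rad N (atom G i).
pose rho (t : T) := \sum_(i | f i == t) weight G i.
have rho_sum (F : T -> R) : \sum_t rho t * F t = \sum_i weight G i * F (f i).
  rewrite [RHS](partition_big f xpredT)//=; apply: eq_bigr => t _.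
  by rewrite mulr_suml; apply: eq_bigr => i /eqP <-.
have rho1 : \sum_t rho t = 1.
  have := rho_sum (fun=> 1); under eq_bigr do rewrite mulr1.
  by move=> ->; under eq_bigr do rewrite mulr1; exact: weight_sum1.
have rho0 t : 0 <= rho t by apply: sumr_ge0 => i _; exact: weight_ge0.
have rhok t : 0 <= rho t <= #|{: T}|%:R * pi0 t.
  rewrite rho0 /pi0 divff ?lt0r_neq0//= -rho1 (bigD1 t)//= lerDl.
  by apply: sumr_ge0.
pose e := mesh rad N * L.
have e0 : 0 <= e by rewrite mulr_ge0// ltW// mesh_gt0.
have close x : `|mixture_pdf S G x - \sum_t rho t * psi t x| <= e * (g x * ewt c x).
  rewrite rho_sum -(ev_cst G (e * _)) -[X in X - _]/(ev G (fun th => gauss_pdf th S x)).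
  rewrite -sumrB; apply: (le_trans (ler_norm_sum _ _ _)); apply: ler_sum => i _.
  rewrite -mulrBr normrM (ger0_norm (weight_ge0 i)) ler_wpM2l ?weight_ge0//.
  exact: gauss_pdf_grid.
have h1 x : mixture_pdf S G x <= \sum_t rho t * psi t x + e * (g x * ewt c x).
  by have := close x; rewrite ler_norml => /andP[_]; lra.
have h2 x : \sum_t rho t * psi t x <= mixture_pdf S G x + e * (g x * ewt c x).
  by have := close x; rewrite ler_norml => /andP[]; lra.
have := badP w nBw SY G rho _ e e sG lik cT rhok rho1 e0 e0 h1 h2.
rewrite -/KK => H.
have nn : 0 < n%:R :> R by rewrite ltr0n.
have hh : h0 ^+ 2 <= hel S G Gs ^+ 2 by rewrite lerXn2r ?nnegrE ?hel_ge0 ?(ltW h00).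
have H1 : KK * (1 / m%:R + e + e) <= h0 ^+ 2 / 2.
  rewrite -addrA mulrDr (_ : e + e = 2 * e) ?mul1r; last lra.
  by rewrite /e; lra.
have := ler_wpM2l (ltW nn) hh; have := ler_wpM2l (ltW nn) H1; rewrite [n%:R * (_ / 2)]mulrA.
move: (n%:R * (KK * _)) (n%:R * hel S G Gs ^+ 2) (n%:R * h0 ^+ 2) H => A B C H; lra.
Qed.

End global_regime.

(** * Rates of convergence *)

Lemma ln_lt_linear {R : realType} (a K : R) : 0 < a -> exists n0 : nat, forall n : nat,
  (n0 <= n)%N -> K + 4 * ln n%:R < n%:R * a.
Proof.
move=> a0; pose s0 := 1 + (`|K| + 9) / a; have s01 : 1 <= s0.
  by rewrite lerDl divr_ge0 ?addr_ge0// ltW.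
exists (Num.truncn (s0 ^+ 2)).+1 => n nn.
have n_s0 : s0 ^+ 2 <= n%:R by apply: le_trans (ltW (truncnS_gt _)) _; rewrite ler_nat.
have n0 : 0 < n%:R :> R by apply: lt_le_trans n_s0; rewrite exprn_gt0//; lra.
pose s := Num.sqrt (n%:R : R); have sE : s ^+ 2 = n%:R by rewrite sqr_sqrtr// ltW.
have ss0 : s0 <= s.
  by rewrite -(@ler_sqr R) ?nnegrE ?sqrtr_ge0 ?sE//; lra.
have s_gt0 : 0 < s by lra.
have ln_s : ln n%:R <= 2 * s.
  rewrite -sE lnXn// -[_ *+ 2]mulr_natl ler_wpM2l//.
  by have := expR_ge1Dx (ln s); rewrite lnK ?posrE//; lra.
have sa : `|K| + 9 < s * a.
  have : (`|K| + 9) / a < s by rewrite /s0 in ss0; lra.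
  by rewrite ltr_pdivrMr.
have kk := ler_norm K; have k0 := normr_ge0 K.
have -> : n%:R * a = s * (s * a) by rewrite -sE expr2 mulrA.
have H : s * (`|K| + 9) < s * (s * a) by rewrite ltr_pM2l.
rewrite mulrDr in H.
have : `|K| <= s * `|K| by rewrite ler_peMl//; lra.
lra.
Qed.

Section density_rate.
Context {R : realType} (d : nat).
Variables (S : 'M[R]_d).
Hypothesis pS : sym_posdef S.

Section exceptional_event.
Context (disp : measure_display) (Omega : measurableType disp) (P : probability Omega R).

Lemma Boole_nat (A : nat -> set Omega) (e : R) n :
  (forall k, measurable (A k) /\ (P (A k) <= e%:E)%E) ->
  measurable (\big[setU/set0]_(k < n) A k) /\
  (P (\big[setU/set0]_(k < n) A k) <= (n%:R * e)%:E)%E.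
Proof.
move=> HA; split; first by apply: bigsetU_measurable => i _; exact: (HA i).1.
apply: le_trans (Boole_inequality P (fun i _ => (HA i).1)) _.
apply: (@le_trans _ _ (\sum_(i < n) e%:E)%E); first by apply: lee_sum => i _; exact: (HA i).2.
by rewrite sumEFin sumr_const card_ord mulr_natl.
Qed.

Lemma measureU2_le (A B : set Omega) (a b : R) :
  measurable A /\ (P A <= a%:E)%E -> measurable B /\ (P B <= b%:E)%E ->
  measurable (A `|` B) /\ (P (A `|` B) <= (a + b)%:E)%E.
Proof.
move=> [mA PA] [mB PB]; split; first exact: measurableU.
by rewrite EFinD; apply: le_trans (measureU2 P mA mB) _; exact: leeD.
Qed.

Lemma ewt_average_event rad b c (Gs : mixing R d) n
   (X : 'I_n -> {mfun Omega >-> d.-tuple (measurableTypeR R)}) :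
  0 <= rad -> supp rad Gs -> (0 < n)%N -> iid_sample P X (mixture_pdf S Gs) ->
  exists A : set Omega, (measurable A /\
    (P A <= (mom S rad (2 * (2 * c + 2 * b)) / n%:R)%:E)%E) /\
  forall w, ~ A w ->
    \sum_i ewt (2 * c + 2 * b) (rv_of_tuple (X i w)) <= n%:R * ewt_avg S rad b c.
Proof.
move=> r0 sGs n0 iidX; set y := 2 * c + 2 * b.
have p0 x : 0 <= mixture_pdf S Gs x by rewrite ltW// mixture_pdf_gt0.
have ysq (x : 'rV[R]_d) : ewt y x ^+ 2 = ewt (2 * y) x.
  by rewrite expr2 -ewtD; congr (ewt _ x); lra.
exists [set w | n%:R * ewt_avg S rad b c < \sum_i ewt y (rv_of_tuple (X i w))].
split; [split|].
- have mS : measurable_fun setT (fun w => \sum_i ewt y (rv_of_tuple (X i w))).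
    by apply: measurable_sum => i; apply: measurable_sample; exact: rv_measurable_ewt.
  by rewrite -[X in measurable X]setTI; exact: measurable_fun_ltr.
- apply: (iid_chebyshev p0 (rv_integrable_mixture pS Gs) iidX n0 (rv_measurable_ewt y)).
  + by move=> x; exact: expR_ge0.
  + exact: (mixture_ewt_integrable pS r0 _ sGs).
  + by under eq_fun do rewrite ysq; exact: (mixture_ewt_integrable pS r0 _ sGs).
  + exact: (mixture_ewt_le pS r0 _ sGs).
  + apply: le_trans (mixture_ewt_le pS r0 (2 * y) sGs).
    by rewrite le_eqVlt; apply/orP; left; apply/eqP/eq_rv_int => x; rewrite ysq.
- by move=> w /negP; rewrite -leNgt.
Qed.

End exceptional_event.

(* [hel] is rounded up to a multiple of [1 / n], so that n + 1 local events suffice. *)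
Lemma density_rate rad ks : (0 < d)%N -> 1 <= rad -> exists K : R, 0 < K /\
  forall Gs : mixing R d, natoms Gs = ks -> supp rad Gs ->
  forall (disp : measure_display) (Omega : measurableType disp) (P : probability Omega R)
    (n : nat) (X : 'I_n -> {mfun Omega >-> d.-tuple (measurableTypeR R)})
    (Ghat : Omega -> mixing R d), (0 < n)%N ->
  iid_sample P X (mixture_pdf S Gs) -> (forall w, supp rad (Ghat w)) ->
  (forall w, \sum_i ln (mixture_pdf S Gs (rv_of_tuple (X i w))) <=
             \sum_i ln (mixture_pdf S (Ghat w) (rv_of_tuple (X i w)))) ->
  (mu_ext P [set w | (3 * Num.sqrt (d%:R * ln n%:R / n%:R) < hel S (Ghat w) Gs)%R]
    <= (K / n%:R)%:E)%E.
Proof.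
move=> d0 r1; have r0 : 0 <= rad by lra.
have [K1 [h0 [b1 [c1 [h00 _ _ local]]]]] := local_rate pS ks d0 r1.
have [K2 [b2 [c2 [_ _ global]]]] := global_rate pS d0 r1 h00.
pose M1 := mom S rad (2 * (2 * c1 + 2 * b1)).
pose M2 := mom S rad (2 * (2 * c2 + 2 * b2)).
have M10 : 0 <= M1 by exact: mom_ge0.
have M20 : 0 <= M2 by exact: mom_ge0.
have [n1 Hn1] := ln_lt_linear K2 (exprn_gt0 2 h00).
pose n2 := (Num.truncn (expR (1 + `|K1|))).+1.
pose n0 := maxn n1 n2.
exists (n0%:R + (3 + M1 + M2)); split.
  by rewrite ltr_wpDl//; lra.
move=> Gs Hks sGs disp Omega P n X Ghat n_gt0 iidX sGhat lik.
have nn : 0 < n%:R :> R by rewrite ltr0n.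
have [nn0|nn0] := ltnP n n0.
  (* For [n < n0] the bound [K / n] exceeds 1, because [K] is at least [n0]. *)
  apply: (@le_trans _ _ (mu_ext P setT)); first exact: le_mu_ext.
  rewrite measurable_mu_extE//= probability_setT lee_fin ler_pdivlMr// mul1r.
  have : n%:R <= n0%:R :> R by rewrite ler_nat ltnW.
  lra.
have n1n := leq_trans (leq_maxl n1 n2) nn0; have n2n := leq_trans (leq_maxr n1 n2) nn0.
have lnK1 : 1 + `|K1| <= ln n%:R.
  rewrite -[leLHS]expRK ler_ln ?posrE ?expR_gt0//.
  by apply: le_trans (ltW (truncnS_gt _)) _; rewrite ler_nat.
have etak0 (k : nat) : 0 < k.+1%:R / n%:R :> R by rewrite divr_gt0// ltr0n.
have localk k := local Gs Hks sGs disp Omega P n X n_gt0 iidX _ (etak0 k).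
pose BL k := projT1 (cid (localk k)).
have BLP k : measurable (BL k) /\ (P (BL k) <= ((n%:R ^+ 2)^-1)%:E)%E.
  by rewrite /BL; case: cid => B []; split.
have [BG [mBG PBG HBG]] := global Gs sGs disp Omega P n X n_gt0 iidX.
have [E1 [mE1 HE1]] := ewt_average_event b1 c1 r0 sGs n_gt0 iidX.
have [E2 [mE2 HE2]] := ewt_average_event b2 c2 r0 sGs n_gt0 iidX.
have [mBad PBad] := measureU2_le (measureU2_le (measureU2_le (Boole_nat n.+1 BLP) (conj mBG PBG)) mE1) mE2.
set Bad := _ `|` E2 in mBad PBad.
apply: (@le_trans _ _ (mu_ext P Bad)); last first.
  rewrite measurable_mu_extE//; apply: (le_trans PBad); rewrite lee_fin -/M1 -/M2.
  (* The [n + 1] local events and the global one, of probability [n ^- 2] each, sum up to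
     [(n + 2) / n ^ 2 <= 3 / n]. *)
  have -> : n.+1%:R * n%:R ^- 2 + n%:R ^- 2 + M1 / n%:R + M2 / n%:R =
     ((n.+1%:R + 1) / n%:R + M1 + M2) / n%:R by field; rewrite lt0r_neq0.
  rewrite ler_wpM2r ?invr_ge0 ?(ltW nn)//.
  have : (n.+1%:R + 1) / n%:R <= 3 :> R.
    rewrite ler_pdivrMr// -natr1.
    have : 1 <= n%:R :> R by rewrite ler1n.
    by lra.
  by have := ler0n R n0; lra.
apply: le_mu_ext => w /= Hw; apply: contrapT => nBad.
have nBL k : (k < n.+1)%N -> ~ BL k w.
  move=> kn Bk; apply: nBad; do 3 left; rewrite -bigcup_mkord; by exists k.
have nBG : ~ BG w by move=> ?; apply: nBad; left; left; right.
have nE1 : ~ E1 w by move=> ?; apply: nBad; left; right.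
have nE2 : ~ E2 w by move=> ?; apply: nBad; right.
set h := hel S (Ghat w) Gs in Hw.
have hge0 : 0 <= h := hel_ge0 S _ _.
have ln1 : 1 <= ln n%:R :> R by have := normr_ge0 K1; lra.
have nh : 9 * ln n%:R < n%:R * h ^+ 2.
  have d1 : 1 <= d%:R :> R by rewrite ler1n.
  have D0 : 0 <= d%:R * ln n%:R / n%:R :> R by rewrite divr_ge0 ?mulr_ge0//; lra.
  have : (3 * Num.sqrt (d%:R * ln n%:R / n%:R)) ^+ 2 < h ^+ 2.
    by rewrite ltrXn2r// nnegrE// mulr_ge0// sqrtr_ge0.
  rewrite exprMn sqr_sqrtr// -(ltr_pM2l nn).
  have -> : n%:R * (3 ^+ 2 * (d%:R * ln n%:R / n%:R)) = 9 * (d%:R * ln n%:R) :> R.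
    by field; rewrite lt0r_neq0.
  by apply: le_lt_trans; rewrite ler_wpM2l// ler_peMl//; lra.
have [h0h|hh0] := leP h0 h.
  have := HBG w nBG (HE2 w nE2) (Ghat w) (sGhat w) (lik w) h0h.
  by apply/negP; rewrite -ltNge Hn1.
pose k := Num.truncn (n%:R * h).
have nh0 : 0 <= n%:R * h by rewrite mulr_ge0// ltW.
have [kl ku] := andP (truncn_itv nh0).
have h1 : h <= 1.
  rewrite -(@ler_sqr R) ?nnegrE// expr1n.
  rewrite hel_affinity//; last exact: iid_density_int (rv_integrable_mixture pS Gs) iidX n_gt0.
  by rewrite gerBl; apply: rv_int_ge0 => x; exact: sqrtr_ge0.
have kn : (k < n.+1)%N.
  rewrite ltnS -(ler_nat R); apply: (le_trans kl).
  by rewrite -[leRHS]mulr1 ler_wpM2l// ltW.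
have hk : h <= k.+1%:R / n%:R by rewrite ler_pdivlMr// mulrC ltW.
(* Rounding up at most doubles [h], because [n * h >= 1]; the latter follows from [h <= 1] and
   [n * h ^+ 2 > 9 * ln n]. *)
have hk2 : k.+1%:R / n%:R <= 2 * h.
  rewrite ler_pdivrMr// -natr1.
  suff : 1 <= n%:R * h by move: kl; rewrite -/k; lra.
  have : h * (n%:R * h) <= 1 * (n%:R * h) by rewrite ler_wpM2r.
  by rewrite mulrCA -expr2; lra.
have := nBL k kn; rewrite /BL; case: cid => /= B [_ _ HB] nB.
have := HB w nB (HE1 w nE1) (Ghat w) (sGhat w) (lik w) hk hk2 (ltW hh0).
by rewrite -/h; have := ler_norm K1; have := normr_ge0 K1; lra.
Qed.

End density_rate.

Lemma sep_gt0_dim {R : realType} (d : nat) (G : mixing R d) : (1 < natoms G)%N ->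
  0 < sep G -> (0 < d)%N.
Proof.
move=> n1 s0; rewrite lt0n; apply/eqP => d0.
pose i0 : 'I_(natoms G) := Ordinal (ltnW n1); pose i1 : 'I_(natoms G) := Ordinal n1.
have := @sep_le _ _ G i0 i1 isT; apply/negP; rewrite -ltNge.
suff -> : enorm (atom G i0 - atom G i1) = 0 by [].
rewrite /enorm big1 ?sqrtr0// => i _.
suff : (i < 0)%N by [].
by rewrite -[X in (_ < X)%N]d0.
Qed.

(* The value 1 outside of the range of the parameters is arbitrary. *)
Definition glob_cst {R : realType} (d ks : nat) (hks : (2 <= ks)%N) (rad : R)
    (S : 'M[R]_d) (C0 D0 : R) : R :=
  if pselect ([/\ sym_posdef S, 0 < rad, 1 <= C0 & 0 < D0]) is left h then
    let: And4 pS r0 c1 D00 := h in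
    projT1 (cid (wasserstein2_hellinger pS hks r0 c1 D00))
  else 1.

Lemma avg_loglik_le {R : realType} d (S : 'M[R]_d) n (x : 'I_n -> 'rV[R]_d) G H :
  (0 < n)%N -> avg_loglik S x G <= avg_loglik S x H ->
  \sum_i ln (mixture_pdf S G (x i)) <= \sum_i ln (mixture_pdf S H (x i)).
Proof. by move=> n0; rewrite /avg_loglik ler_pM2l// invr_gt0 ltr0n. Qed.

(** The square turns the fourth root into a square root, and the factor [cg * s ^+ (2 * m)] cancels
    everything else except [cd]. A large Wasserstein distance thus forces a large Hellinger
    distance. *)
Lemma wasserstein_threshold {R : realType} (y s w h cd cg : R) (m : nat) :
  0 < cd -> 0 < cg -> 0 < s -> 0 <= y -> 0 <= w ->
  Num.sqrt (cd / cg) * y `^ (4^-1) * s ^- m < w ->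
  cg * s ^+ (2 * m) * w ^+ 2 <= h -> cd * Num.sqrt y < h.
Proof.
move=> cd0 cg0 s0 y0 w0 tw; apply: lt_le_trans.
have sm : 0 < s ^+ m by rewrite exprn_gt0.
have E : (Num.sqrt (cd / cg) * y `^ (4^-1) * s ^- m) ^+ 2 =
    cd / cg * Num.sqrt y * (s ^+ (2 * m))^-1.
  rewrite !exprMn sqr_sqrtr ?divr_ge0 ?(ltW cd0) ?(ltW cg0)//.
  have -> : (y `^ 4^-1) ^+ 2 = Num.sqrt y.
    rewrite -powR_mulrn ?powR_ge0// -powRrM (_ : 4^-1 * 2%:R = 2^-1 :> R) ?powR12_sqrt//.
    by field.
  by rewrite exprVn -exprM (mulnC m).
have : (Num.sqrt (cd / cg) * y `^ (4^-1) * s ^- m) ^+ 2 < w ^+ 2.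
  by rewrite ltrXn2r ?nnegrE// !mulr_ge0 ?sqrtr_ge0 ?powR_ge0// invr_ge0 ltW.
rewrite E => H; have c2 : 0 < cg * s ^+ (2 * m) by rewrite mulr_gt0 ?exprn_gt0.
rewrite -(ltr_pM2l c2) in H; apply: le_lt_trans H.
rewrite le_eqVlt; apply/orP; left; apply/eqP; field.
by rewrite !lt0r_neq0 ?exprn_gt0.
Qed.

Theorem theorem5 (R : realType) (d ks : nat) (hks : (2 <= ks)%N) :
  exists (Cglob : R -> 'M[R]_d -> R -> R -> R)
         (Cdens cdens : set 'rV[R]_d -> R),
  [/\ (forall (rad : R) (Sigma : 'M[R]_d) (C0 D0 : R),
        0 < rad -> sym_posdef Sigma -> 1 <= C0 -> 0 < D0 ->
        0 < Cglob rad Sigma C0 D0),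
      (forall Theta : set 'rV[R]_d, compact Theta ->
        0 < Cdens Theta /\ 0 < cdens Theta) &
  forall (rad : R) (Theta : set 'rV[R]_d) (Sigma : 'M[R]_d)
         (lmin lmax C0 D0 : R) (k : nat),
    0 < rad -> compact Theta ->
    (forall theta, Theta theta -> enorm theta <= rad) ->
    sym_posdef Sigma -> 0 < lmin -> lmin <= lmax ->
    (forall a, eigenvalue Sigma a -> lmin <= a <= lmax) ->
    1 <= C0 -> 0 < D0 -> (ks < k)%N ->
    (forall (Gs : mixing R d) (C : {set {set 'I_(natoms Gs)}}),
      true_mixing ks Theta Gs -> multi_cluster C0 D0 C ->
      forall G : mixing R d, mixing_class k Theta G ->
      Cglob rad Sigma C0 D0 * sep Gs ^+ (2 * max_cluster C - 2)
        * wasserstein2 G Gs ^+ 2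
        <= hellinger (mixture_pdf Sigma G) (mixture_pdf Sigma Gs))
    /\
    (exists K : R, 0 < K /\
      forall (Gs : mixing R d), true_mixing ks Theta Gs ->
      forall (n : nat) (disp : measure_display) (Omega : measurableType disp)
        (P : probability Omega R)
        (X : 'I_n -> {mfun Omega >-> d.-tuple (measurableTypeR R)})
        (Ghat : Omega -> mixing R d),
      (1 <= n)%N ->
      iid_sample P X (mixture_pdf Sigma Gs) ->
      (forall w, is_mle k Theta Sigma (fun i => rv_of_tuple (X i w)) (Ghat w)) ->
      (mu_ext P [set w : Omega | Cdens Theta * Num.sqrt (d%:R * ln n%:R / n%:R)
          < hellinger (mixture_pdf Sigma (Ghat w)) (mixture_pdf Sigma Gs)]%R
        <= (K * n%:R `^ (- cdens Theta))%R%:E)%E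
      /\
      forall C : {set {set 'I_(natoms Gs)}}, multi_cluster C0 D0 C ->
      (mu_ext P [set w : Omega |
          Num.sqrt (Cdens Theta / Cglob rad Sigma C0 D0)
            * (d%:R * ln n%:R / n%:R) `^ (4^-1)
            * sep Gs ^- (max_cluster C - 1)
          < wasserstein2 (Ghat w) Gs]%R
        <= (K * expR (- cdens Theta * ln n%:R))%R%:E)%E)].
Proof.
exists (glob_cst hks), (fun=> 3), (fun=> 1); split.
- move=> rad S C0 D0 r0 pS c1 D00; rewrite /glob_cst.
  by case: pselect => // -[? ? ? ?]; case: cid => c [].
- by [].
move=> rad Theta S lmin lmax C0 D0 k r0 _ Theta_le pS _ _ _ c1 D00 ksk.
have cg0 : 0 < glob_cst hks rad S C0 D0.
  by rewrite /glob_cst; case: pselect => // -[? ? ? ?]; case: cid => c [].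
have part1 (Gs : mixing R d) (C : {set {set 'I_(natoms Gs)}}) :
    true_mixing ks Theta Gs -> multi_cluster C0 D0 C ->
    forall G : mixing R d, mixing_class k Theta G ->
    glob_cst hks rad S C0 D0 * sep Gs ^+ (2 * max_cluster C - 2) * wasserstein2 G Gs ^+ 2
    <= hellinger (mixture_pdf S G) (mixture_pdf S Gs).
  move=> [Gk GT w0 s0] mc G [_ GT']; rewrite /glob_cst.
  case: pselect => [[? ? ? ?]|]; last by case; split.
  case: cid => c /= [_ Hc]; apply: Hc => //.
  - by move=> i; exact: Theta_le.
  - by move=> i; exact: Theta_le.
split=> //.
have [d0|d0] := posnP d.
  (* In dimension 0 all atoms coincide, so that no true mixing measure with at least two atoms has a
     positive [sep]. *)
  exists 1; split=> // Gs [Gk _ _ s0]; exfalso.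
  suff : (0 < d)%N by rewrite d0.
  by apply: sep_gt0_dim s0; rewrite Gk.
pose rad1 := 1 + rad; have r1 : 1 <= rad1 by rewrite lerDl ltW.
have [K [K0 HK]] := density_rate pS ks d0 r1.
exists K; split=> // Gs tGs n disp Omega P X Ghat n0 iidX mle.
have [Gk GT w0 s0] := tGs.
have supp1 G : (forall i, Theta (atom G i)) -> supp rad1 G.
  move=> TG i; apply: (le_trans (Theta_le _ (TG i))); rewrite /rad1; lra.
have nn : 0 < n%:R :> R by rewrite ltr0n.
(* The true measure competes in the maximization, as [ks < k]; this gives the likelihood
   inequality. *)
have Gs_class : mixing_class k Theta Gs.
  by split=> //; rewrite Gk (ltnW hks) ltnW.
have dens : (mu_ext P [set w | (3 * Num.sqrt (d%:R * ln n%:R / n%:R) < hel S (Ghat w) Gs)%R]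
    <= (K / n%:R)%:E)%E.
  apply: (HK Gs Gk (supp1 _ GT) _ _ P n X) => // w.
    by apply: supp1; have [[]] := mle w.
  by apply: avg_loglik_le => //; exact: (mle w).2.
split; first by rewrite powR_inv1// ltW.
move=> C mc; rewrite mulN1r expRN lnK ?posrE//.
apply: le_trans dens; apply: le_mu_ext => w /= Hw.
have y0 : 0 <= d%:R * ln n%:R / n%:R :> R.
  by rewrite divr_ge0 ?mulr_ge0 ?(ltW nn)// ln_ge0// ler1n.
have W0 := wasserstein2_ge0 (Ghat w) Gs.
have cd0 : 0 < 3 :> R by [].
apply: (wasserstein_threshold cd0 cg0 s0 y0 W0 Hw).
by rewrite mulnBr muln1; apply: part1 => //; have [] := mle w.
Qed.
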